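(* Let $d\in\mathbb{N}$, $l\in\mathbb{N}$, $\alpha>0$, $\Omega\in\Phi_{\alpha,l}$, and $1\leqslant\theta\leqslant\infty$. Then for $(p,q)\in\{(1,1),(\infty,\infty)\}$ $$\mathcal{E}_n\big(B^{\Omega}_{p,\theta}(\mathbb{R}^d)\big)_{L_{q}(\mathbb{R}^d)}\asymp \Omega(2^{-n}),$$ that is, there exist constants $c,C>0$, independent of $n$ (they may depend on $d,p,\theta,\alpha,l,\Omega$), such that for all $n\in\mathbb{N}$ $$c\,\Omega(2^{-n})\leqslant \mathcal{E}_n\big(B^{\Omega}_{p,\theta}(\mathbb{R}^d)\big)_{L_{q}(\mathbb{R}^d)}\leqslant C\,\Omega(2^{-n}).$$
   Context: $L_p(\mathbb{R}^d)$, $1\leqslant p\leqslant\infty$, is the usual Lebesgue space of (complex-valued) functions with its usual norm. **The set $\Phi_{\alpha,l}$** ($\alpha>0$, $l\in\mathbb{N}$). It consists of all continuous functions $\Omega:[0,\infty)\to[0,\infty)$ such that: (1) $\Omega(0)=0$ and $\Omega(t)>0$ for $t>0$; (2) $\Omega$ is nondecreasing; (3) there is $C_1>0$ with $\Omega(nt)\leqslant C_1n^l\Omega(t)$ for all $n\in\mathbb{Z}_+$ and $t\geqslant 0$; $(S^{\alpha})$ $\Omega(\tau)/\tau^{\alpha}$ is almost increasing: there is $C_2>0$ with $\Omega(\tau_1)/\tau_1^{\alpha}\leqslant C_2\,\Omega(\tau_2)/\tau_2^{\alpha}$ for all $0<\tau_1\leqslant\tau_2\leqslant 1$; $(S_l)$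 there are $\gamma$ with $0<\gamma<l$ and $C_3>0$ such that $\Omega(\tau_1)/\tau_1^{l-\gamma}\geqslant C_3\,\Omega(\tau_2)/\tau_2^{l-\gamma}$ for all $0<\tau_1\leqslant\tau_2\leqslant1$. **De la Vallée Poussin sums.** For $s\in\mathbb{Z}_+=\{0,1,2,\dots\}$ let $$V_{2^s}(\boldsymbol{x})=\frac{1}{2^{sd}}\prod_{j=1}^{d}\frac{\cos 2^s x_j-\cos 2^{s+1}x_j}{x_j^2},\qquad \boldsymbol{x}\in\mathbb{R}^d,$$ which belongs to $L_1(\mathbb{R}^d)\cap L_\infty(\mathbb{R}^d)$. For $f\in L_p(\mathbb{R}^d)$, $1\leqslant p\leqslant\infty$, put $$\sigma_{2^s}(f,\boldsymbol{x})=\frac{1}{\pi^d}\int_{\mathbb{R}^d}V_{2^s}(\boldsymbol{x}-\boldsymbol{u})f(\boldsymbol{u})\,d\boldsymbol{u},$$ $q_0(f,\cdot)=\sigma_{2^0}(f,\cdot)$, and $q_s(f,\cdot)=\sigma_{2^s}(f,\cdot)-\sigma_{2^{s-1}}(f,\cdot)$ for $s\in\mathbb{N}$. **The class $B^{\Omega}_{p,\theta}(\mathbb{R}^d)$.** For $1\leqslant p,\theta\leqslant\infty$ it is the unit ball $\{f\in L_p(\mathbb{R}^d):\|f\|_{B^{\Omega}_{p,\theta}(\mathbb{R}^d)}\leqslant 1\}$, where $$\|f\|_{B^{\Omega}_{p,\theta}(\mathbb{R}^d)}=\Big(\sum_{s=0}^{\infty}\big(\Omega(2^{-s})\big)^{-\theta}\|q_s(f,\cdot)\|^{\theta}_{L_p(\mathbb{R}^d)}\Big)^{1/\theta}\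 (1\leqslant\theta<\infty),\qquad \|f\|_{B^{\Omega}_{p,\infty}(\mathbb{R}^d)}=\sup_{s\geqslant0}\big(\Omega(2^{-s})\big)^{-1}\|q_s(f,\cdot)\|_{L_p(\mathbb{R}^d)}.$$ **Approximation quantity.** For $n\in\mathbb{N}$ let $\mathbb{V}_{n-1}(f,\cdot)=\sum_{s=0}^{n-1}q_s(f,\cdot)$, $\mathcal{E}_n(f)_{L_q(\mathbb{R}^d)}=\|f-\mathbb{V}_{n-1}(f,\cdot)\|_{L_q(\mathbb{R}^d)}$, and for a class $F\subset L_q(\mathbb{R}^d)$, $\mathcal{E}_n(F)_{L_q(\mathbb{R}^d)}=\sup_{f\in F}\mathcal{E}_n(f)_{L_q(\mathbb{R}^d)}$. *)

(* Defs.v *)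
From HB Require Import structures.
From mathcomp Require Import all_boot all_order all_algebra.
From mathcomp Require Import all_classical all_reals all_analysis.
From mathcomp Require Import complex.

Set Implicit Arguments.
Unset Strict Implicit.
Unset Printing Implicit Defensive.

Import Order.TTheory GRing.Theory Num.Theory.
Import numFieldNormedType.Exports.

Local Open Scope classical_set_scope.
Local Open Scope ring_scope.

(* [mathcomp.real_closed.complex] and the numeric hierarchy both declare
   [Re]/[Im]; here these are always the R-valued projections of [R[i]]. *)
Local Notation reC := complex.Re.
Local Notation imC := complex.Im.

(** ** The measure space R^d *)

(* R^n with the product sigma-algebra of the Borel sigma-algebras, i.e. with
   its Borel sets. *)
Notation Rn R n := (n.-tuple (measurableTypeR R)).

Definition coordRn (R : realType) n (x : Rn R n) (j : 'I_n) : R := tnth x j.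

Definition subRn (R : realType) n (x u : Rn R n) : Rn R n :=
  [tuple (coordRn x j - coordRn u j : measurableTypeR R) | j < n].

Section lebesgue_Rn.
Variable R : realType.

Definition cons_Rn n (xt : measurableTypeR R * Rn R n) : Rn R n.+1 :=
  [the n.+1.-tuple _ of xt.1 :: xt.2].

Lemma measurable_cons_Rn n : measurable_fun setT (@cons_Rn n).
Proof. exact: (measurable_cons measurable_fst measurable_snd). Qed.

Definition uncons_Rn n (x : Rn R n.+1) : measurableTypeR R * Rn R n :=
  (tnth x ord0, [tuple of behead x]).

Lemma measurable_uncons_Rn n : measurable_fun setT (@uncons_Rn n).
Proof.
apply: measurable_fun_pair; first exact: measurable_tnth.
exact: measurable_behead.
Qed.

Lemma cons_RnK n : cancel (@cons_Rn n) (@uncons_Rn n).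
Proof.
by move=> [x t]; rewrite /uncons_Rn /cons_Rn; congr pair; apply/val_inj.
Qed.

Section step.
Variables (n : nat) (m : {sigma_finite_measure set (Rn R n) -> \bar R}).

Definition lebesgue_cons : set (Rn R n.+1) -> \bar R :=
  pushforward (@lebesgue_measure R \x m)%E (@cons_Rn n).

HB.instance Definition _ := isMeasurableFun.Build _ _ _ _ (@cons_Rn n)
  (@measurable_cons_Rn n).

Let lebesgue_cons0 : lebesgue_cons set0 = 0%E.
Proof. exact: measure0. Qed.

Let lebesgue_cons_ge0 A : (0 <= lebesgue_cons A)%E.
Proof. exact: measure_ge0. Qed.

Let lebesgue_cons_sigma_additive : semi_sigma_additive lebesgue_cons.
Proof. exact: measure_semi_sigma_additive. Qed.

HB.instance Definition _ := isMeasure.Build _ _ _ lebesgue_cons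
  lebesgue_cons0 lebesgue_cons_ge0 lebesgue_cons_sigma_additive.

Let lebesgue_cons_sigma_finite : sigma_finite setT lebesgue_cons.
Proof.
have /sigma_finiteP[F [TF ndF Foo]] := sigma_finiteT (@lebesgue_measure R).
have /sigma_finiteP[G [TG ndG Goo]] := sigma_finiteT m.
exists (fun i => @uncons_Rn n @^-1` (F i `*` G i)).
  apply/esym; rewrite -subTset => x _.
  have [i _ Fi] : (\bigcup_i F i) (uncons_Rn x).1 by rewrite -TF.
  have [j _ Gj] : (\bigcup_i G i) (uncons_Rn x).2 by rewrite -TG.
  exists (maxn i j) => //; split.
  - by move: Fi; exact/subsetPset/ndF/leq_maxl.
  - by move: Gj; exact/subsetPset/ndG/leq_maxr.
move=> i; have [mF Fy] := Foo i; have [mG Gy] := Goo i; split.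
  by rewrite -[X in measurable X]setTI; apply: measurable_uncons_Rn => //;
    exact: measurableX.
rewrite /lebesgue_cons /pushforward -comp_preimage.
rewrite (_ : _ \o _ = id) ?preimage_id; last first.
  by apply/funext; exact: cons_RnK.
by rewrite product_measure1E// lte_mul_pinfty// ge0_fin_numE.
Qed.

HB.instance Definition _ := Measure_isSigmaFinite.Build _ _ _ lebesgue_cons
  lebesgue_cons_sigma_finite.

End step.

(* d-dimensional Lebesgue measure: the d-fold product of the Lebesgue measure
   of the line, transported along (x, t) |-> x :: t at each step. *)
Fixpoint lebesgue_Rn (n : nat) : {sigma_finite_measure set (Rn R n) -> \bar R} :=
  match n with
  | 0 => \d_([tuple] : Rn R 0)
  | n'.+1 => lebesgue_cons (lebesgue_Rn n')
  end.

End lebesgue_Rn.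

(** ** Complex-valued functions and the spaces L_p(R^d) *)

Section besov.
Variables (R : realType) (d : nat).
Implicit Types (f : Rn R d -> R[i]) (p theta : \bar R).

Definition Cintegral f : R[i] :=
  Complex (\int[lebesgue_Rn R d]_u (reC (f u)))
          (\int[lebesgue_Rn R d]_u (imC (f u))).

(* For a complex number z, [`|z|] is its modulus seen as an element of [R[i]]. *)
Definition normLp p f : \bar R :=
  Lnorm (lebesgue_Rn R d) p (fun x => (reC `|f x|)%:E).

Definition Lp p : set (Rn R d -> R[i]) :=
  [set f | [/\ measurable_fun setT (fun x => reC (f x)),
                measurable_fun setT (fun x => imC (f x)) &
                (normLp p f < +oo)%E]].

(** ** De la Vallee Poussin sums *)

(* On the null set where some coordinate vanishes, division by 0 gives the
   junk value 0 instead of the limit; no integral below is affected. *)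
Definition VP (s : nat) (x : Rn R d) : R :=
  (2 ^+ (s * d))^-1 *
  \prod_(j < d) ((cos (2 ^+ s * coordRn x j) - cos (2 ^+ s.+1 * coordRn x j))
                 / coordRn x j ^+ 2).

Definition sigmaVP (s : nat) f : Rn R d -> R[i] := fun x =>
  ((pi ^+ d)^-1)%:C%C * Cintegral (fun u => (VP s (subRn x u))%:C%C * f u).

Definition qVP (s : nat) f : Rn R d -> R[i] :=
  if s is s'.+1 then sigmaVP s f - sigmaVP s' f else sigmaVP 0 f.

(** ** The class of functions Omega *)

(* Only the restriction of Omega to [0, +oo[ is constrained. *)
Record Phi (alpha : R) (l : nat) (Omega : R -> R) : Prop := {
  Phi_continuous : {within `[0, +oo[, continuous Omega} ;
  Phi_ge0 : forall t : R, 0 <= t -> 0 <= Omega t ;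
  Phi_at0 : Omega 0 = 0 ;
  Phi_gt0 : forall t : R, 0 < t -> 0 < Omega t ;
  Phi_nondecreasing : forall t1 t2 : R, 0 <= t1 -> t1 <= t2 -> Omega t1 <= Omega t2 ;
  Phi_dilation : exists2 C1 : R, 0 < C1 &
    forall (n : nat) (t : R), 0 <= t -> Omega (n%:R * t) <= C1 * n%:R ^+ l * Omega t ;
  Phi_S_alpha : exists2 C2 : R, 0 < C2 &
    forall t1 t2 : R, 0 < t1 -> t1 <= t2 -> t2 <= 1 ->
      Omega t1 / t1 `^ alpha <= C2 * (Omega t2 / t2 `^ alpha) ;
  Phi_S_l : exists gamma C3 : R, [/\ 0 < gamma, gamma < l%:R, 0 < C3 &
    forall t1 t2 : R, 0 < t1 -> t1 <= t2 -> t2 <= 1 ->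
      Omega t1 / t1 `^ (l%:R - gamma) >= C3 * (Omega t2 / t2 `^ (l%:R - gamma))]
}.

(** ** Besov classes and approximation *)

(* The last case is never used: theta ranges over [1, +oo]. *)
Definition normB (Omega : R -> R) p theta f : \bar R :=
  match theta with
  | r%:E => ((\sum_(0 <= s <oo)
      ((Omega (2 ^- s)) `^ (- r))%:E * normLp p (qVP s f) `^ r) `^ r^-1)%E
  | +oo%E => ereal_sup
      (range (fun s : nat => ((Omega (2 ^- s))^-1)%:E * normLp p (qVP s f))%E)
  | -oo%E => 0%E
  end.

Definition Bclass (Omega : R -> R) p theta : set (Rn R d -> R[i]) :=
  [set f | Lp p f /\ (normB Omega p theta f <= 1)%E].

(* [partialVP n f] is V_{n-1}(f). *)
Definition partialVP (n : nat) f : Rn R d -> R[i] := \sum_(s < n) qVP s f.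

Definition approxE (q : \bar R) (n : nat) f : \bar R :=
  normLp q (f - partialVP n f).

Definition approxE_class (q : \bar R) (n : nat) (F : set (Rn R d -> R[i])) :
    \bar R :=
  ereal_sup [set approxE q n f | f in F].

End besov.

(* Main.v *)
(* Upper bound.  The integrals of sigma_{2^N}(f) over boxes converge to those of
   f (Fubini moves the kernel onto the indicator of the box), so summability of
   the integrals of |q_s(f)| over boxes forces f - V_{n-1}(f) to be dominated
   a.e. by the sum of the |q_s(f)|, s >= n, up to a factor 2 for real and
   imaginary parts.  On the class, ||q_s(f)||_p <= Omega(2^-s), and (S^alpha)
   turns the tail of these bounds into a geometric series.

   Lower bound.  Take f with spectrum in [2^n, 2^{n+1}]: then V_{n-1}(f) = 0,
   sigma_{2^s}(f) = f for s > n, and only q_n(f), q_{n+1}(f) survive.  For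
   p = oo a multiple of exp(i 2^n x_1) works.  For p = 1 use the tensor power of
   cos(3 2^{n-1} x) (1 - cos(2^{n-1} x)) / x^2, a superposition of frequencies
   between 2^n and 2^{n+1}; Young's inequality with ||K_n||_1 <= 3 pi for the
   one-dimensional kernel K_n controls q_n(f) and q_{n+1}(f). *)

From HB Require Import structures.
Require Import Defs.
From mathcomp Require Import all_boot all_order all_algebra.
From mathcomp Require Import all_classical all_reals all_analysis.
From mathcomp Require Import measurable_realfun ess_sup_inf complex zify ring lra.

Set Implicit Arguments.
Unset Strict Implicit.
Unset Printing Implicit Defensive.

Import Order.TTheory GRing.Theory Num.Theory.
Import numFieldNormedType.Exports.

Local Open Scope classical_set_scope.
Local Open Scope ring_scope.

Local Notation reC := complex.Re.
Local Notation imC := complex.Im.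

(** The upper bound cannot start from f being the sum of its q_s(f). Membership in the class makes
    that series converge in norm, but does not say that the sum is f, and for p = oo the sums
    sigma_{2^N}(f) of a general f need not converge to f in norm. Testing on boxes to identify the
    limit asks only that f times the product of the 1 / (1 + x_j^2) be integrable. This covers L_1
    and L_oo at once, with no density argument and no Lebesgue points. The price is a bound, uniform
    in s, for the kernel integrated over a box. No Fourier transform is defined either. Each
    one-dimensional factor of the kernel is a difference of two Fejer kernels (1 - cos(lam y)) /
    y^2, of integral pi |lam|. A product with a cosine is again a combination of such kernels, so
    the multiplier of sigma_{2^s} is an explicit piecewise linear function. For p = 1 the block
    q_{n+1}(f) must be compared with Omega(2^-(n+1)) although f is scaled by Omega(2^-n).
    Monotonicity goes the wrong way there, and the dilation condition (3) with factor 2 is what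
    helps. *)

Section fubini_tonelli_in.
Context d1 d2 (T1 : measurableType d1) (T2 : measurableType d2) (R : realType).
Variables (m1 : {sigma_finite_measure set T1 -> \bar R})
  (m2 : {sigma_finite_measure set T2 -> \bar R}).
Variable f : T1 * T2 -> \bar R.
Hypotheses (mf : measurable_fun setT f) (f0 : forall z, (0 <= f z)%E).

(** Extension by zero reduces a rectangle to the whole product. The Fejer integral below is a double
    integral over a quarter plane. *)
Lemma fubini_tonelli_in (A : set T1) (B : set T2) : measurable A -> measurable B ->
  (\int[m1]_(x in A) \int[m2]_(y in B) f (x, y) =
   \int[m2]_(y in B) \int[m1]_(x in A) f (x, y))%E.
Proof.
move=> mA mB.
have mAB : measurable (A `*` B) by exact: measurableX.
have mg : measurable_fun setT (f \_ (A `*` B)).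
  by apply/(measurable_restrictT _ mAB); exact: measurable_funTS.
have g0 z : (0 <= (f \_ (A `*` B)) z)%E by apply: erestrict_ge0.
have := fubini_tonelli (m1 := m1) (m2 := m2) _ mg g0.
have E (x : T1) (y : T2) : (f \_ (A `*` B)) (x, y) = 
   if x \in A then if y \in B then f (x, y) else 0%E else 0%E.
  by rewrite patchE in_setX/=; case: ifP => //= [/andP[-> ->//]|]; case: ifP => //= _; case: ifP.
move=> H; rewrite [LHS]integral_mkcond [RHS]integral_mkcond (eq_integral (fun x => \int[m2]_y (f \_ (A `*` B)) (x, y)))%E.
  rewrite H; apply: eq_integral => y _; rewrite patchE; case: ifPn => yB.
    rewrite [RHS]integral_mkcond; apply: eq_integral => x _.
    by rewrite E patchE yB.
  transitivity (0 : \bar R)%E => //; apply: integral0_eq => x _.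
  by rewrite E (negbTE yB); case: ifP.
move=> x _; rewrite patchE; case: ifPn => xA.
  rewrite integral_mkcond; apply: eq_integral => y _.
  by rewrite E patchE xA.
transitivity (0 : \bar R)%E => //; apply/esym; apply: integral0_eq => y _.
by rewrite E (negbTE xA).
Qed.

End fubini_tonelli_in.

(** * The Fejer integral *)

Section fejer_integral.
Context {R : realType}.
Let mu := @lebesgue_measure R.
Implicit Types (x t lam : R).

Lemma derivable_continuous (f : R -> R) : (forall x, derivable f x 1) -> continuous f.
Proof.
by move=> df x; apply: differentiable_continuous; exact/derivable1_diffP.
Qed.

Lemma ge0_integral0y_FTC (f F : R -> R) (l : R) :
  (forall x, 0 <= x -> 0 <= f x) -> continuous f ->
  (forall x, is_derive x 1 F (f x)) -> F x @[x --> +oo] --> l ->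
  (\int[mu]_(x in `[0%R, +oo[) (f x)%:E = (l - F 0)%:E)%E.
Proof.
move=> f0 cf dF Fl; apply: ge0_continuous_FTC2y => //.
- exact: continuous_subspaceT.
- apply: cvg_at_right_filter; apply: differentiable_continuous.
  by apply/derivable1_diffP; have ? := dF 0; exact: ex_derive.
- by move=> x _; have ? := dF x; rewrite derive1E; exact: derive_val.
Qed.

(** [expR (t * x)] dominates both [t * x] and [(t * x) ^+ 2 / 2]: the first absorbs the constant
    part of the linear bound on [g], the second its linear part, and each leaves a factor 1/x. *)
Lemma cvgy0_expRM t (g : R -> R) (C : R) : 0 < t ->
  (forall x, 0 <= x -> `|g x| <= C * (1 + x)) ->
  (fun x => g x * expR (- (t * x))) x @[x --> +oo] --> 0.
Proof.
move=> t0 gC.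
have C0 : 0 <= C by have := gC 0 (lexx _); rewrite addr0 mulr1; exact: le_trans.
pose B := C * (t^-1 + 2 / t ^+ 2).
have bd x : 0 < x -> `|g x * expR (- (t * x))| <= 2 * B * x^-1.
  move=> x0; rewrite normrM (ger0_norm (expR_ge0 _)) expRN.
  have tx0 : 0 < t * x by rewrite mulr_gt0.
  have := expR_ge1Dxn 1 (ltW tx0); rewrite (_ : 2`!%:R = 2) => [|//].
  have h2 : 1 + (t*x) <= expR (t * x) by exact: expR_ge1Dx.
  move=> h1.
  rewrite ler_pdivrMr ?expR_gt0//.
  apply: (le_trans (gC _ (ltW x0))).
  have -> : 2 * B * x^-1 * expR (t * x) = C * ((2 * (t^-1 + 2 / t ^+ 2) / x) * expR (t*x)).
    by rewrite /B; ring.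
  rewrite ler_wpM2l//.
  apply: (@le_trans _ _ ((t^-1 / x + 2 / t^+2 / x)* expR (t*x))); last first.
    apply: ler_wpM2r; first exact: expR_ge0.
    have q0 : 0 <= (t^-1 + 2 / t ^+ 2) / x.
      by rewrite mulr_ge0 ?addr_ge0 ?mulr_ge0 ?invr_ge0 ?exprn_ge0 ?ltW.
    rewrite [leRHS](_ : _ = (t^-1 + 2 / t ^+ 2) / x + (t^-1 + 2 / t ^+ 2) / x); last by ring.
    by rewrite -mulrDl lerDl.
  rewrite mulrDl; apply: lerD.
    have : t^-1 / x * (t * x) <= t^-1 / x * expR (t*x).
      rewrite ler_wpM2l// ?divr_ge0 ?invr_ge0 ?ltW//.
      by apply: lt_le_trans h2; rewrite ltrDr.
    by rewrite [X in X <= _ -> _](_ : _ = 1)//; field; rewrite !gt_eqF.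
  have : 2 / t ^+ 2 / x * ((t * x) ^+ 2 / 2) <= 2 / t ^+ 2 / x * expR (t*x).
    rewrite ler_wpM2l// ?divr_ge0 ?exprn_ge0 ?ltW//.
    by apply: lt_le_trans h1; rewrite ltrDr.
  rewrite [X in X <= _ -> _](_ : _ = x)//; field; by rewrite !gt_eqF.
apply/cvgr0Pnorm_le => /= e e0; near=> x.
have x0 : 0 < x by near: x; exact: nbhs_pinfty_gt.
apply: (le_trans (bd _ x0)).
rewrite (ler_pdivrMr _ _ x0) -(ler_pdivrMl _ _ e0).
near: x; apply: nbhs_pinfty_ge; exact: num_real.
Unshelve. all: by end_near. Qed.

(** Used from right to left: the denominator of the Fejer kernel becomes a Laplace transform. *)
Lemma integral_xexpR x : 0 < x ->
  (\int[mu]_(t in `[0%R, +oo[) (t * expR (- (x * t)))%:E = (x ^- 2)%:E)%E.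
Proof.
move=> x0.
pose F : R -> R := fun t => - (t / x + x ^- 2) * expR (- (x * t)).
transitivity ((0 - F 0)%:E); last first; [|apply: (@ge0_integral0y_FTC (fun t : R => t * expR (- (x * t))) F); rewrite /F].
- by rewrite /F mulr0 mul0r oppr0 expR0; congr EFin; ring.
- by move=> t t0; rewrite mulr_ge0 ?expR_ge0.
- by apply: derivable_continuous => t; exact: ex_derive.
- move=> t; apply: is_derive_eq.
  rewrite /GRing.scale/=. field. by rewrite gt_eqF.
- apply: (@cvgy0_expRM _ _ (x^-1 + x^-2)) => // t t0.
  have x10 : 0 <= x^-1 by rewrite invr_ge0 ltW.
  have x20 : 0 <= x^-2 by rewrite invr_ge0 exprn_ge0 ?ltW.
  rewrite normrN ger0_norm; last by rewrite addr_ge0 ?mulr_ge0.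
  rewrite -subr_ge0 (_ : _ - _ = x^-1 + x^-2 * t); last by ring.
  by rewrite addr_ge0 ?mulr_ge0.
Qed.

(** The Laplace transform of 1 - cos(lam x) is 1/t - t / (t^2 + lam^2), here over a common
    denominator. *)
Lemma integral_1Bcos_expR lam t : 0 < t ->
  (\int[mu]_(x in `[0%R, +oo[) ((1 - cos (lam * x)) * expR (- (t * x)))%:E =
   (lam ^+ 2 / (t * (t ^+ 2 + lam ^+ 2)))%:E)%E.
Proof.
move=> t0.
have tl : 0 < t ^+ 2 + lam ^+ 2.
  by rewrite ltr_pwDl ?exprn_gt0 ?sqr_ge0.
pose F : R -> R := fun x => (- t^-1 + (t ^+ 2 + lam ^+ 2)^-1 * (t * cos (lam * x) - lam * sin (lam * x)))
        * expR (- (t * x)).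
transitivity ((0 - F 0)%:E); last first; [|apply: (@ge0_integral0y_FTC (fun x : R => (1 - cos (lam * x)) * expR (- (t * x))) F); rewrite /F].
- congr EFin; rewrite /F !mulr0 cos0 sin0 oppr0 expR0; field.
  by rewrite !gt_eqF.
- by move=> x x0; rewrite mulr_ge0 ?expR_ge0// subr_ge0 cos_le1.
- by apply: derivable_continuous => x; exact: ex_derive.
- move=> x; apply: is_derive_eq.
  rewrite /GRing.scale/=. field. by rewrite !gt_eqF.
- apply: (@cvgy0_expRM _ _ (t^-1 + (t ^+ 2 + lam ^+ 2)^-1 * (t + `|lam|))) => // x x0.
  rewrite [leRHS]mulrDr mulr1 ler_wpDr//.
    by rewrite mulr_ge0// addr_ge0 ?mulr_ge0 ?addr_ge0 ?invr_ge0 ?(ltW t0) ?(ltW tl).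
  rewrite (le_trans (ler_normD _ _))// normrN ger0_norm ?invr_ge0 ?(ltW t0)// lerD2l.
  rewrite normrM ger0_norm ?invr_ge0 ?(ltW tl)// ler_wpM2l ?invr_ge0 ?(ltW tl)//.
  rewrite (le_trans (ler_normB _ _))// !normrM lerD//.
    by rewrite ger0_norm ?(ltW t0)// ler_piMr ?(ltW t0)// cos_max.
  by rewrite ler_piMr// sin_max.
Qed.

Lemma derivable_cauchy lam : 0 < lam ->
  forall t, derivable (fun t => lam ^+ 2 / (t ^+ 2 + lam ^+ 2)) t 1.
Proof.
move=> l0 t; apply: derivableM => //; apply: derivableV => //.
by rewrite gt_eqF// ltr_wpDl ?exprn_gt0 ?sqr_ge0.
Qed.

Lemma integral_cauchy lam : 0 < lam ->
  (\int[mu]_(t in `[0%R, +oo[) (lam ^+ 2 / (t ^+ 2 + lam ^+ 2))%:E =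
   (lam * (pi / 2))%:E)%E.
Proof.
move=> l0.
have tl t : 0 < t ^+ 2 + lam ^+ 2.
  by rewrite ltr_wpDl ?exprn_gt0 ?sqr_ge0.
pose F : R -> R := fun t => lam * atan (lam^-1 * t).
transitivity (((lam * (pi / 2)) - F 0)%:E); last first; [|apply: (@ge0_integral0y_FTC (fun t : R => lam ^+ 2 / (t ^+ 2 + lam ^+ 2)) F); rewrite /F].
- by rewrite /F mulr0 atan0 mulr0 subr0.
- by move=> t _; rewrite divr_ge0 ?sqr_ge0 ?(ltW (tl t)).
- exact: derivable_continuous (derivable_cauchy l0).
- move=> t; apply: is_derive_eq; rewrite /GRing.scale/=; field.
  rewrite !gt_eqF//.
- apply: cvgM; first exact: cvg_cst.
  apply: (cvg_comp (fun t => lam^-1 * t) atan); last exact: cvgy_atan.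
  apply: gt0_cvgMry; first by rewrite invr_gt0. exact: cvg_id.
Qed.

Definition reflectR (c : R) (u : measurableTypeR R) : measurableTypeR R := c - u.

Lemma measurable_reflectR c : measurable_fun setT (reflectR c).
Proof. by apply: measurable_funB => //; exact: measurable_id. Qed.

HB.instance Definition _ c := isMeasurableFun.Build _ _ _ _ (reflectR c)
  (measurable_reflectR c).

(** Comparison on the intervals []a, b]] is enough, and reflection turns them into [[c - b, c - a[],
    of the same length. This is the change of variables of a convolution. *)
Lemma pushforward_reflectR c (A : set (measurableTypeR R)) : measurable A ->
  pushforward mu (reflectR c) A = mu A.
Proof.
move=> mA; apply/esym.
apply: (@lebesgue_measure_unique R (pushforward mu (reflectR c))) => // X [[a b] _ <-] /=.
rewrite /pushforward (_ : _ @^-1` _ = [set` `[c - b, c - a[ ]).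
  rewrite !lebesgue_measure_itv/= !lte_fin ltrD2l ltrN2 -!EFinB.
  by case: ifP => // _; congr EFin; ring.
apply/seteqP; split => u /=; rewrite /reflectR !in_itv/= => /andP[h1 h2]; apply/andP; split; lra.
Qed.

Lemma ge0_integral_reflect c (f : R -> R) : measurable_fun setT f ->
  (forall x, 0 <= f x) ->
  (\int[mu]_u (f (c - u))%:E = \int[mu]_u (f u)%:E)%E.
Proof.
move=> mf f0.
transitivity (\int[pushforward mu (reflectR c)]_u (f u)%:E)%E.
  rewrite ge0_integral_pushforward//; first by apply/measurable_EFinP; exact: mf.
  by move=> y _; rewrite lee_fin.
by apply: eq_measure_integral => A mA _; exact: pushforward_reflectR.
Qed.

Lemma integrable_reflect c (f : R -> R) : mu.-integrable setT (EFin \o f) ->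
  mu.-integrable setT (fun u => (f (c - u))%:E).
Proof.
move=> /integrableP[/measurable_EFinP mf fi]; apply/integrableP; split.
  by apply/measurable_EFinP; apply: measurableT_comp => //; exact: measurable_reflectR.
rewrite (_ : integral _ _ _ = \int[mu]_u (`|f u|)%:E)%E//.
rewrite -(@ge0_integral_reflect c (fun x => `|f x|))//.
exact: measurableT_comp.
Qed.

Lemma integral_reflect c (f : R -> R) : mu.-integrable setT (EFin \o f) ->
  (\int[mu]_u (f (c - u))%:E = \int[mu]_u (f u)%:E)%E.
Proof.
move=> fi.
transitivity (\int[pushforward mu (reflectR c)]_u (f u)%:E)%E.
  rewrite integral_pushforward//; first exact: measurable_int fi.
  exact: (integrable_reflect c fi).
by apply: eq_measure_integral => A mA _; exact: pushforward_reflectR.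
Qed.

Lemma measurable_cos : measurable_fun setT (@cos R).
Proof. by apply: continuous_measurable_fun; exact: continuous_cos. Qed.

Lemma measurable_sin : measurable_fun setT (@sin R).
Proof. by apply: continuous_measurable_fun; exact: continuous_sin. Qed.

Lemma measurable_invr : measurable_fun setT (fun x : R => x^-1).
Proof.
rewrite -(setvU [set (0 : R)]); apply/measurable_funU => //.
  exact: measurableC.
split.
  apply: open_continuous_measurable_fun.
    by apply: closed_openC; exact: closed_eq.
  by move=> x; rewrite inE/= => /eqP x0; exact: inv_continuous.
by apply: measurable_fun_set1.
Qed.

Lemma derivable_measurable (f : R -> R) (D : set R) : measurable D ->
  (forall x, derivable f x 1) -> measurable_fun D (EFin \o f).
Proof.
move=> mD df; apply/measurable_EFinP; apply: measurable_funTS.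
by apply: continuous_measurable_fun; exact: derivable_continuous.
Qed.

(** Up to a constant, the Fejer kernel of bandwidth [lam], whose Fourier transform is a triangle. At
    0 the division returns 0 instead of lam^2 / 2. *)
Definition fejer (lam y : R) := (1 - cos (lam * y)) / y ^+ 2.

Lemma fejer_ge0 lam y : 0 <= fejer lam y.
Proof. by rewrite divr_ge0 ?sqr_ge0// subr_ge0 cos_le1. Qed.

Lemma measurable_fejer lam : measurable_fun setT (fejer lam).
Proof.
apply: measurable_funM.
  apply: measurable_funB => //.
  apply: measurableT_comp; first exact: measurable_cos.
  exact: measurable_funM.
apply: (measurableT_comp measurable_invr).
exact: measurable_funX.
Qed.

(** Insert the Laplace representation of 1/x^2 and exchange the integrals: the integral in x becomes
    lam^2 / (t^2 + lam^2), whose primitive is a multiple of an arctangent. *)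
Lemma integral0y_fejer lam : 0 < lam ->
  (\int[mu]_(x in `[0%R, +oo[) (fejer lam x)%:E = (lam * (pi / 2))%:E)%E.
Proof.
move=> l0; rewrite -(integral_cauchy l0).
(* The absolute value keeps the integrand nonnegative on the whole plane, as Tonelli asks. The range
   of [t] is open because at t = 0 the integral in [x] is 0 and not 1. *)
have inner1 (x : R) : 0 <= x -> (\int[mu]_(t in `]0%R, +oo[)
    ((1 - cos (lam * x)) * `|t| * expR (- (x * t)))%:E = (fejer lam x)%:E)%E.
  move=> x0.
  transitivity (\int[mu]_(t in `]0%R, +oo[) ((1 - cos (lam * x))%:E * (t * expR (- (x * t)))%:E))%E.
    apply: eq_integral => t; rewrite inE/= in_itv/= andbT => t0.
    by rewrite -EFinM mulrA (gtr0_norm t0).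
  move: x0; rewrite le_eqVlt => /predU1P[<-|x0].
    rewrite /fejer mulr0 cos0 subrr mul0r; apply: integral0_eq => t _.
    by rewrite mul0e.
  have mg : measurable_fun (`]0%R, +oo[ : set R) (EFin \o (fun t : R => t * expR (- (x * t)))).
    by apply: derivable_measurable => // t; exact: ex_derive.
  have G := eq_trans (integral_itv_obnd_cbnd mg) (integral_xexpR x0).
  rewrite ge0_integralZl.
  - by rewrite G -EFinM.
  - exact: measurable_itv.
  - exact: mg.
  - move=> t /=; rewrite in_itv/= andbT => /ltW t0.
    by rewrite lee_fin; apply: mulr_ge0; [exact: t0|exact: expR_ge0].
  - by rewrite lee_fin subr_ge0 cos_le1.
have inner2 (t : R) : 0 < t -> (\int[mu]_(x in `[0%R, +oo[)
    ((1 - cos (lam * x)) * `|t| * expR (- (x * t)))%:E = (lam ^+ 2 / (t ^+ 2 + lam ^+ 2))%:E)%E.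
  move=> t0.
  have mh : measurable_fun (`[0%R, +oo[ : set R)
      (EFin \o (fun x : R => (1 - cos (lam * x)) * expR (- (t * x)))).
    by apply: derivable_measurable => // x; exact: ex_derive.
  have alg : t * (lam ^+ 2 / (t * (t ^+ 2 + lam ^+ 2))) = lam ^+ 2 / (t ^+ 2 + lam ^+ 2).
    have tl0 : t ^+ 2 + lam ^+ 2 != 0 by rewrite gt_eqF// ltr_wpDl ?exprn_gt0 ?sqr_ge0.
    by field; rewrite tl0 gt_eqF.
  have fE (x : R) : ((1 - cos (lam * x)) * `|t| * expR (- (x * t)))%:E =
      (t%:E * ((1 - cos (lam * x)) * expR (- (t * x)))%:E)%E.
    by rewrite -EFinM (gtr0_norm t0) (mulrC x t); congr EFin; ring.
  transitivity (\int[mu]_(x in `[0%R, +oo[) (t%:E * ((1 - cos (lam * x)) * expR (- (t * x)))%:E))%E.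
    by apply: eq_integral => x _; exact: fE.
  rewrite ge0_integralZl.
  - apply: etrans; first exact: (congr1 (mule t%:E) (integral_1Bcos_expR lam t0)).
    by rewrite -EFinM alg.
  - exact: measurable_itv.
  - exact: mh.
  - by move=> x _; rewrite lee_fin mulr_ge0 ?expR_ge0// subr_ge0 cos_le1.
  - by rewrite lee_fin ltW.
have mc : measurable_fun (`]0%R, +oo[ : set R)
    (EFin \o (fun t : R => lam ^+ 2 / (t ^+ 2 + lam ^+ 2))).
  exact: derivable_measurable (measurable_itv _) (derivable_cauchy l0).
pose f (z : measurableTypeR R * measurableTypeR R) : \bar R :=
  ((1 - cos (lam * z.1)) * `|z.2| * expR (- (z.1 * z.2)))%:E.
have mf : measurable_fun setT f.
  apply/measurable_EFinP; apply: measurable_funM; first apply: measurable_funM.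
  - apply: measurable_funB => //; apply: measurableT_comp; first exact: measurable_cos.
    by apply: measurable_funM => //; exact: measurable_fst.
  - by apply: measurableT_comp => //; exact: measurable_snd.
  - apply: measurableT_comp; first exact: measurable_expR.
    apply: measurableT_comp => //.
    by apply: measurable_funM; [exact: measurable_fst|exact: measurable_snd].
have f0 z : (0 <= f z)%E.
  by rewrite lee_fin !mulr_ge0 ?expR_ge0// subr_ge0 cos_le1.
have H := @fubini_tonelli_in _ _ _ _ R mu mu f mf f0 `[0%R, +oo[ `]0%R, +oo[
  (measurable_itv _) (measurable_itv _).
apply: etrans (etrans H _).
  apply: eq_integral => x; rewrite inE/= in_itv/= andbT => x0.
  exact/esym/inner1.
apply: etrans (integral_itv_obnd_cbnd mc).
apply: eq_integral => t; rewrite inE/= in_itv/= andbT => t0.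
exact: inner2.
Qed.

(** Evenness in x doubles the half-line integral, evenness in [lam] gives the absolute value. Total
    mass, L_1 bound and multiplier of the kernel are all combinations of this integral. *)
Lemma integral_fejer lam : (\int[mu]_x (fejer lam x)%:E = (pi * `|lam|)%:E)%E.
Proof.
wlog l0 : lam / 0 < lam => [wl|].
  have [l0|l0|->] := ltgtP lam 0; last 2 first.
  - exact: wl.
  - rewrite normr0 mulr0 -[RHS](@integral0 _ _ _ mu setT); apply: eq_integral => x _.
    by rewrite /fejer mul0r cos0 subrr mul0r.
  - rewrite -normrN -wl ?oppr_gt0//; apply: eq_integral => x _.
    by rewrite /fejer mulNr cosN.
have mE (D : set (measurableTypeR R)) : measurable_fun D (EFin \o fejer lam).
  by apply/measurable_EFinP; apply: measurable_funTS; exact: measurable_fejer.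
rewrite -(setUv (`[0%R, +oo[%classic : set (measurableTypeR R))).
rewrite ge0_integral_setU//=; last 3 first.
- exact: measurableC.
- by move=> x _; rewrite lee_fin fejer_ge0.
- by apply/disj_setPS => x [] /= ->.
rewrite integral0y_fejer//.
suff -> : (\int[mu]_(x in ~` `[0%R, +oo[) (fejer lam x)%:E = (lam * (pi / 2))%:E)%E.
  by rewrite -EFinD gtr0_norm//; congr EFin; field.
rewrite -integral0y_fejer// setCitvr integral_mkcond.
rewrite -[RHS]integral_itv_obnd_cbnd; last exact: mE.
rewrite [RHS]integral_mkcond restrict_EFin.
under [RHS]eq_integral do rewrite restrict_EFin.
rewrite -[LHS](@ge0_integral_reflect 0 (fejer lam \_ (`]-oo, 0%R[ : set (measurableTypeR R)))).
- apply: eq_integral => x _; rewrite /= !patchE !mem_setE !in_itv/= sub0r.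
  by rewrite oppr_lt0 andbT /fejer mulrN cosN sqrrN.
- have mD : measurable (`]-oo, 0%R[ : set R) by exact: measurable_itv.
  apply: (iffLR (measurable_restrictT (fejer lam) mD)).
  by apply: measurable_funTS; exact: measurable_fejer.
- by move=> x; rewrite patchE; case: ifP => // _; exact: fejer_ge0.
Qed.

Lemma integrable_fejer lam : mu.-integrable setT (EFin \o fejer lam).
Proof.
apply/integrableP; split; first by apply/measurable_EFinP; exact: measurable_fejer.
rewrite (_ : integral _ _ _ = \int[mu]_x (fejer lam x)%:E)%E.
  by rewrite integral_fejer ltry.
by apply: eq_integral => x _ /=; rewrite ger0_norm ?fejer_ge0.
Qed.

End fejer_integral.

(** * Integrability of real-valued functions *)

Section Rintegrable.
Context d (T : measurableType d) (R : realType) (mu : {measure set T -> \bar R}).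
Implicit Types f g : T -> R.

Lemma EFin_Rintegral f : mu.-integrable setT (EFin \o f) ->
  (\int[mu]_x (f x)%:E)%E = (\int[mu]_x f x)%:E.
Proof.
by move=> fi; rewrite /Rintegral fineK//; exact: (integrable_fin_num measurableT fi).
Qed.

Lemma Rintegrable_measurable f :
  mu.-integrable setT (EFin \o f) -> measurable_fun setT f.
Proof. by move=> /measurable_int/measurable_EFinP. Qed.

Lemma RintegrableD f g : mu.-integrable setT (EFin \o f) ->
  mu.-integrable setT (EFin \o g) -> mu.-integrable setT (EFin \o (fun x => f x + g x)).
Proof. by move=> fi gi; exact: (integrableD measurableT fi gi). Qed.

Lemma RintegrableB f g : mu.-integrable setT (EFin \o f) ->
  mu.-integrable setT (EFin \o g) -> mu.-integrable setT (EFin \o (fun x => f x - g x)).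
Proof. by move=> fi gi; exact: (integrableB measurableT fi gi). Qed.

Lemma RintegrableZl (k : R) f : mu.-integrable setT (EFin \o f) ->
  mu.-integrable setT (EFin \o (fun x => k * f x)).
Proof. by move=> fi; exact: (integrableZl measurableT k fi). Qed.

Lemma le_Rintegrable f g : measurable_fun setT f -> (forall x, `|f x| <= g x) ->
  mu.-integrable setT (EFin \o g) -> mu.-integrable setT (EFin \o f).
Proof.
move=> mf fg; apply: le_integrable => //; first exact/measurable_EFinP.
by move=> x _ /=; rewrite lee_fin (le_trans (fg x))// ler_norm.
Qed.

Lemma RintegrableMr (C : R) f g : mu.-integrable setT (EFin \o f) ->
  measurable_fun setT g -> (forall x, `|g x| <= C) ->
  mu.-integrable setT (EFin \o (fun x => f x * g x)).
Proof.
move=> fi mg gC; have mf := Rintegrable_measurable fi.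
apply: (@le_Rintegrable _ (fun x => C * `|f x|)).
- exact: measurable_funM.
- by move=> x; rewrite normrM mulrC ler_wpM2r.
- by apply: RintegrableZl; exact: integrable_norm.
Qed.

Lemma le_RintegralT f g : mu.-integrable setT (EFin \o f) ->
  mu.-integrable setT (EFin \o g) -> (forall x, f x <= g x) ->
  \int[mu]_x f x <= \int[mu]_x g x.
Proof. by move=> fi gi fg; apply: le_Rintegral. Qed.

Lemma ler_norm_Rintegral f g : measurable_fun setT f -> (forall x, `|f x| <= g x) ->
  mu.-integrable setT (EFin \o g) -> `|\int[mu]_x f x| <= \int[mu]_x g x.
Proof.
move=> mf fg gi; have fi := le_Rintegrable mf fg gi.
apply: (le_trans (le_normr_Rintegral measurableT fi)).
by apply: le_RintegralT => //; exact: integrable_norm.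
Qed.

End Rintegrable.

(** * The one-dimensional kernel *)

Section kernel.
Context {R : realType}.
Let mu := @lebesgue_measure R.
Implicit Types (x y u lam : R) (s : nat).

Lemma Rintegral_reflect c (f : R -> R) : mu.-integrable setT (EFin \o f) ->
  \int[mu]_u f (c - u) = \int[mu]_u f u.
Proof. by move=> fi; rewrite /Rintegral integral_reflect. Qed.

(** The quadratic decay of the kernel made bounded at 0: an integrable majorant for [kerVP s], for
    its translates and for its integrals over intervals. *)
Definition oneDsqrV (y : R) : R := (1 + y ^+ 2)^-1.

Lemma oneDsqrV_gt0 y : 0 < oneDsqrV y.
Proof. by rewrite invr_gt0 ltr_pwDl// sqr_ge0. Qed.

Lemma oneDsqrV_le1 y : oneDsqrV y <= 1.
Proof. by rewrite invf_le1 ?lerDl ?sqr_ge0// ltr_pwDl// sqr_ge0. Qed.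

Lemma measurable_oneDsqrV : measurable_fun setT oneDsqrV.
Proof. by apply: continuous_measurable_fun; exact: continuous_oneDsqrV. Qed.

Lemma integral_oneDsqrV : (\int[mu]_y (oneDsqrV y)%:E = pi%:E)%E.
Proof.
rewrite ge0_symfun_integralT.
- rewrite -set_itvcy integral0y_oneDsqr -EFinM; congr EFin; by field.
- by move=> y; exact: ltW (oneDsqrV_gt0 y).
- exact: continuous_oneDsqrV.
- by move=> y /=; rewrite /oneDsqrV sqrrN.
Qed.

Lemma integrable_oneDsqrV : mu.-integrable setT (EFin \o oneDsqrV).
Proof.
apply/integrableP; split; first by apply/measurable_EFinP; exact: measurable_oneDsqrV.
suff -> : (\int[mu]_y `|(EFin \o oneDsqrV) y| = \int[mu]_y (oneDsqrV y)%:E)%E.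
  by rewrite integral_oneDsqrV ltry.
by apply: eq_integral => y _ /=; rewrite (gtr0_norm (oneDsqrV_gt0 y)).
Qed.

Lemma ler_norm_sin x : `|sin x| <= `|x|.
Proof.
wlog x0 : x / 0 <= x => [wl|].
  have [/wl//|x0] := leP 0 x.
  by rewrite -normrN -[leRHS]normrN -sinN wl// oppr_ge0 ltW.
have [c _] := @MVT_segment R sin cos 0 x x0 (fun y _ => is_derive_sin y)
  (continuous_subspaceT (@continuous_sin R)).
rewrite sin0 !subr0 => ->; rewrite normrM ler_piMl//; exact: cos_max.
Qed.

Lemma cos_ge_1Bsqr x : 1 - cos x <= x ^+ 2 / 2.
Proof.
have -> : x = (x / 2) *+ 2 by rewrite mulr2n; field.
rewrite cos_mulr2n cos2sin2.
have := ler_norm_sin (x / 2).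
rewrite -ler_sqr ?nnegrE// !real_normK ?num_real// => h.
rewrite -subr_ge0.
rewrite (_ : _ - _ = 2 * ((x / 2) ^+ 2 - sin (x / 2) ^+ 2)); last by field.
by rewrite mulr_ge0// subr_ge0.
Qed.

Lemma fejer_le_sqr lam y : fejer lam y <= lam ^+ 2 / 2.
Proof.
rewrite /fejer; have [->|y0] := eqVneq y 0.
  by rewrite expr0n/= invr0 mulr0 divr_ge0// sqr_ge0.
rewrite ler_pdivrMr ?exprn_even_gt0//.
by apply: le_trans (cos_ge_1Bsqr _) _; rewrite exprMn mulrAC.
Qed.

Lemma fejer_le_inv lam y : fejer lam y <= 2 / y ^+ 2.
Proof.
rewrite ler_wpM2r ?invr_ge0 ?sqr_ge0// lerBlDr -lerBlDl.
by apply: le_trans (cos_geN1 _); lra.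
Qed.

Lemma fejer_mul_sqr lam y : fejer lam y * y ^+ 2 <= 2.
Proof.
rewrite /fejer; have [->|y0] := eqVneq y 0; first by rewrite expr0n/= mulr0.
rewrite mulfVK ?expf_neq0//; have := cos_geN1 (lam * y); lra.
Qed.

Definition kerVP s y : R :=
  (2 ^+ s)^-1 * ((cos (2 ^+ s * y) - cos (2 ^+ s.+1 * y)) / y ^+ 2).

Lemma kerVPE s y : kerVP s y = (2 ^+ s)^-1 * (fejer (2 ^+ s.+1) y - fejer (2 ^+ s) y).
Proof. by rewrite /kerVP /fejer; congr (_ * _); ring. Qed.

Lemma kerVPN s y : kerVP s (- y) = kerVP s y.
Proof. by rewrite /kerVP !mulrN !cosN sqrrN. Qed.

Lemma measurable_kerVP s : measurable_fun setT (kerVP s).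
Proof.
rewrite (_ : kerVP s = fun y => (2 ^+ s)^-1 * (fejer (2 ^+ s.+1) y - fejer (2 ^+ s) y)).
  by apply: measurable_funM => //; apply: measurable_funB; exact: measurable_fejer.
by apply/funext => y; exact: kerVPE.
Qed.

Lemma integrable_kerVP s : mu.-integrable setT (EFin \o kerVP s).
Proof.
rewrite (_ : kerVP s = fun y => (2 ^+ s)^-1 * (fejer (2 ^+ s.+1) y - fejer (2 ^+ s) y)).
  by apply: RintegrableZl; apply: RintegrableB; exact: integrable_fejer.
by apply/funext => y; exact: kerVPE.
Qed.

Let pow2_gt0 s : (0 : R) < 2 ^+ s. Proof. by rewrite exprn_gt0. Qed.

Lemma norm_kerVP_le s y :
  `|kerVP s y| <= (2 ^+ s)^-1 * (fejer (2 ^+ s.+1) y + fejer (2 ^+ s) y).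
Proof.
rewrite kerVPE normrM gtr0_norm ?invr_gt0//; apply: ler_wpM2l.
  by rewrite invr_ge0 ltW.
by apply: (le_trans (ler_normB _ _)); rewrite !ger0_norm ?fejer_ge0.
Qed.

(** Both Fejer terms lie between 0 and 2 / y^2, hence so does the modulus of their difference. Away
    from 0 this bound shrinks like 2^-s, which localises the kernel. *)
Lemma norm_kerVP_le_inv s y : `|kerVP s y| <= (2 ^+ s)^-1 * (2 / y ^+ 2).
Proof.
rewrite kerVPE normrM gtr0_norm ?invr_gt0//; apply: ler_wpM2l.
  by rewrite invr_ge0 ltW.
have := fejer_le_inv (2 ^+ s) y; have := fejer_le_inv (2 ^+ s.+1) y.
have := fejer_ge0 (2 ^+ s) y; have := fejer_ge0 (2 ^+ s.+1) y.
move: (fejer _ _) (fejer _ _) (_ / _) => a b c h1 h2 h3 h4.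
by rewrite ler_norml; apply/andP; split; lra.
Qed.

(** Multiplying by 1 + y^2 adds up the bound near 0 and the bound at infinity. [C] depends on [s],
    so this serves integrability for fixed [s] only. *)
Lemma norm_kerVP_bound s : exists2 C : R, 0 <= C &
  forall y, `|kerVP s y| <= C * oneDsqrV y.
Proof.
have B lam y : fejer lam y <= (lam ^+ 2 / 2 + 2) * oneDsqrV y.
  rewrite ler_pdivlMr ?ltr_pwDl ?sqr_ge0// mulrDr mulr1.
  by apply: lerD; [exact: fejer_le_sqr|exact: fejer_mul_sqr].
exists ((2 ^+ s)^-1 * (((2 ^+ s.+1) ^+ 2 / 2 + 2) + ((2 ^+ s) ^+ 2 / 2 + 2))).
  by rewrite mulr_ge0 ?invr_ge0 ?(ltW (pow2_gt0 s))// !addr_ge0// divr_ge0// sqr_ge0.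
move=> y; apply: (le_trans (norm_kerVP_le s y)).
rewrite -mulrA; apply: ler_wpM2l; first by rewrite invr_ge0 ltW.
by rewrite mulrDl lerD.
Qed.

Lemma Rintegral_fejer lam : \int[mu]_y fejer lam y = pi * `|lam|.
Proof. by rewrite /Rintegral integral_fejer. Qed.

(** The mass of a Fejer kernel is linear in its bandwidth, so the bound is (2^(s+1) + 2^s) pi / 2^s,
    uniform in [s]. *)
Lemma Rintegral_norm_kerVP s : \int[mu]_y `|kerVP s y| <= 3 * pi.
Proof.
have F i := integrable_fejer (2 ^+ i : R).
apply: (@le_trans _ _ (\int[mu]_y
    ((2 ^+ s)^-1 * (fejer (2 ^+ s.+1) y + fejer (2 ^+ s) y)))).
  apply: le_RintegralT; first exact: integrable_norm (integrable_kerVP s).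
    by apply: RintegrableZl; apply: RintegrableD.
  exact: norm_kerVP_le.
rewrite RintegralZl//; last exact: RintegrableD.
rewrite RintegralD// !Rintegral_fejer !gtr0_norm//.
rewrite exprS [leLHS](_ : _ = 3 * pi)//; field; by rewrite gt_eqF.
Qed.

(* The Fourier multiplier of sigma_{2^s}: [pi * multVP s] is the Fourier transform of [kerVP s]. *)
Definition multVP s lam : R :=
  (`|2 ^+ s.+1 + lam| + `|2 ^+ s.+1 - lam| - `|2 ^+ s + lam| - `|2 ^+ s - lam|)
  / (2 * 2 ^+ s).

Lemma multVP1 s lam : `|lam| <= 2 ^+ s -> multVP s lam = 1.
Proof.
have := pow2_gt0 s; rewrite /multVP exprS; move: (2 ^+ s) => a a0.
rewrite ler_norml => /andP[h1 h2].
by rewrite !ger0_norm; [field; rewrite gt_eqF|lra..].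
Qed.

Lemma multVP0 s lam : 2 ^+ s.+1 <= `|lam| -> multVP s lam = 0.
Proof.
have := pow2_gt0 s; rewrite /multVP exprS; move: (2 ^+ s) => a a0.
have [l0|l0] := leP 0 lam; [rewrite (ger0_norm l0)|rewrite (ltr0_norm l0)] => h.
- rewrite (@ger0_norm _ (2 * a + lam)) ?(@ler0_norm _ (2 * a - lam)) ?(@ger0_norm _ (a + lam))
    ?(@ler0_norm _ (a - lam)); [field; rewrite gt_eqF|lra..]; lra.
- rewrite (@ler0_norm _ (2 * a + lam)) ?(@ger0_norm _ (2 * a - lam)) ?(@ler0_norm _ (a + lam))
    ?(@ger0_norm _ (a - lam)); [field; rewrite gt_eqF|lra..]; lra.
Qed.

(** Modulation turns a Fejer kernel into half a second difference in the bandwidth, which integrates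
    to a combination of absolute values. In [kerVP] the two copies of [fejer lam] cancel. *)
Lemma fejer_mul_cos a lam y : fejer a y * cos (lam * y) =
  2^-1 * (fejer (a + lam) y + fejer (a - lam) y) - fejer lam y.
Proof.
rewrite /fejer (mulrDl a) (mulrBl y a) cosD cosB.
by move: (y ^+ 2)^-1 (cos _) (sin _) => c A B; field.
Qed.

Lemma Rintegral_kerVP_cos s lam :
  \int[mu]_y (kerVP s y * cos (lam * y)) = pi * multVP s lam.
Proof.
have F a := @integrable_fejer R a.
have E y : kerVP s y * cos (lam * y) = (2 * 2 ^+ s)^-1 *
   ((fejer (2 ^+ s.+1 + lam) y + fejer (2 ^+ s.+1 - lam) y) -
    (fejer (2 ^+ s + lam) y + fejer (2 ^+ s - lam) y)).
  rewrite kerVPE -mulrA mulrBl !fejer_mul_cos invfM; ring.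
under eq_Rintegral do rewrite E.
rewrite RintegralZl//; last by apply: RintegrableB; exact: RintegrableD.
rewrite RintegralB//; [|exact: RintegrableD..].
rewrite !RintegralD// !Rintegral_fejer /multVP; ring.
Qed.

Lemma integrable_kerVP_cos s lam :
  mu.-integrable setT (EFin \o (fun y => kerVP s y * cos (lam * y))).
Proof.
apply: (RintegrableMr (C := 1) (integrable_kerVP s)).
  by apply: measurableT_comp; [exact: measurable_cos|exact: measurable_funM].
by move=> y; exact: cos_max.
Qed.

Lemma integrable_kerVP_sin s lam :
  mu.-integrable setT (EFin \o (fun y => kerVP s y * sin (lam * y))).
Proof.
apply: (RintegrableMr (C := 1) (integrable_kerVP s)).
  by apply: measurableT_comp; [exact: measurable_sin|exact: measurable_funM].
by move=> y; exact: sin_max.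
Qed.

Lemma Rintegral_kerVP_sin s lam : \int[mu]_y (kerVP s y * sin (lam * y)) = 0.
Proof.
have := Rintegral_reflect 0 (integrable_kerVP_sin s lam).
set I := \int[mu]_y (kerVP s y * sin (lam * y)).
have -> : \int[mu]_u (kerVP s (0 - u) * sin (lam * (0 - u))) = - 1 * I.
  rewrite /I -RintegralZl//; last exact: integrable_kerVP_sin.
  by apply: eq_Rintegral => u _; rewrite sub0r kerVPN mulrN sinN mulrN mulN1r.
lra.
Qed.

Lemma Rintegral_kerVP s : \int[mu]_y kerVP s y = pi.
Proof.
have := Rintegral_kerVP_cos s 0; rewrite multVP1 ?normr0 ?(ltW (pow2_gt0 _))// mulr1 => <-.
by apply: eq_Rintegral => y _; rewrite mul0r cos0 mulr1.
Qed.

Lemma Rintegral_kerVP_conv s x (f : R -> R) (C : R) : measurable_fun setT f ->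
  (forall y, `|f y| <= C) ->
  \int[mu]_u (kerVP s (x - u) * f u) = \int[mu]_y (kerVP s y * f (x - y)).
Proof.
move=> mf fC.
have mf' : measurable_fun setT (fun y : R => f (x - y)).
  by apply: measurableT_comp => //; exact: measurable_funB.
have := Rintegral_reflect x (RintegrableMr (C := C) (integrable_kerVP s) mf' (fun y => fC _)).
by move=> <-; apply: eq_Rintegral => u _; rewrite subKr.
Qed.

(** Cosines are eigenfunctions of convolution with an even kernel: after expanding cos(lam (x - y)),
    the sine part integrates to 0. *)
Lemma conv_kerVP_cos s x lam :
  \int[mu]_u (kerVP s (x - u) * cos (lam * u)) = pi * multVP s lam * cos (lam * x).
Proof.
rewrite (@Rintegral_kerVP_conv _ _ (fun u => cos (lam * u)) 1).
- transitivity (\int[mu]_y (cos (lam * x) * (kerVP s y * cos (lam * y)) +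
    sin (lam * x) * (kerVP s y * sin (lam * y)))).
    by apply: eq_Rintegral => y _; rewrite mulrBr cosB; ring.
  have C := integrable_kerVP_cos s lam; have S := integrable_kerVP_sin s lam.
  rewrite RintegralD//; [|exact: RintegrableZl..].
  rewrite !RintegralZl// Rintegral_kerVP_cos Rintegral_kerVP_sin; ring.
- by apply: measurableT_comp; [exact: measurable_cos|exact: measurable_funM].
- by move=> y; exact: cos_max.
Qed.

Lemma conv_kerVP_sin s x lam :
  \int[mu]_u (kerVP s (x - u) * sin (lam * u)) = pi * multVP s lam * sin (lam * x).
Proof.
rewrite (@Rintegral_kerVP_conv _ _ (fun u => sin (lam * u)) 1).
- transitivity (\int[mu]_y (sin (lam * x) * (kerVP s y * cos (lam * y)) -
    cos (lam * x) * (kerVP s y * sin (lam * y)))).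
    by apply: eq_Rintegral => y _; rewrite mulrBr sinB; ring.
  have C := integrable_kerVP_cos s lam; have S := integrable_kerVP_sin s lam.
  rewrite RintegralB//; [|exact: RintegrableZl..].
  rewrite !RintegralZl// Rintegral_kerVP_cos Rintegral_kerVP_sin; ring.
- by apply: measurableT_comp; [exact: measurable_sin|exact: measurable_funM].
- by move=> y; exact: sin_max.
Qed.

End kernel.

(** * Tensor products *)

Section tensor.
Context {R : realType}.
Let mu := @lebesgue_measure R.
Notation mun n := (lebesgue_Rn R n).

Lemma measurable_coordRn n (j : 'I_n) :
  measurable_fun setT (fun x : Rn R n => coordRn x j).
Proof. exact: measurable_tnth. Qed.

Lemma coordRn_cons0 n (z : measurableTypeR R * Rn R n) :
  coordRn (cons_Rn z) ord0 = z.1.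
Proof. by rewrite /coordRn (tnth_nth 0). Qed.

Lemma coordRn_consS n (z : measurableTypeR R * Rn R n) j :
  coordRn (cons_Rn z) (lift ord0 j) = coordRn z.2 j.
Proof. by rewrite /coordRn !(tnth_nth 0). Qed.

(** By construction [lebesgue_Rn] in dimension [n.+1] is the image of a product measure under
    [cons_Rn], so one pulls back and applies Tonelli. *)
Lemma ge0_integral_Rn_cons n (f : Rn R n.+1 -> \bar R) :
  measurable_fun setT f -> (forall x, (0 <= f x)%E) ->
  (\int[mun n.+1]_x f x = \int[mu]_t \int[mun n]_x f (cons_Rn (t, x)))%E.
Proof.
move=> mf f0.
transitivity (\int[pushforward (mu \x mun n)%E (@cons_Rn R n)]_x f x)%E.
  by apply: eq_measure_integral.
rewrite (ge0_integral_pushforward (@measurable_cons_Rn R n) _ measurableT mf (fun x _ => f0 x)).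
rewrite preimage_setT fubini_tonelli1//=.
by apply: measurableT_comp => //; exact: measurable_cons_Rn.
Qed.

Lemma integrable_Rn_cons n (f : Rn R n.+1 -> \bar R) :
  (mun n.+1).-integrable setT f -> (mu \x mun n)%E.-integrable setT (f \o @cons_Rn R n).
Proof.
move=> /integrableP[mf fi].
have mfc : measurable_fun setT (f \o @cons_Rn R n).
  by apply: measurableT_comp => //; exact: measurable_cons_Rn.
apply/integrableP; split => //.
have mfa : measurable_fun setT (abse \o f) by exact: measurableT_comp.
move: fi; rewrite (ge0_integral_Rn_cons mfa (fun x => abse_ge0 _)).
rewrite (fubini_tonelli1 (abse \o (f \o @cons_Rn R n)))//.
  exact: measurableT_comp.
by move=> x; exact: abse_ge0.
Qed.

Lemma integral_Rn_cons n (f : Rn R n.+1 -> \bar R) : (mun n.+1).-integrable setT f ->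
  (\int[mun n.+1]_x f x = \int[mu]_t \int[mun n]_x f (cons_Rn (t, x)))%E.
Proof.
move=> fi; have fci := integrable_Rn_cons fi.
transitivity (\int[pushforward (mu \x mun n)%E (@cons_Rn R n)]_x f x)%E.
  by apply: eq_measure_integral.
have /integrableP[mf _] := fi.
rewrite (integral_pushforward (@measurable_cons_Rn R n) mf)//.
by rewrite preimage_setT -integral12_prod_meas1.
Qed.

Lemma measurable_tensor n (F : nat -> R -> R) : (forall j, measurable_fun setT (F j)) ->
  measurable_fun setT (fun x : Rn R n => \prod_(j < n) F j (coordRn x j)).
Proof.
move=> mF; apply: measurable_prod => j _.
by apply: measurableT_comp => //; exact: measurable_coordRn.
Qed.

Lemma tensor_cons n (F : nat -> R -> R) t (x : Rn R n) :
  \prod_(j < n.+1) F j (coordRn (cons_Rn (t, x)) j) =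
  F 0 t * \prod_(j < n) F j.+1 (coordRn x j).
Proof.
rewrite big_ord_recl coordRn_cons0; congr (_ * _).
by apply: eq_bigr => j _; rewrite coordRn_consS.
Qed.

Lemma lebesgue_Rn0T : mun 0 setT = 1%E.
Proof. exact: diracT. Qed.

(** The factors are indexed by [nat] rather than ['I_n], so that the induction can drop the first
    one by passing to [F \o S]. *)
Lemma ge0_integral_tensor n (F : nat -> R -> R) : (forall j, measurable_fun setT (F j)) ->
  (forall j y, 0 <= F j y) ->
  (\int[mun n]_x (\prod_(j < n) F j (coordRn x j))%:E =
   \prod_(j < n) \int[mu]_y (F j y)%:E)%E.
Proof.
elim: n F => [|n IH] F mF F0.
  rewrite big_ord0 (eq_integral (cst 1%E)); last by move=> x _; rewrite big_ord0.
  by apply: etrans lebesgue_Rn0T; rewrite integral_cst// mul1e.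
rewrite ge0_integral_Rn_cons; first last.
- by move=> x; rewrite lee_fin prodr_ge0.
- by apply/measurable_EFinP; exact: measurable_tensor.
rewrite big_ord_recl -(IH (F \o S)); first last.
- by move=> j y; exact: F0.
- by move=> j; exact: mF.
have mG : measurable_fun setT (fun x : Rn R n =>
    (\prod_(j < n) (F \o S) j (coordRn x j))%:E).
  have mFS j : measurable_fun setT ((F \o S) j) by exact: mF.
  apply/measurable_EFinP; apply: measurable_prod => k _.
  by apply: measurableT_comp; [exact: mFS|exact: measurable_coordRn].
have G0 (x : Rn R n) : (0 <= (\prod_(j < n) (F \o S) j (coordRn x j))%:E)%E.
  by rewrite lee_fin prodr_ge0// => j _; exact: F0.
set I := (X in (_ * X)%E).
have I0 : (0 <= I)%E by exact: integral_ge0.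
rewrite -ge0_integralZr//; last first.
- by move=> y _; rewrite lee_fin.
- by apply/measurable_EFinP; exact: mF.
apply: eq_integral => t _; rewrite -ge0_integralZl//; last by rewrite lee_fin.
by apply: eq_integral => x _; rewrite tensor_cons EFinM.
Qed.

Lemma integrable_tensor n (F : nat -> R -> R) :
  (forall j, mu.-integrable setT (EFin \o F j)) ->
  (mun n).-integrable setT (EFin \o (fun x => \prod_(j < n) F j (coordRn x j))).
Proof.
move=> Fi; have mF j := Rintegrable_measurable (Fi j).
apply/integrableP; split; first by apply/measurable_EFinP; exact: measurable_tensor.
have -> : (\int[mun n]_x `|(EFin \o (fun x : Rn R n => (\prod_(j < n) F j (coordRn x j))%R)) x| =
  \int[mun n]_x (\prod_(j < n) (fun j y => `|F j y|) j (coordRn x j))%:E)%E.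
  by apply: eq_integral => x _ /=; rewrite normr_prod.
rewrite (@ge0_integral_tensor _ (fun j y => `|F j y|))//; last first.
  by move=> j; apply: measurableT_comp; [exact: normr_measurable|exact: mF].
rewrite (eq_bigr (fun j : 'I_n => (\int[mu]_y `|F j y|)%:E)).
  by rewrite prodEFin ltry.
by move=> j _; rewrite EFin_Rintegral//; exact: integrable_norm (Fi j).
Qed.

Lemma Rintegral_tensor n (F : nat -> R -> R) :
  (forall j, mu.-integrable setT (EFin \o F j)) ->
  \int[mun n]_x \prod_(j < n) F j (coordRn x j) = \prod_(j < n) \int[mu]_y F j y.
Proof.
elim: n F => [|n IH] F Fi.
  rewrite big_ord0 /Rintegral (eq_integral (cst 1%E)); last by move=> x _; rewrite big_ord0.
  rewrite (_ : 1 = fine 1%E)//; congr fine; apply: etrans lebesgue_Rn0T.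
  by rewrite integral_cst// mul1e.
rewrite big_ord_recl -(IH (F \o S)); last by move=> j; exact: Fi.
have Ti := integrable_tensor n (F := F \o S) (fun j => Fi j.+1).
rewrite {1}/Rintegral integral_Rn_cons; last exact: integrable_tensor.
set I := (X in _ = _ * X).
transitivity (\int[mu]_y (F 0 y * I)).
  congr fine; apply: eq_integral => t _.
  rewrite EFinM /I -EFin_Rintegral// -integralZl//.
  by apply: eq_integral => x _; rewrite /= tensor_cons EFinM.
rewrite RintegralZr//.
Qed.

Lemma Rintegral_tensor_norm n (F : nat -> R -> R) :
  (forall j, mu.-integrable setT (EFin \o F j)) ->
  \int[mun n]_x `|\prod_(j < n) F j (coordRn x j)| = \prod_(j < n) \int[mu]_y `|F j y|.
Proof.
move=> Fi; rewrite -(@Rintegral_tensor _ (fun j y => `|F j y|)).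
  by apply: eq_Rintegral => x _; rewrite normr_prod.
by move=> j; exact: integrable_norm (Fi j).
Qed.

(** For the exponent [+oo], [Lnorm] is the essential supremum only on a space of positive measure.
    The same positivity gives a point outside any null set. *)
Lemma lebesgue_Rn_setT_gt0 n : (0 < mun n setT)%E.
Proof.
have := @ge0_integral_tensor n (fun _ => cst 1) (fun _ => measurable_cst _) (fun _ _ => ler01).
rewrite (eq_integral (cst 1%E)); last by move=> x _; rewrite big1.
rewrite integral_cst// mul1e => ->.
elim/big_ind : _ => // [x y|i _]; first exact: mule_gt0.
rewrite (eq_integral (cst 1%E))// integral_cst// mul1e.
have I01 : (0 < lebesgue_measure (`]0%R, 1%R] : set R))%E.
  by rewrite lebesgue_measure_itv/= lte_fin ltr01 -EFinB subr0 lte_fin.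
by apply: (lt_le_trans I01); apply: le_measure; rewrite ?inE.
Qed.

(** The indicator of the hyperplane is a tensor product with one factor of integral 0. The other
    factors have infinite integral, but 0 times +oo is 0 in [\bar R]. *)
Lemma negligible_coordRn n (j : 'I_n) a : (mun n).-negligible [set x | coordRn x j = a].
Proof.
have mA : measurable [set x : Rn R n | coordRn x j = a].
  rewrite -[X in measurable X]setTI.
  exact: (measurable_coordRn j measurableT (measurable_set1 a)).
apply/negligibleP => //.
pose F (i : nat) : R -> R := if i == j :> nat then \1_[set a] else cst 1.
have mF i : measurable_fun setT (F i).
  by rewrite /F; case: ifP => // _; exact: measurable_indic.
have F0 i y : 0 <= F i y by rewrite /F; case: ifP => // _; rewrite indicE ler0n.
have FjE : F j = \1_[set a] by rewrite /F eqxx.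
have := ge0_integral_tensor n mF F0.
have I0 : (\int[mu]_y (F j y)%:E = 0)%E.
  by apply: etrans (lebesgue_measure_set1 a); rewrite FjE integral_indic// setIT.
rewrite [X in _ = X -> _](bigD1 j)//= I0 mul0e => <-.
transitivity (\int[mun n]_x (\1_[set x : Rn R n | coordRn x j = a] x)%:E)%E.
  by rewrite integral_indic// setIT.
apply: eq_integral => x _; congr EFin.
rewrite (bigD1 j)//= FjE big1 ?mulr1//; last by move=> i /negbTE ij; rewrite /F val_eqE ij.
Qed.

End tensor.

(** * The kernel integrated over an interval *)

Section kernel_box.
Context {R : realType}.
Let mu := @lebesgue_measure R.
Implicit Types (x y u a b : R) (s : nat).

(** A Peetre inequality, 1 + u^2 <= 2 (1 + y^2) (1 + (y - u)^2), proved by a sum of squares. It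
    converts decay in y - u into decay in u. *)
Lemma oneDsqrV_shift y u : oneDsqrV (y - u) <= 2 * (1 + y ^+ 2) * oneDsqrV u.
Proof.
have p v : 0 < 1 + v ^+ 2 :> R by rewrite ltr_pwDl// sqr_ge0.
rewrite /oneDsqrV ler_pdivlMr// mulrC ler_pdivrMr// -subr_ge0.
rewrite (_ : _ - _ = 1 + (u - 2 * y) ^+ 2 + 2 * (y * (y - u)) ^+ 2); last by ring.
by apply: addr_ge0; [rewrite addr_ge0 ?sqr_ge0|rewrite mulr_ge0 ?sqr_ge0].
Qed.

Lemma norm_kerVP_shift s y : exists2 C : R, 0 <= C &
  forall u, `|kerVP s (y - u)| <= C * oneDsqrV u.
Proof.
have [C C0 hC] := @norm_kerVP_bound R s.
exists (C * (2 * (1 + y ^+ 2))).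
  by rewrite !mulr_ge0// addr_ge0// sqr_ge0.
move=> u; apply: (le_trans (hC _)); rewrite -mulrA ler_wpM2l//.
exact: oneDsqrV_shift.
Qed.

Lemma integrable_indic_itvoc a b :
  mu.-integrable setT (EFin \o (\1_(`]a, b] : set R) : R -> R)).
Proof. exact: integrable_indic_itv. Qed.

Lemma measurable_indic_itvoc a b : measurable_fun setT (\1_(`]a, b] : set R) : R -> R).
Proof. exact: measurable_indic. Qed.

Lemma indic_itvoc a b x : \1_(`]a, b] : set R) x = (a < x <= b)%R%:R :> R.
Proof. by rewrite indicE mem_setE in_itv. Qed.

Lemma measurable_kerVP_reflect s u : measurable_fun setT (fun x : R => kerVP s (u - x)).
Proof.
by apply: measurableT_comp; [exact: measurable_kerVP|exact: measurable_funB].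
Qed.

Lemma integrable_kerVP_reflect s u :
  mu.-integrable setT (EFin \o (fun x : R => kerVP s (u - x))).
Proof. exact: (integrable_reflect u (integrable_kerVP s)). Qed.

Lemma integrable_kerVP_indic s u a b :
  mu.-integrable setT (EFin \o (fun x : R => \1_(`]a, b] : set R) x * kerVP s (u - x))).
Proof.
rewrite (_ : (fun x : R => _) = (fun x : R => kerVP s (u - x) * \1_(`]a, b] : set R) x)).
  apply: (RintegrableMr (C := 1) (integrable_kerVP_reflect s u)).
    exact: measurable_indic_itvoc.
  by move=> x; rewrite indic_itvoc ger0_norm// lern1 leq_b1.
by apply/funext => x; rewrite mulrC.
Qed.

(** [C] is independent of [s], which is what dominated convergence needs later. Near the interval
    the L_1 bound 3 pi suffices. Beyond 2M every point of the interval is at distance at least |u| /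
    2 from u, and the quadratic decay takes over. *)
Lemma kerVP_indic_bound a b : exists2 C : R, 0 <= C & forall s u,
  \int[mu]_x `|\1_(`]a, b] : set R) x * kerVP s (u - x)| <= C * oneDsqrV u.
Proof.
pose M : R := 1 + `|a| + `|b|.
have M1 : 1 <= M by rewrite /M -addrA lerDl addr_ge0.
have aM : - M <= a by rewrite /M; have := ler_norm (- a); rewrite normrN; have := normr_ge0 b; lra.
have bM : b <= M by rewrite /M; have := ler_norm b; have := normr_ge0 a; lra.
pose L := \int[mu]_x (\1_(`]a, b] : set R) x : R).
have L0 : 0 <= L by apply: Rintegral_ge0 => x _; rewrite indic_itvoc.
have pi0 : 0 <= pi :> R by exact: pi_ge0.
have K0 : 0 <= 3 * pi * (1 + 4 * M ^+ 2).
  by rewrite mulr_ge0 ?mulr_ge0// addr_ge0// mulr_ge0// sqr_ge0.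
exists (3 * pi * (1 + 4 * M ^+ 2) + 16 * L).
  by rewrite addr_ge0 ?K0 ?mulr_ge0.
move=> s u; have Vu0 := ltW (oneDsqrV_gt0 u); have [uM|uM] := leP `|u| (2 * M).
  apply: (@le_trans _ _ (3 * pi)).
    rewrite (le_trans _ (Rintegral_norm_kerVP s))//.
    rewrite -(Rintegral_reflect u (integrable_norm (integrable_kerVP s))).
    apply: le_RintegralT.
    - exact: integrable_norm (integrable_kerVP_indic s u a b).
    - exact: integrable_norm (integrable_kerVP_reflect s u).
    - move=> x; rewrite normrM indic_itvoc (ger0_norm (ler0n _ _)).
      by rewrite ler_piMl// lern1 leq_b1.
  apply: (@le_trans _ _ (3 * pi * (1 + 4 * M ^+ 2) * oneDsqrV u)).
    rewrite -[leLHS]mulr1 -[leRHS]mulrA; apply: ler_wpM2l; first by rewrite mulr_ge0.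
    rewrite ler_pdivlMr ?ltr_pwDl ?sqr_ge0//.
    rewrite mul1r lerD2l (_ : 4 * M ^+ 2 = (2 * M) ^+ 2); last by ring.
    by rewrite -[u ^+ 2]real_normK ?num_real// ler_sqr ?nnegrE// mulr_ge0// (le_trans _ M1).
  by apply: ler_wpM2r => //; rewrite lerDl mulr_ge0.
(* The 16: (u - x)^2 >= u^2 / 4 gives 2 / (u - x)^2 <= 8 / u^2, and u^2 >= 1 (from M >= 1) gives 8 /
   u^2 <= 16 / (1 + u^2). *)
have hx x : `|\1_(`]a, b] : set R) x * kerVP s (u - x)| <=
    16 * oneDsqrV u * \1_(`]a, b] : set R) x.
  rewrite normrM indic_itvoc (ger0_norm (ler0n _ _)).
  have [/andP[ax xb]|_] := boolP (a < x <= b)%R; last by rewrite mul0r mulr0.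
  rewrite mul1r mulr1; apply: (le_trans (norm_kerVP_le_inv _ _)).
  have s1 : (2 ^+ s)^-1 <= 1 :> R.
    by rewrite invf_le1 ?exprn_gt0// exprn_ege1// ler1n.
  have xM : `|x| <= M by rewrite ler_norml; apply/andP; split; lra.
  have ux : `|u| / 2 <= `|u - x|.
    by have := ler_normB (u - x) (- x); rewrite opprK subrK normrN; lra.
  have u1 : 1 <= u ^+ 2.
    by rewrite -[u ^+ 2]real_normK ?num_real// exprn_ege1//; lra.
  have ux2 : u ^+ 2 / 4 <= (u - x) ^+ 2.
    rewrite -[(u - x) ^+ 2]real_normK ?num_real// -[u ^+ 2]real_normK ?num_real//.
    rewrite (_ : _ / 4 = (`|u| / 2) ^+ 2); last by field.
    by rewrite ler_sqr ?nnegrE// divr_ge0.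
  have ux0 : 0 < (u - x) ^+ 2 by apply: lt_le_trans ux2; lra.
  apply: (@le_trans _ _ (2 / (u - x) ^+ 2)).
    by rewrite ler_piMl// divr_ge0// ltW.
  rewrite ler_pdivrMr// /oneDsqrV mulrAC ler_pdivlMr ?ltr_pwDl ?sqr_ge0//.
  lra.
apply: (@le_trans _ _ (\int[mu]_x (16 * oneDsqrV u * \1_(`]a, b] : set R) x))).
  apply: le_RintegralT => //.
  - exact: integrable_norm (integrable_kerVP_indic s u a b).
  - by apply: RintegrableZl; exact: integrable_indic_itvoc.
rewrite RintegralZl//; last exact: integrable_indic_itvoc.
apply: (@le_trans _ _ (16 * L * oneDsqrV u)); first by rewrite mulrAC.
by apply: ler_wpM2r => //; rewrite lerDr.
Qed.

(* Off the diagonal |kerVP s (u - x)| <= 2^-s * 2 / (u - x)^2, whence the factor 2^-s. *)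
Lemma kerVP_tail (chi : R -> R) (del : R) u : measurable_fun setT chi ->
  (forall x, `|chi x| <= 1) -> 0 < del ->
  (forall x, `|u - x| < del -> chi x = 0) -> forall s,
  `|\int[mu]_x (chi x * kerVP s (u - x))| <= (2 ^+ s)^-1 * (2 * (1 + del ^- 2) * pi).
Proof.
move=> mchi chi1 del0 chi0 s.
have s0 : 0 < (2 ^+ s)^-1 :> R by rewrite invr_gt0 exprn_gt0.
have Vi : mu.-integrable setT (EFin \o (fun x : R => oneDsqrV (u - x))).
  exact: (integrable_reflect u integrable_oneDsqrV).
have <- : \int[mu]_x ((2 ^+ s)^-1 * (2 * (1 + del ^- 2)) * oneDsqrV (u - x)) =
    (2 ^+ s)^-1 * (2 * (1 + del ^- 2) * pi).
  rewrite RintegralZl// Rintegral_reflect; last exact: integrable_oneDsqrV.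
  by rewrite {1}/Rintegral integral_oneDsqrV/= !mulrA.
apply: ler_norm_Rintegral.
- by apply: measurable_funM => //; exact: measurable_kerVP_reflect.
- move=> x; have [ux|ux] := ltP `|u - x| del.
    rewrite chi0// mul0r normr0 !mulr_ge0 ?(ltW s0)//.
      by rewrite addr_ge0// invr_ge0 exprn_ge0// ltW.
    exact: ltW (oneDsqrV_gt0 _).
  rewrite normrM (le_trans (ler_wpM2r (normr_ge0 _) (chi1 x)))// mul1r.
  apply: (le_trans (norm_kerVP_le_inv _ _)).
  rewrite -!mulrA; apply: ler_wpM2l; first exact: ltW.
  apply: ler_wpM2l => //.
  (* For |v| >= del, (1 + v^2) / v^2 <= 1 + del^-2: this trades the singular 1 / v^2 for the
     integrable [oneDsqrV]. *)
  have v0 : 0 < (u - x) ^+ 2.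
    by rewrite -[(u - x) ^+ 2]real_normK ?num_real// exprn_gt0// (lt_le_trans del0).
  rewrite ler_pdivlMr ?ltr_pwDl ?sqr_ge0// mulrDr mulr1 mulVf ?gt_eqF//.
  rewrite addrC lerD2l -[(u - x) ^+ 2]real_normK ?num_real//.
  rewrite lef_pV2 ?posrE ?exprn_gt0// ?(lt_le_trans del0)//.
  by rewrite ler_sqr ?nnegrE// ltW.
- exact: RintegrableZl.
Qed.

(** Since the kernel has mass pi, subtracting from the indicator its value at u changes the integral
    by exactly the expected limit. The difference vanishes near u, so [kerVP_tail] applies. At an
    endpoint no neighbourhood of u avoids the jump. *)
Lemma cvg_kerVP_indic u a b : u != a -> u != b ->
  (fun s => \int[mu]_x (\1_(`]a, b] : set R) x * kerVP s (u - x))) @ \oo -->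
  pi * \1_(`]a, b] : set R) u.
Proof.
move=> ua ub.
pose del := Num.min `|u - a| `|u - b|.
have del0 : 0 < del by rewrite lt_min !normr_gt0 !subr_eq0 ua ub.
pose c : R := \1_(`]a, b] : set R) u.
pose chi x : R := \1_(`]a, b] : set R) x - c.
have mchi : measurable_fun setT chi.
  by apply: measurable_funB => //; exact: measurable_indic_itvoc.
have chi1 x : `|chi x| <= 1.
  rewrite /chi /c !indic_itvoc; move: (a < x <= b)%R (a < u <= b)%R => [] [] /=;
    by rewrite ?subrr ?normr0 ?subr0 ?sub0r ?normrN ?normr1.
have chi0 x : `|u - x| < del -> chi x = 0.
  rewrite lt_min => /andP[xa xb]; apply/eqP; rewrite subr_eq0 /c !indic_itvoc.
  move: xa xb; rewrite !ltr_norml => /andP[xa1 xa2] /andP[xb1 xb2].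
  have -> : (a < x) = (a < u).
    move: xa1 xa2; have [au|au|au] := ltgtP a u; last by rewrite au eqxx in ua.
      by rewrite gtr0_norm ?subr_gt0// => *; apply/idP/idP => *; lra.
    by rewrite ltr0_norm ?subr_lt0// => *; apply/idP/idP => *; lra.
  have -> // : (x <= b) = (u <= b).
  move: xb1 xb2; have [bu|bu|bu] := ltgtP b u; last by rewrite bu eqxx in ub.
    by rewrite gtr0_norm ?subr_gt0// => *; apply/idP/idP => *; lra.
  by rewrite ltr0_norm ?subr_lt0// => *; apply/idP/idP => *; lra.
have E s : \int[mu]_x (\1_(`]a, b] : set R) x * kerVP s (u - x)) - pi * c =
    \int[mu]_x (chi x * kerVP s (u - x)).
  have ki := integrable_kerVP_reflect s u.
  transitivity (\int[mu]_x (\1_(`]a, b] : set R) x * kerVP s (u - x) - c * kerVP s (u - x))).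
    rewrite RintegralB//; [|exact: integrable_kerVP_indic|exact: RintegrableZl].
    rewrite RintegralZl// Rintegral_reflect ?Rintegral_kerVP 1?mulrC//.
    exact: integrable_kerVP.
  by apply: eq_Rintegral => x _; rewrite -mulrBl.
pose C : R := 2 * (1 + del ^- 2) * pi.
apply/subr_cvg0; apply/norm_cvg0P.
apply: (@squeeze_cvgr _ _ _ _ (fun=> 0) (fun s : nat => (2^-1) ^+ s * C)).
- apply: nearW => s; rewrite normr_ge0 /= E exprVn.
  exact: kerVP_tail.
- exact: cvg_cst.
- rewrite -[X in _ --> X](mul0r C); apply: cvgMl; apply: cvg_expr.
  by rewrite gtr0_norm ?invr_gt0// invf_lt1// ltr1n.
Qed.

End kernel_box.

Lemma cvg_prodr (R : realType) (I : Type) (r : seq I) (F : I -> nat -> R) (L : I -> R) :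
  (forall i, F i @ \oo --> L i) ->
  (fun s => \prod_(i <- r) F i s) @ \oo --> \prod_(i <- r) L i.
Proof.
move=> FL; elim: r => [|i r IH].
  by under eq_fun do rewrite big_nil; rewrite big_nil; exact: cvg_cst.
by under eq_fun do rewrite big_cons; rewrite big_cons; exact: cvgM.
Qed.

(** * Convolution tested on boxes *)

Section box.
Context {R : realType} (d : nat).
Let mu := @lebesgue_measure R.
Notation mun := (lebesgue_Rn R d).
Notation rn := (Rn R d).
Implicit Types (x u : rn) (s : nat) (a b : nat -> R) (h : rn -> R).

Definition boxRn a b : set rn :=
  [set x | forall j : 'I_d, (a j < coordRn x j <= b j)%R].

(** Every function of L_1 or L_oo becomes integrable when multiplied by this weight. That is the one
    assumption under which both exponents are treated together. *)
Definition weightRn (u : rn) : R := \prod_(j < d) oneDsqrV (coordRn u j).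

Lemma coordRn_nth x (j : 'I_d) : coordRn x j = nth 0 x j.
Proof. by rewrite /coordRn (tnth_nth 0). Qed.

Lemma weightRn_gt0 u : 0 < weightRn u.
Proof. by apply: prodr_gt0 => j _; exact: oneDsqrV_gt0. Qed.

Lemma weightRn_le1 u : weightRn u <= 1.
Proof. by apply: prodr_ile1 => j _; rewrite oneDsqrV_le1 ltW ?oneDsqrV_gt0. Qed.

Lemma measurable_weightRn : measurable_fun setT weightRn.
Proof. exact: (@measurable_tensor R d (fun=> oneDsqrV) (fun=> measurable_oneDsqrV)). Qed.

Lemma integrable_weightRn : mun.-integrable setT (EFin \o weightRn).
Proof. exact: (@integrable_tensor R d (fun=> oneDsqrV) (fun=> integrable_oneDsqrV)). Qed.

Lemma indic_boxRn a b x :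
  \1_(boxRn a b) x = \prod_(j < d) \1_(`]a j, b j] : set R) (coordRn x j) :> R.
Proof.
rewrite indicE; have [/set_mem xA|/negP xA] := boolP (x \in boxRn a b).
  by rewrite big1// => j _; rewrite indic_itvoc xA.
apply/esym/eqP; rewrite prodf_seq_eq0; apply/hasP.
have /existsP[j hj] : [exists j : 'I_d, ~~ (a j < coordRn x j <= b j)%R].
  rewrite -negb_forall; apply/negP => /forallP H; apply: xA.
  by rewrite inE => j; exact: H.
by exists j; rewrite ?mem_index_enum//= indic_itvoc (negbTE hj).
Qed.

Lemma measurable_boxRn a b : measurable (boxRn a b).
Proof.
rewrite (_ : boxRn a b = \bigcap_(j in [set: 'I_d])
    ((fun x => coordRn x j) @^-1` `]a j, b j])).
  apply: fin_bigcap_measurable; first exact: finite_finset.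
  move=> j _; rewrite -[X in measurable X]setTI.
  exact: (measurable_coordRn j measurableT (measurable_itv _)).
apply/seteqP; split => x /=.
  by move=> xA j _ /=; rewrite in_itv/= xA.
by move=> xA j; have := xA j I; rewrite /= in_itv.
Qed.

Lemma VP_subRn s x u : VP s (subRn x u) = \prod_(j < d) kerVP s (coordRn x j - coordRn u j).
Proof.
rewrite /VP /kerVP [RHS]big_split/= prodr_const card_ord exprM -exprVn; congr (_ * _).
by apply: eq_bigr => j _; rewrite /coordRn tnth_mktuple.
Qed.

Lemma VP_subRnC s x u : VP s (subRn x u) = \prod_(j < d) kerVP s (coordRn u j - coordRn x j).
Proof. by rewrite VP_subRn; apply: eq_bigr => j _; rewrite -kerVPN opprB. Qed.

Lemma measurable_VP_subRn s :
  measurable_fun setT (fun z : rn * rn => VP s (subRn z.1 z.2)).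
Proof.
under eq_fun do rewrite VP_subRn.
apply: measurable_prod => j _; apply: measurableT_comp; first exact: measurable_kerVP.
apply: measurable_funB.
  apply: (measurableT_comp (measurable_coordRn j)); exact: measurable_fst.
apply: (measurableT_comp (measurable_coordRn j)); exact: measurable_snd.
Qed.

Lemma prod_bound_weightRn (F : 'I_d -> rn -> R) :
  (forall j u, 0 <= F j u) ->
  (forall j, exists2 C : R, 0 <= C & forall u, F j u <= C * oneDsqrV (coordRn u j)) ->
  exists2 C : R, 0 <= C & forall u, \prod_(j < d) F j u <= C * weightRn u.
Proof.
move=> F0 FC.
have /choice[C hC] : forall j, exists C : R, 0 <= C /\
    forall u, F j u <= C * oneDsqrV (coordRn u j).
  by move=> j; have [C] := FC j; exists C.
exists (\prod_j C j); first by apply: prodr_ge0 => j _; exact: (hC j).1.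
move=> u; rewrite -big_split/=; apply: ler_prod => j _.
by rewrite F0 (hC j).2.
Qed.

Lemma norm_VP_shift s x : exists2 C : R, 0 <= C &
  forall u, `|VP s (subRn x u)| <= C * weightRn u.
Proof.
have [|j|C C0 hC] := @prod_bound_weightRn (fun j u => `|kerVP s (coordRn x j - coordRn u j)|).
- by [].
- by have [C C0 hC] := norm_kerVP_shift s (coordRn x j); exists C.
- by exists C => // u; rewrite VP_subRn normr_prod.
Qed.

(** [sigmaVP] acts in this way on the real and on the imaginary part separately, which reduces the
    analysis to real functions. *)
Definition sigR s h : rn -> R := fun x =>
  (pi ^+ d)^-1 * \int[mun]_u (VP s (subRn x u) * h u).

Section fixed_h.
Variable h : rn -> R.
Hypothesis mh : measurable_fun setT h.
Hypothesis hW : mun.-integrable setT (EFin \o (fun u => h u * weightRn u)).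

Let kf s (z : rn * rn) : R := VP s (subRn z.1 z.2) * h z.2.

Let mkf s : measurable_fun setT (kf s).
Proof.
apply: measurable_funM; first exact: measurable_VP_subRn.
by apply: measurableT_comp; [exact: mh|exact: measurable_snd].
Qed.

Lemma integrable_VP_conv s x :
  mun.-integrable setT (EFin \o (fun u => VP s (subRn x u) * h u)).
Proof.
have [C C0 hC] := norm_VP_shift s x.
apply: (@le_Rintegrable _ _ _ _ _ (fun u => C * `|h u * weightRn u|)).
- exact: (measurableT_comp (mkf s) (pair1_measurable x)).
- move=> u; rewrite normrM [X in _ <= C * X]normrM (gtr0_norm (weightRn_gt0 u)).
  by rewrite [leRHS]mulrCA mulrC ler_wpM2l// hC.
- by apply: RintegrableZl; exact: integrable_norm hW.
Qed.

Lemma measurable_sigR s : measurable_fun setT (sigR s h).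
Proof.
apply: measurable_funM => //; apply: measurableT_comp; first exact: fine_measurable.
have mf : measurable_fun setT (EFin \o kf s) by exact/measurable_EFinP.
rewrite (_ : (fun x => _) = (fun x => \int[mun]_u (EFin \o kf s)^\+ (x, u) -
    \int[mun]_u (EFin \o kf s)^\- (x, u))%E); last first.
  apply/funext => x; rewrite integralE; congr (_ - _)%E;
    by apply: eq_integral => u _; rewrite ?funeposE ?funenegE.
apply: emeasurable_funB.
  by apply: (measurable_fun_fubini_tonelli_F (m2 := mun)) => //; exact: measurable_funepos.
by apply: (measurable_fun_fubini_tonelli_F (m2 := mun)) => //; exact: measurable_funeneg.
Qed.

(* [mass s a b u] is the integral of VP s (x - u) over the box, as a function of u. *)
Definition mass s a b (u : rn) : R :=
  \prod_(j < d) \int[mu]_y (\1_(`]a j, b j] : set R) y * kerVP s (coordRn u j - y)).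

Let gker s a b u (j : nat) (y : R) : R :=
  \1_(`]a j, b j] : set R) y * kerVP s (nth 0 u j - y).

Let gker_int s a b u j : mu.-integrable setT (EFin \o gker s a b u j).
Proof. exact: integrable_kerVP_indic. Qed.

Let gkerE s a b u x : \1_(boxRn a b) x * VP s (subRn x u) =
  \prod_(j < d) gker s a b u j (coordRn x j).
Proof.
rewrite indic_boxRn VP_subRnC -big_split/=; apply: eq_bigr => j _.
by rewrite /gker -coordRn_nth.
Qed.

Lemma integrable_box_VP s a b u :
  mun.-integrable setT (EFin \o (fun x => \1_(boxRn a b) x * VP s (subRn x u))).
Proof.
rewrite (_ : (fun x => _) = (fun x => \prod_(j < d) gker s a b u j (coordRn x j))).
  exact: integrable_tensor (gker_int s a b u).
by apply/funext => x; exact: gkerE.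
Qed.

Lemma Rintegral_box_VP s a b u :
  \int[mun]_x (\1_(boxRn a b) x * VP s (subRn x u)) = mass s a b u.
Proof.
transitivity (\int[mun]_x \prod_(j < d) gker s a b u j (coordRn x j)).
  by apply: eq_Rintegral => x _; exact: gkerE.
rewrite (Rintegral_tensor d (gker_int s a b u)); apply: eq_bigr => j _.
by rewrite /gker -coordRn_nth.
Qed.

Lemma Rintegral_box_VP_norm a b : exists2 C : R, 0 <= C & forall s u,
  \int[mun]_x `|\1_(boxRn a b) x * VP s (subRn x u)| <= C * weightRn u.
Proof.
have /choice[C hC] : forall j : 'I_d, exists C : R, 0 <= C /\ forall s (u : R),
    \int[mu]_y `|\1_(`]a j, b j] : set R) y * kerVP s (u - y)| <= C * oneDsqrV u.
  by move=> j; have [C] := kerVP_indic_bound (a j) (b j); exists C.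
exists (\prod_j C j); first by apply: prodr_ge0 => j _; exact: (hC j).1.
move=> s u; rewrite -big_split/=.
rewrite (_ : Rintegral _ _ _ = \int[mun]_x `|\prod_(j < d) gker s a b u j (coordRn x j)|).
  rewrite (Rintegral_tensor_norm d (gker_int s a b u)); apply: ler_prod => j _.
  by rewrite Rintegral_ge0//= /gker -coordRn_nth (hC j).2.
by apply: eq_Rintegral => x _; rewrite gkerE.
Qed.

Lemma norm_mass_le a b : exists2 C : R, 0 <= C & forall s u, `|mass s a b u| <= C * weightRn u.
Proof.
have [C C0 hC] := Rintegral_box_VP_norm a b; exists C => // s u.
apply: le_trans (hC s u); rewrite -Rintegral_box_VP.
by apply: le_normr_Rintegral => //; exact: integrable_box_VP.
Qed.

Let F s a b (z : rn * rn) : \bar R := (\1_(boxRn a b) z.1 * kf s z)%:E.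

(** Integrating the modulus first in x over the box leaves at most a multiple of |h| times the
    weight, by [Rintegral_box_VP_norm]. *)
Let F_int s a b : (mun \x mun)%E.-integrable setT (F s a b).
Proof.
have mF : measurable_fun setT (F s a b).
  apply/measurable_EFinP; apply: measurable_funM => //.
  apply: measurableT_comp; last exact: measurable_fst.
  by apply: measurable_indic; exact: measurable_boxRn.
apply/(integrable21ltyP _ _ mF).
have [C C0 hC] := Rintegral_box_VP_norm a b.
apply: (@le_lt_trans _ _ (\int[mun]_u (C * `|h u * weightRn u|)%:E)%E); last first.
  rewrite EFin_Rintegral ?ltry//; apply: RintegrableZl.
  exact: integrable_norm hW.
apply: ge0_le_integral => //.
- by move=> u _; apply: integral_ge0 => x _; exact: abse_ge0.
- apply: (measurable_fun_fubini_tonelli_G (m1 := mun) (abse \o F s a b)).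
    exact: measurableT_comp.
  by move=> z; exact: abse_ge0.
- apply/measurable_EFinP; apply: measurable_funM => //.
  apply: measurableT_comp => //; apply: measurable_funM => //.
  exact: measurable_weightRn.
move=> u _.
rewrite (_ : integral _ _ _ =
   \int[mun]_x (`|h u| * `|\1_(boxRn a b) x * VP s (subRn x u)|)%:E)%E; last first.
  by apply: eq_integral => x _; rewrite /F /kf /= mulrA normrM mulrC.
have Bi := integrable_norm (integrable_box_VP s a b u).
rewrite EFin_Rintegral; last exact: RintegrableZl.
rewrite RintegralZl// lee_fin normrM (gtr0_norm (weightRn_gt0 u)) mulrCA.
by rewrite ler_wpM2l.
Qed.

Lemma Rintegral_box_sigR s a b :
  mun.-integrable setT (EFin \o (fun x => \1_(boxRn a b) x * sigR s h x)) /\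
  \int[mun]_x (\1_(boxRn a b) x * sigR s h x) =
  (pi ^+ d)^-1 * \int[mun]_u (h u * mass s a b u).
Proof.
have innerE x : (\int[mun]_u F s a b (x, u))%E =
    (\1_(boxRn a b) x * \int[mun]_u (VP s (subRn x u) * h u))%:E.
  rewrite -RintegralZl//; last exact: integrable_VP_conv.
  rewrite -EFin_Rintegral//.
  by apply: RintegrableZl; exact: integrable_VP_conv.
have outerE u : (\int[mun]_x F s a b (x, u))%E = (h u * mass s a b u)%:E.
  rewrite -Rintegral_box_VP -RintegralZl//; last exact: integrable_box_VP.
  rewrite -EFin_Rintegral; last by apply: RintegrableZl; exact: integrable_box_VP.
  by apply: eq_integral => x _; rewrite /F /kf/=; congr EFin; ring.
have Gi := integrable_fubini_F (F_int s a b).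
have {}Gi : mun.-integrable setT
    (EFin \o (fun x => \1_(boxRn a b) x * \int[mun]_u (VP s (subRn x u) * h u))).
  by move: Gi; apply: eq_integrable => // x _; exact: innerE.
have sE x : \1_(boxRn a b) x * sigR s h x =
    (pi ^+ d)^-1 * (\1_(boxRn a b) x * \int[mun]_u (VP s (subRn x u) * h u)).
  by rewrite /sigR mulrCA.
split.
  by rewrite (funext sE); exact: RintegrableZl.
under eq_Rintegral do rewrite sE.
rewrite RintegralZl//; congr (_ * _).
have := Fubini (F_int s a b).
under eq_integral do rewrite innerE.
under [X in _ = X -> _]eq_integral do rewrite outerE.
by rewrite /Rintegral => ->.
Qed.

Lemma measurable_mul_mass s a b : measurable_fun setT (fun u => h u * mass s a b u).
Proof.
apply/measurable_EFinP.
rewrite (_ : EFin \o _ = fubini_G mun (F s a b)); first exact: measurable_fubini_G (F_int s a b).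
apply/funext => u; rewrite /fubini_G/= -Rintegral_box_VP -RintegralZl//; last exact: integrable_box_VP.
rewrite -EFin_Rintegral; last by apply: RintegrableZl; exact: integrable_box_VP.
by apply: eq_integral => x _; rewrite /F /kf/=; congr EFin; ring.
Qed.

Lemma ae_coordRn_neq (j : 'I_d) c : {ae mun, forall u, coordRn u j != c}.
Proof.
apply: negligibleS (negligible_coordRn j c) => u /=.
by move/negP; rewrite negbK => /eqP.
Qed.

Lemma cvg_mass a b u : (forall j : 'I_d, coordRn u j != a j /\ coordRn u j != b j) ->
  (fun s => mass s a b u) @ \oo --> pi ^+ d * \1_(boxRn a b) u.
Proof.
move=> uab; rewrite indic_boxRn (_ : pi ^+ d * _ =
    \prod_(j < d) (pi * \1_(`]a j, b j] : set R) (coordRn u j))); last first.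
  by rewrite big_split/= prodr_const card_ord.
rewrite /mass; apply: cvg_prodr => j.
by apply: cvg_kerVP_indic; have [] := uab j.
Qed.

Lemma indic_boxRn_weight a b : exists2 C : R, 0 <= C &
  forall u, \1_(boxRn a b) u <= C * weightRn u.
Proof.
have [||C C0 hC] := @prod_bound_weightRn (fun j u => \1_(`]a j, b j] : set R) (coordRn u j)).
- by move=> j u; rewrite indic_itvoc.
- move=> j; exists (1 + (`|a j| + `|b j|) ^+ 2); first by rewrite addr_ge0// sqr_ge0.
  move=> u; rewrite indic_itvoc; move: (coordRn u j) => y.
  have [/andP[ay yb]|_] := boolP (a j < y <= b j)%R; last first.
    by rewrite mulr_ge0 ?addr_ge0 ?sqr_ge0// ltW// oneDsqrV_gt0.
  rewrite ler_pdivlMr ?ltr_pwDl ?sqr_ge0// mul1r lerD2l.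
  rewrite -[y ^+ 2]real_normK ?num_real// ler_sqr ?nnegrE ?addr_ge0//.
  rewrite ler_norml; have := ler_norm (b j); have := ler_norm (- a j).
  have := normr_ge0 (a j); have := normr_ge0 (b j); rewrite normrN => *.
  by apply/andP; split; lra.
by exists C => // u; rewrite indic_boxRn.
Qed.

Lemma integrable_box_h a b :
  mun.-integrable setT (EFin \o (fun x => \1_(boxRn a b) x * h x)).
Proof.
have [C C0 hC] := indic_boxRn_weight a b.
apply: (@le_Rintegrable _ _ _ _ _ (fun u => C * `|h u * weightRn u|)).
- by apply: measurable_funM => //; apply: measurable_indic; exact: measurable_boxRn.
- move=> u; rewrite normrM [X in _ <= C * X]normrM (gtr0_norm (weightRn_gt0 u)).
  by rewrite [leRHS]mulrCA mulrC ler_wpM2l// ger0_norm// indicE ler0n.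
- by apply: RintegrableZl; exact: integrable_norm hW.
Qed.

(** Once the kernel sits on the indicator, this is dominated convergence: [norm_mass_le] gives a
    majorant uniform in s, and [cvg_mass] holds off the finitely many hyperplanes carrying the faces
    of the box. *)
Lemma cvg_Rintegral_box_sigR a b :
  (fun s => \int[mun]_x (\1_(boxRn a b) x * sigR s h x)) @ \oo -->
  \int[mun]_x (\1_(boxRn a b) x * h x).
Proof.
have [C C0 hC] := norm_mass_le a b.
have Wi : mun.-integrable setT (EFin \o (fun u => C * `|h u * weightRn u|)).
  by apply: RintegrableZl; exact: integrable_norm hW.
have mlim : measurable_fun setT (fun u => pi ^+ d * (\1_(boxRn a b) u * h u)).
  apply: measurable_funM => //; apply: measurable_funM => //.
  by apply: measurable_indic; exact: measurable_boxRn.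
have [] := @dominated_convergence _ _ _ mun setT measurableT
  (fun s u => (h u * mass s a b u)%:E) (fun u => (pi ^+ d * (\1_(boxRn a b) u * h u))%:E)
  (fun u => (C * `|h u * weightRn u|)%:E).
- by move=> s; apply/measurable_EFinP; exact: measurable_mul_mass.
- exact/measurable_EFinP.
- have A1 : \forall u \ae mun, forall j : 'I_d, coordRn u j != a j /\ coordRn u j != b j.
    apply: filter_forall => j.
    by apply: filterS2 (ae_coordRn_neq j (a j)) (ae_coordRn_neq j (b j)) => u; split.
  apply: filterS A1 => u uab _; apply: cvg_EFin; first exact: nearW.
  rewrite [X in _ --> X](_ : _ = h u * (pi ^+ d * \1_(boxRn a b) u)); last by ring.
  by apply: cvgMr; exact: cvg_mass.
- exact: Wi.
- apply: aeW => u s _ /=; rewrite lee_fin !normrM mulrCA ler_wpM2l//.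
  by rewrite (gtr0_norm (weightRn_gt0 u)).
move=> _ _; rewrite EFin_Rintegral; last first.
  by apply: RintegrableZl; exact: integrable_box_h.
move=> /fine_cvg H.
have {}H : (fun s => \int[mun]_u (h u * mass s a b u)) @ \oo -->
    \int[mun]_u (pi ^+ d * (\1_(boxRn a b) u * h u)) by [].
have -> : \int[mun]_x (\1_(boxRn a b) x * h x) =
    (pi ^+ d)^-1 * \int[mun]_u (pi ^+ d * (\1_(boxRn a b) u * h u)).
  rewrite RintegralZl//; last exact: integrable_box_h.
  by rewrite mulrA mulVf ?mul1r// expf_neq0// gt_eqF// pi_gt0.
rewrite (_ : (fun s => _) = (fun s => (pi ^+ d)^-1 * \int[mun]_u (h u * mass s a b u))).
  exact: cvgMr.
by apply/funext => s; rewrite (Rintegral_box_sigR _ _ _).2.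
Qed.

End fixed_h.

End box.

(** * Boxes determine a nonnegative function almost everywhere *)

Section density.
Context d (T : measurableType d) (R : realType) (mu : {measure set T -> \bar R}).
Variable f : T -> \bar R.

(** The two proofs are arguments so that the measure structure can be attached to the term
    itself. *)
Definition density of measurable_fun setT f & (forall x, (0 <= f x)%E) :
  set T -> \bar R := fun A => (\int[mu]_(x in A) f x)%E.

Hypotheses (mf : measurable_fun setT f) (f0 : forall x, (0 <= f x)%E).

Let density0 : density mf f0 set0 = 0%E.
Proof. exact: integral_set0. Qed.

Let density_ge0 A : (0 <= density mf f0 A)%E.
Proof. by apply: integral_ge0. Qed.

Let density_sigma_additive : semi_sigma_additive (density mf f0).
Proof. exact: semi_sigma_additive_nng_induced. Qed.

HB.instance Definition _ := isMeasure.Build _ _ _ (density mf f0)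
  density0 density_ge0 density_sigma_additive.

End density.

Section box_unique.
Context {R : realType} (d : nat).
Notation mun := (lebesgue_Rn R d).
Notation rn := (Rn R d).
Implicit Types (x u : rn) (a b : nat -> R).

Definition boxes : set (set rn) := [set boxRn ab.1 ab.2 | ab in [set: (nat -> R) * (nat -> R)]].

Definition cubeRn (k : nat) : set rn := boxRn (fun=> - k%:R) (fun=> k%:R).

Lemma boxes_setI : setI_closed boxes.
Proof.
move=> _ _ [[a b] _ <-] [[a' b'] _ <-] /=.
exists (fun j => Num.max (a j) (a' j), fun j => Num.min (b j) (b' j)) => //=.
apply/seteqP; split => x /=.
  move=> H; split => j; have := H j; rewrite gt_max le_min.
    by move=> /andP[/andP[-> _] /andP[-> _]].
  by move=> /andP[/andP[_ ->] /andP[_ ->]].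
by move=> [H H'] j; have /andP[h1 h2] := H j; have /andP[h3 h4] := H' j;
  rewrite gt_max le_min h1 h2 h3 h4.
Qed.

Lemma nat_bound_family (y : 'I_d -> R) : exists k : nat, forall j, `|y j| < k%:R.
Proof.
have [k hk] : exists k : nat, \sum_j `|y j| < k%:R.
  by exists (Num.bound (\sum_j `|y j|)); apply: archi_boundP; exact: sumr_ge0.
exists k => j; apply: le_lt_trans hk; rewrite (bigD1 j)//= lerDl.
exact: sumr_ge0.
Qed.

Lemma cubeRn_cover : \bigcup_k cubeRn k = setT.
Proof.
apply/seteqP; split => // x _.
have [k hk] := nat_bound_family (fun j => coordRn x j).
exists k => //= j; have := hk j; rewrite ltr_norml => /andP[h1 h2].
by rewrite h1 ltW.
Qed.

(** The nontrivial inclusion says that coordinates are measurable for the sigma-algebra of the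
    boxes. The preimage of []c, e]] is a countable union of boxes that grow in all other
    directions. *)
Lemma measurable_Rn_boxes : @measurable _ rn = <<s boxes >>.
Proof.
apply/seteqP; split => [A mA|]; last first.
  apply: smallest_sub; first exact: sigma_algebra_measurable.
  by move=> _ [[a b] _ <-]; exact: measurable_boxRn.
have mid : measurable_fun setT (id : g_sigma_algebraType boxes -> rn).
  apply/measurable_fun_tnthP => j.
  apply: (@measurability _ _ _ _ _ _ (@ocitv R)) => //.
  move=> _ [_ [[c e] _ <-] <-] /=; rewrite setTI.
  rewrite (_ : _ @^-1` _ = \bigcup_k
     boxRn (fun i => if i == j :> nat then c else - k%:R)
           (fun i => if i == j :> nat then e else k%:R)).
    by apply: bigcup_measurable => k _; apply: sub_sigma_algebra; eexists (_, _).
  apply/seteqP; split => [x /=|x [k _] /= /(_ j)].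
    rewrite in_itv/= => xj; have [k hk] := nat_bound_family (fun i => coordRn x i).
    exists k => // i; rewrite val_eqE; have [->//|_] := eqVneq i j.
    by have := hk i; rewrite ltr_norml => /andP[-> /ltW].
  by rewrite eqxx in_itv.
by have := mid measurableT A mA; rewrite setTI preimage_id.
Qed.

(** The measures with densities [f1] and [f2] agree on the boxes, a generating family stable under
    intersection, and are finite on cubes exhausting the space, so they are equal. Equality of the
    densities then follows cube by cube. *)
Lemma box_ae_eq (f1 f2 : rn -> \bar R) :
  measurable_fun setT f1 -> (forall x, (0 <= f1 x)%E) ->
  measurable_fun setT f2 -> (forall x, (0 <= f2 x)%E) ->
  (forall a b, \int[mun]_(x in boxRn a b) f1 x = \int[mun]_(x in boxRn a b) f2 x)%E ->
  (forall a b, \int[mun]_(x in boxRn a b) f1 x < +oo)%E ->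
  {ae mun, forall x, f1 x = f2 x}.
Proof.
move=> mf1 f10 mf2 f20 f12 fin1.
have E A : measurable A -> (\int[mun]_(x in A) f1 x = \int[mun]_(x in A) f2 x)%E.
  apply: (@measure_unique _ _ _ boxes cubeRn measurable_Rn_boxes boxes_setI _ cubeRn_cover
    (density mun mf1 f10) (density mun mf2 f20)).
  - by move=> k; exists (fun=> - k%:R, fun=> k%:R).
  - by move=> _ [[a b] _ <-]; exact: f12.
  - by move=> k; exact: fin1.
have C k : \forall x \ae mun, cubeRn k x -> f1 x = f2 x.
  apply: integral_ae_eq; first exact: measurable_boxRn.
  - apply/integrableP; split; first exact: measurable_funTS.
    by under eq_integral do rewrite gee0_abs//; exact: fin1.
  - exact: measurable_funTS.
  - by move=> A _ mA; exact: E.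
have := ae_foralln C; apply: filterS => x Cx.
by have : setT x by []; rewrite -cubeRn_cover => -[k _ /Cx].
Qed.

End box_unique.

Lemma nneseries_fin_cvg (R : realType) (c : nat -> R) (S : R) : (forall s, 0 <= c s) ->
  (\sum_(s <oo) (c s)%:E = S%:E)%E -> (fun n => \sum_(0 <= s < n) c s) @ \oo --> S.
Proof.
move=> c0 cS.
have : cvgn (fun n => (\sum_(0 <= s < n) (c s)%:E)%E).
  by apply: is_cvg_nneseries => n _ _; rewrite lee_fin.
move=> H; have {}H : (fun n => (\sum_(0 <= s < n) (c s)%:E)%E) @ \oo --> S%:E.
  by rewrite -cS.
have E : fine \o (fun n => (\sum_(0 <= s < n) (c s)%:E)%E) = fun n => \sum_(0 <= s < n) c s.
  by apply/funext => n /=; rewrite sumEFin.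
by have := fine_cvg H; rewrite E; apply.
Qed.

(** * Reconstruction almost everywhere *)

Section reconstruction.
Context {R : realType} (d : nat).
Notation mun := (lebesgue_Rn R d).
Notation rn := (Rn R d).
Variable h : rn -> R.
Hypothesis mh : measurable_fun setT h.
Hypothesis hW : mun.-integrable setT (EFin \o (fun u => h u * weightRn u)).

Definition qR (s : nat) (x : rn) : R :=
  if s is s'.+1 then sigR s h x - sigR s' h x else sigR 0 h x.

Lemma sum_qR n x : \sum_(s < n.+1) qR s x = sigR n h x.
Proof.
elim: n => [|n IH]; first by rewrite big_ord1.
by rewrite big_ord_recr/= IH addrC subrK.
Qed.

Lemma measurable_qR s : measurable_fun setT (qR s).
Proof.
by case: s => [|s]; [|apply: measurable_funB]; exact: measurable_sigR.
Qed.

(** Only local summability is asked: for p = oo the integrals over the whole space may be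
    infinite. *)
Hypothesis qfin : forall a b,
  (\sum_(s <oo) \int[mun]_(x in boxRn a b) `|qR s x|%:E < +oo)%E.

(** The positive part, in a form whose identities are settled by [field]. *)
Let pos (y : R) := (`|y| + y) / 2.

Let pos_ge0 y : 0 <= pos y.
Proof. by rewrite /pos divr_ge0// -lerBlDr sub0r -normrN ler_norm. Qed.
Let posB y : pos y - pos (- y) = y. Proof. by rewrite /pos normrN; field. Qed.
Let posD y : pos y + pos (- y) = `|y|. Proof. by rewrite /pos normrN; field. Qed.
Let pos_le y : pos y <= `|y|. Proof. by rewrite -posD lerDl. Qed.

Let measurable_pos (f : rn -> R) : measurable_fun setT f ->
  measurable_fun setT (fun x => pos (f x)).
Proof.
move=> mf; apply: measurable_funM => //; apply: measurable_funD => //.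
exact: measurableT_comp.
Qed.

(** Positive and negative parts are summed apart: each sum is defined everywhere in [\bar R], while
    the series of the [qR s x] itself need not converge. *)
Let P x : \bar R := (\sum_(s <oo) (pos (qR s x))%:E)%E.
Let M x : \bar R := (\sum_(s <oo) (pos (- qR s x))%:E)%E.

Let mqp s : measurable_fun setT (fun x => (pos (qR s x))%:E).
Proof. by apply/measurable_EFinP; apply: measurable_pos; exact: measurable_qR. Qed.

Let mqm s : measurable_fun setT (fun x => (pos (- qR s x))%:E).
Proof.
apply/measurable_EFinP; apply: measurable_pos.
by apply: measurableT_comp => //; exact: measurable_qR.
Qed.

Let mP : measurable_fun setT P.
Proof.
have := @ge0_emeasurable_sum _ _ R setT (fun s x => (pos (qR s x))%:E) predT.
by apply => // k x _ _; rewrite lee_fin.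
Qed.

Let mM : measurable_fun setT M.
Proof.
have := @ge0_emeasurable_sum _ _ R setT (fun s x => (pos (- qR s x))%:E) predT.
by apply => // k x _ _; rewrite lee_fin.
Qed.

Let P0 x : (0 <= P x)%E.
Proof. by apply: nneseries_ge0 => s _ _; rewrite lee_fin. Qed.

Let M0 x : (0 <= M x)%E.
Proof. by apply: nneseries_ge0 => s _ _; rewrite lee_fin. Qed.

Section on_box.
Variables a b : nat -> R.
Let A := boxRn a b : set rn.
Let chi x : R := \1_A x.

Let mA : measurable A. Proof. exact: measurable_boxRn. Qed.

Let chi_ge0 x : 0 <= chi x. Proof. by rewrite /chi indicE ler0n. Qed.

Let mchi : measurable_fun setT chi. Proof. exact: measurable_indic. Qed.

Let integral_boxE (f : rn -> R) :
  mun.-integrable setT (EFin \o (fun x => chi x * f x)) ->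
  (\int[mun]_(x in A) (f x)%:E = (\int[mun]_x (chi x * f x))%:E)%E.
Proof.
move=> fi; rewrite -EFin_Rintegral// [LHS]integral_mkcond; apply: eq_integral => x _.
by rewrite patchE /chi indicE; case: ifP => _; rewrite ?mul1r ?mul0r.
Qed.

Let integrable_pos (f : rn -> R) : measurable_fun setT f ->
  mun.-integrable setT (EFin \o (fun x => chi x * f x)) ->
  mun.-integrable setT (EFin \o (fun x => chi x * pos (f x))).
Proof.
move=> mf fi; apply: le_Rintegrable (integrable_norm fi).
  by apply: measurable_funM => //; exact: measurable_pos.
by move=> x; rewrite [leRHS]normrM (normrM (chi x)) ler_wpM2l// (ger0_norm (pos_ge0 _)) pos_le.
Qed.

Let integrable_neg (f : rn -> R) : measurable_fun setT f ->
  mun.-integrable setT (EFin \o (fun x => chi x * f x)) ->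
  mun.-integrable setT (EFin \o (fun x => chi x * pos (- f x))).
Proof.
move=> mf fi; apply: le_Rintegrable (integrable_norm fi).
  by apply: measurable_funM => //; apply: measurable_pos; exact: measurableT_comp.
by move=> x; rewrite [leRHS]normrM (normrM (chi x)) ler_wpM2l// (ger0_norm (pos_ge0 _)) (le_trans (pos_le _))// normrN.
Qed.

Let chi_posB (f : rn -> R) : measurable_fun setT f ->
  mun.-integrable setT (EFin \o (fun x => chi x * f x)) ->
  \int[mun]_x (chi x * f x) =
  \int[mun]_x (chi x * pos (f x)) - \int[mun]_x (chi x * pos (- f x)).
Proof.
move=> mf fi; rewrite -RintegralB//; [|exact: integrable_pos|exact: integrable_neg].
by apply: eq_Rintegral => x _; rewrite -mulrBr posB.
Qed.

Let chi_qi s : mun.-integrable setT (EFin \o (fun x => chi x * qR s x)).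
Proof.
have I n := (Rintegral_box_sigR mh hW n a b).1.
case: s => [|s]; first exact: I.
rewrite (_ : (fun x => _) = (fun x => chi x * sigR s.+1 h x - chi x * sigR s h x)).
  exact: RintegrableB (I _) (I _).
by apply/funext => x; rewrite /= mulrBr.
Qed.

Let cp s : R := \int[mun]_x (chi x * pos (qR s x)).
Let cm s : R := \int[mun]_x (chi x * pos (- qR s x)).

Let cp_ge0 s : 0 <= cp s.
Proof. by apply: Rintegral_ge0 => x _; rewrite mulr_ge0. Qed.

Let cm_ge0 s : 0 <= cm s.
Proof. by apply: Rintegral_ge0 => x _; rewrite mulr_ge0. Qed.

Let cpBcm s : cp s - cm s = \int[mun]_x (chi x * qR s x).
Proof. exact: esym (chi_posB (measurable_qR s) (chi_qi s)). Qed.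

Let sum_chi_q n : \sum_(0 <= s < n.+1) (cp s - cm s) = \int[mun]_x (chi x * sigR n h x).
Proof.
under eq_bigr do rewrite cpBcm.
elim: n => [|n IH]; first by rewrite big_nat1.
have si := (Rintegral_box_sigR mh hW n a b).1.
transitivity (\int[mun]_x (chi x * sigR n h x) + \int[mun]_x (chi x * qR n.+1 x)).
  by rewrite -IH; exact: big_nat_recr (leq0n _).
apply: etrans (esym (RintegralD measurableT si (chi_qi n.+1))) _.
by apply: eq_Rintegral => x _; rewrite -mulrDr /= addrC subrK.
Qed.

Let integral_boxP : (\int[mun]_(x in A) P x = \sum_(s <oo) (cp s)%:E)%E.
Proof.
rewrite integral_nneseries//; last 2 first.
- by move=> s; exact: measurable_funTS (mqp s).
- by move=> s x _; rewrite lee_fin.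
apply: eq_eseriesr => s _; rewrite integral_boxE//.
by apply: integrable_pos; [exact: measurable_qR|exact: chi_qi].
Qed.

Let integral_boxM : (\int[mun]_(x in A) M x = \sum_(s <oo) (cm s)%:E)%E.
Proof.
rewrite integral_nneseries//; last 2 first.
- by move=> s; exact: measurable_funTS (mqm s).
- by move=> s x _; rewrite lee_fin.
apply: eq_eseriesr => s _; rewrite integral_boxE//.
by apply: integrable_neg; [exact: measurable_qR|exact: chi_qi].
Qed.

Let fin_series (c : nat -> R) : (forall s, 0 <= c s) ->
  (forall s, ((c s)%:E <= \int[mun]_(x in A) `|qR s x|%:E)%E) ->
  exists S : R, (\sum_(s <oo) (c s)%:E = S%:E)%E.
Proof.
move=> c0 cq; have : (\sum_(s <oo) (c s)%:E < +oo)%E.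
  apply: le_lt_trans (qfin a b); apply: lee_nneseries => s _ //.
  by rewrite lee_fin.
move=> H; exists (fine (\sum_(s <oo) (c s)%:E)%E); rewrite fineK// ge0_fin_numE//.
by apply: nneseries_ge0 => s _ _; rewrite lee_fin.
Qed.

Let integral_box_norm s :
  (\int[mun]_(x in A) `|qR s x|%:E = (\int[mun]_x (chi x * `|qR s x|))%:E)%E.
Proof.
rewrite integral_boxE//; apply: le_Rintegrable (integrable_norm (chi_qi s)).
  apply: measurable_funM => //; apply: measurableT_comp => //.
  exact: measurable_qR.
by move=> x /=; rewrite !normrM normr_id.
Qed.

Let integrable_box_norm s :
  mun.-integrable setT (EFin \o (fun x => chi x * `|qR s x|)).
Proof.
apply: le_Rintegrable (integrable_norm (chi_qi s)).
  apply: measurable_funM => //; apply: measurableT_comp => //.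
  exact: measurable_qR.
by move=> x /=; rewrite !normrM normr_id.
Qed.

(* Stated without subtraction, as [P] and [M] may both be [+oo] on a null set. *)
Lemma box_balance :
  (\int[mun]_(x in A) ((pos (h x))%:E + M x) =
   \int[mun]_(x in A) ((pos (- h x))%:E + P x) /\
   \int[mun]_(x in A) ((pos (h x))%:E + M x) < +oo)%E.
Proof.
have hi := integrable_box_h mh hW a b.
have [SP SPE] := fin_series cp_ge0 (fun s => ltac:(idtac; rewrite integral_box_norm lee_fin;
  apply: le_RintegralT; [by apply: integrable_pos; [exact: measurable_qR|exact: chi_qi]|
   exact: integrable_box_norm|by move=> x; rewrite ler_wpM2l])).
have [SM SME] := fin_series cm_ge0 (fun s => ltac:(idtac; rewrite integral_box_norm lee_fin;
  apply: le_RintegralT; [by apply: integrable_neg; [exact: measurable_qR|exact: chi_qi]|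
   exact: integrable_box_norm|by move=> x; rewrite ler_wpM2l// (le_trans (pos_le _))// normrN])).
have mhp : measurable_fun setT (fun x => (pos (h x))%:E).
  by apply/measurable_EFinP; exact: measurable_pos.
have mhm : measurable_fun setT (fun x => (pos (- h x))%:E).
  by apply/measurable_EFinP; apply: measurable_pos; exact: measurableT_comp.
rewrite ge0_integralD//; last 3 first.
- by move=> x _; rewrite lee_fin.
- exact: measurable_funTS.
- exact: measurable_funTS.
rewrite ge0_integralD//; last 3 first.
- by move=> x _; rewrite lee_fin.
- exact: measurable_funTS.
- exact: measurable_funTS.
rewrite integral_boxP integral_boxM SPE SME.
rewrite !integral_boxE; [|exact: integrable_neg|exact: integrable_pos].
rewrite -!EFinD ltry; split => //; congr EFin.
have := chi_posB mh hi.
(* Both sides are limits of one sequence: [cp s - cm s] telescopes to the box integral of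
   [sigR n h]. The shift is needed because [sigR n h] sums the first n + 1 terms. *)
suff -> : \int[mun]_x (chi x * h x) = SP - SM by lra.
have c1 := @cvg_Rintegral_box_sigR _ _ h mh hW a b.
have c2 : (fun n => \sum_(0 <= s < n) (cp s - cm s)) @ \oo --> SP - SM.
  under eq_fun do rewrite sumrB.
  by apply: cvgB; exact: nneseries_fin_cvg.
move: c2; rewrite -cvg_shiftS.
under eq_fun do rewrite sum_chi_q.
by move=> c2; exact: cvg_unique c1 c2.
Qed.

End on_box.

Let qnorm_fin : {ae mun, forall x, (\sum_(s <oo) `|qR s x|%:E < +oo)%E}.
Proof.
have mq s : measurable_fun setT (fun x => `|qR s x|%:E).
  by apply/measurable_EFinP; apply: measurableT_comp => //; exact: measurable_qR.
have C k : \forall x \ae mun, @cubeRn R d k x -> (\sum_(s <oo) `|qR s x|%:E)%E \is a fin_num.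
  apply: integrable_ae; first exact: measurable_boxRn.
  have S0 x : (0 <= \sum_(s <oo) `|qR s x|%:E)%E by apply: nneseries_ge0.
  apply/integrableP; split.
    apply: measurable_funTS.
    by have := @ge0_emeasurable_sum _ _ R setT (fun s x => `|qR s x|%:E) predT; exact.
  under eq_integral do rewrite gee0_abs//.
  rewrite integral_nneseries//; first exact: qfin.
  - exact: measurable_boxRn.
  - by move=> s; exact: measurable_funTS.
have := ae_foralln C; apply: filterS => x Cx.
have : setT x by [].
by rewrite -(@cubeRn_cover R d) => -[k _ /Cx]; rewrite ge0_fin_numE// nneseries_ge0.
Qed.

(** Where the sum of the |q_s| is finite, the balance between [P] and [M] can be subtracted: h -
    sigma_{2^m}(h) is the tail of [P] minus the tail of [M], and these two tails add up to the tail
    of the |q_s|. One null set serves all [m]. *)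
Lemma ae_sigR_remainder : {ae mun, forall x, forall m,
  (`|h x - sigR m h x|%:E <= \sum_(m.+1 <= s <oo) `|qR s x|%:E)%E}.
Proof.
have B := @box_ae_eq R d (fun x => (pos (h x))%:E + M x)%E (fun x => (pos (- h x))%:E + P x)%E.
have {}B : {ae mun, forall x, ((pos (h x))%:E + M x = (pos (- h x))%:E + P x)%E}.
  apply: B.
  - apply: emeasurable_funD => //; apply/measurable_EFinP; exact: measurable_pos.
  - by move=> x; rewrite adde_ge0// lee_fin.
  - apply: emeasurable_funD => //; apply/measurable_EFinP; apply: measurable_pos.
    exact: measurableT_comp.
  - by move=> x; rewrite adde_ge0// lee_fin.
  - by move=> a b; exact: (box_balance a b).1.
  - by move=> a b; exact: (box_balance a b).2.
apply: filterS2 B qnorm_fin => x hx qx m.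
have tail (c : nat -> R) : (forall s, 0 <= c s) -> (forall s, c s <= `|qR s x|) ->
    exists t : R, [/\ 0 <= t, (\sum_(m.+1 <= s <oo) (c s)%:E = t%:E)%E &
     (\sum_(s <oo) (c s)%:E = (\sum_(0 <= s < m.+1) c s + t)%:E)%E].
  move=> c0 cq; have S0 N : (0 <= \sum_(N <= s <oo) (c s)%:E)%E.
    by apply: nneseries_ge0 => s _ _; rewrite lee_fin.
  have split_c := @nneseries_split R (fun s => (c s)%:E) 0 m.+1 (fun k _ => c0 k).
  have tfin : (\sum_(m.+1 <= s <oo) (c s)%:E)%E \is a fin_num.
    rewrite ge0_fin_numE//; apply: le_lt_trans qx.
    apply: (@le_trans _ _ (\sum_(s <oo) (c s)%:E)%E).
      by rewrite split_c add0n leeDr// sume_ge0// => s _; rewrite lee_fin.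
    by apply: lee_nneseries => s _; rewrite lee_fin.
  exists (fine (\sum_(m.+1 <= s <oo) (c s)%:E)%E); split.
  - exact: fine_ge0.
  - by rewrite fineK.
  - by rewrite EFinD fineK// -sumEFin split_c add0n.
have [t [t0 tE tS]] := tail (fun s => pos (qR s x)) (fun=> pos_ge0 _) (fun=> pos_le _).
have [r [r0 rE rS]] := tail (fun s => pos (- qR s x)) (fun=> pos_ge0 _)
  (fun=> ltac:(by rewrite (le_trans (pos_le _))// normrN)).
have -> : (\sum_(m.+1 <= s <oo) `|qR s x|%:E = (t + r)%:E)%E.
  rewrite EFinD -tE -rE -nneseriesD; last 2 first.
  - by move=> s _ _; rewrite lee_fin.
  - by move=> s _ _; rewrite lee_fin.
  by apply: eq_eseriesr => s _; rewrite -EFinD posD.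
have sE : sigR m h x =
    \sum_(0 <= s < m.+1) pos (qR s x) - \sum_(0 <= s < m.+1) pos (- qR s x).
  by rewrite -sum_qR -sumrB big_mkord; apply: eq_bigr => s _; rewrite posB.
move: hx; rewrite /P /M tS rS -!EFinD => -[hx].
have hE := posB (h x).
rewrite lee_fin ler_norml; apply/andP; split; lra.
Qed.

End reconstruction.

(** * The upper bound *)

Section complex_modulus.
Context {R : realType}.
Implicit Types z w : R[i].

Lemma reC_mulC (k : R) z : reC (k%:C%C * z) = k * reC z.
Proof. by case: z => c e /=; rewrite mul0r subr0. Qed.

Lemma imC_mulC (k : R) z : imC (k%:C%C * z) = k * imC z.
Proof. by case: z => c e /=; rewrite mul0r addr0. Qed.

Lemma reCB z w : reC (z - w) = reC z - reC w.
Proof. by case: z w => ? ? [? ?]. Qed.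

Lemma imCB z w : imC (z - w) = imC z - imC w.
Proof. by case: z w => ? ? [? ?]. Qed.

Lemma modulusE z : reC `|z| = Num.sqrt (reC z ^+ 2 + imC z ^+ 2).
Proof. by rewrite normc_def. Qed.

Lemma modulus_ge0 z : 0 <= reC `|z|.
Proof. by rewrite modulusE sqrtr_ge0. Qed.

Lemma ler_reC_modulus z : `|reC z| <= reC `|z|.
Proof. by rewrite modulusE -sqrtr_sqr ler_wsqrtr// lerDl sqr_ge0. Qed.

Lemma ler_imC_modulus z : `|imC z| <= reC `|z|.
Proof. by rewrite modulusE -sqrtr_sqr ler_wsqrtr// lerDr sqr_ge0. Qed.

Lemma modulus_ler z : reC `|z| <= `|reC z| + `|imC z|.
Proof.
rewrite modulusE -[leRHS]ger0_norm ?addr_ge0// -sqrtr_sqr ler_wsqrtr//.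
rewrite sqrrD !real_normK ?num_real// lerD2r lerDl.
by rewrite mulrn_wge0 ?mulr_ge0.
Qed.

End complex_modulus.

(** * Tails of Omega along the dyadic points *)

Section Omega_sums.
Context {R : realType}.
Variables (alpha : R) (l : nat) (Omega : R -> R).
Hypotheses (alpha0 : 0 < alpha) (hO : Phi alpha l Omega).

Let pow2V_gt0 s : 0 < 2 ^- s :> R. Proof. by rewrite invr_gt0 exprn_gt0. Qed.

Lemma Omega_gt0 s : 0 < Omega (2 ^- s).
Proof. exact: (Phi_gt0 hO). Qed.

Lemma nneseries_Omega_le : exists2 C : R, 0 < C &
  forall n, (\sum_(n <= s <oo) (Omega (2 ^- s))%:E <= (C * Omega (2 ^- n))%:E)%E.
Proof.
have [C2 C20 hC2] := Phi_S_alpha hO.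
pose r : R := 2^-1 `^ alpha.
have r0 : 0 < r by rewrite powR_gt0// invr_gt0.
have r1 : r < 1.
  have <- : 1 `^ alpha = 1 :> R by rewrite powR1.
  apply: gt0_ltr_powR => //; rewrite ?nnegrE ?invr_ge0//.
  by rewrite invf_lt1// ltr1n.
have rX s : (2 ^- s) `^ alpha = r ^+ s.
  rewrite -exprVn; elim: s => [|s IH]; first by rewrite !expr0 powR1.
  by rewrite !exprS powRM ?exprn_ge0 ?invr_ge0// IH.
(* (S^alpha) between 2^-(i+n) and 2^-n; the quotient of the two alpha-powers is [r ^+ i] with r =
   2^-alpha < 1, whence the constant C2 / (1 - r). *)
have step n i : Omega (2 ^- (i + n)) <= C2 * Omega (2 ^- n) * r ^+ i.
  have le1 : 2 ^- (i + n) <= 2 ^- n :> R.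
    by rewrite lef_pV2 ?posrE ?exprn_gt0// ler_weXn2l ?ler1n// leq_addl.
  have n1 : 2 ^- n <= 1 :> R by rewrite invf_le1 ?exprn_gt0// exprn_ege1// ler1n.
  have := hC2 _ _ (pow2V_gt0 _) le1 n1; rewrite !rX.
  rewrite ler_pdivrMr ?exprn_gt0// => /le_trans; apply.
  rewrite exprD -subr_ge0 (_ : _ - _ = 0)//.
  by field; rewrite gt_eqF// exprn_gt0.
exists (C2 / (1 - r)); first by rewrite divr_gt0// subr_gt0.
move=> n; apply: lime_le.
  by apply: is_cvg_nneseries => s _ _; rewrite lee_fin ltW ?Omega_gt0.
apply: nearW => N; rewrite sumEFin lee_fin.
have [nN|Nn] := leqP n N; last first.
  rewrite big_geq ?(ltnW Nn)// mulr_ge0 ?divr_ge0 ?subr_ge0 ?(ltW r1) ?(ltW C20)//.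
  exact: ltW (Omega_gt0 n).
rewrite -{1}[n]add0n big_addn.
apply: (@le_trans _ _ (\sum_(0 <= i < N - n) C2 * Omega (2 ^- n) * r ^+ i)).
  by apply: ler_sum => i _; exact: step.
have a0 : 0 <= C2 * Omega (2 ^- n) by rewrite mulr_ge0 ?(ltW C20) ?(ltW (Omega_gt0 _)).
have nr1 : `|r| < 1 by rewrite gtr0_norm.
have := geometric_le_lim (N - n) a0 r0 nr1; rewrite /series/=.
by move=> /le_trans; apply; rewrite mulrAC.
Qed.

End Omega_sums.

(** * From complex functions to real and imaginary parts *)

Section components.
Context {R : realType} (d : nat).
Notation mun := (lebesgue_Rn R d).
Notation rn := (Rn R d).
Implicit Types (f : rn -> R[i]) (x u : rn).

Lemma reC_sigmaVP s f x : reC (sigmaVP s f x) = sigR s (fun u => reC (f u)) x.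
Proof.
rewrite /sigmaVP reC_mulC /sigR /=; congr (_ * _).
by apply: eq_Rintegral => u _; rewrite reC_mulC.
Qed.

Lemma imC_sigmaVP s f x : imC (sigmaVP s f x) = sigR s (fun u => imC (f u)) x.
Proof.
rewrite /sigmaVP imC_mulC /sigR /=; congr (_ * _).
by apply: eq_Rintegral => u _; rewrite imC_mulC.
Qed.

Lemma reC_qVP s f x : reC (qVP s f x) = qR (fun u => reC (f u)) s x.
Proof.
case: s => [|s]; first exact: reC_sigmaVP.
by rewrite (_ : qVP s.+1 f x = sigmaVP s.+1 f x - sigmaVP s f x)// reCB !reC_sigmaVP.
Qed.

Lemma imC_qVP s f x : imC (qVP s f x) = qR (fun u => imC (f u)) s x.
Proof.
case: s => [|s]; first exact: imC_sigmaVP.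
by rewrite (_ : qVP s.+1 f x = sigmaVP s.+1 f x - sigmaVP s f x)// imCB !imC_sigmaVP.
Qed.

Lemma partialVP_sigmaVP n f : partialVP n.+1 f = sigmaVP n f.
Proof.
elim: n => [|n IH]; first by rewrite /partialVP big_ord1.
by rewrite /partialVP big_ord_recr/= -/(partialVP _ _) IH addrC subrK.
Qed.

Definition modf f : rn -> R := fun x => reC `|f x|.

Lemma modf_ge0 f x : 0 <= modf f x. Proof. exact: modulus_ge0. Qed.

Lemma normLp1 f : normLp 1 f = (\int[mun]_x (modf f x)%:E)%E.
Proof.
rewrite /normLp Lnorm1; apply: eq_integral => x _.
by rewrite gee0_abs// lee_fin modf_ge0.
Qed.

Lemma normLpyP f (c : \bar R) :
  (normLp +oo f <= c)%E <-> {ae mun, forall x, ((modf f x)%:E <= c)%E}.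
Proof.
rewrite /normLp unlock /Lnorm lebesgue_Rn_setT_gt0; split.
  move=> /ess_supP; apply: filterS => x /=.
  by rewrite ger0_norm// modf_ge0.
move=> H; apply/ess_supP; apply: filterS H => x /=.
by rewrite ger0_norm// modf_ge0.
Qed.

Lemma measurable_modf f : measurable_fun setT (fun x => reC (f x)) ->
  measurable_fun setT (fun x => imC (f x)) -> measurable_fun setT (modf f).
Proof.
move=> mr mi; rewrite (_ : modf f = (fun x => Num.sqrt (reC (f x) ^+ 2 + imC (f x) ^+ 2))).
  apply: measurableT_comp; first by apply: continuous_measurable_fun; exact: sqrt_continuous.
  by apply: measurable_funD; exact: measurable_funX.
by apply/funext => x; exact: modulusE.
Qed.

(** These are the standing hypotheses of [ae_sigR_remainder], gathered so that they can be checked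
    for each component and each exponent. *)
Definition reconstructible (h : rn -> R) : Prop :=
  [/\ measurable_fun setT h,
      mun.-integrable setT (EFin \o (fun u => h u * weightRn u)) &
      forall a b, (\sum_(s <oo) \int[mun]_(x in boxRn a b) `|qR h s x|%:E < +oo)%E].

Lemma ae_modf_remainder f : reconstructible (fun x => reC (f x)) ->
  reconstructible (fun x => imC (f x)) ->
  {ae mun, forall x, forall m, ((modf (f - partialVP m.+1 f) x)%:E <=
     2%:E * \sum_(m.+1 <= s <oo) (modf (qVP s f) x)%:E)%E}.
Proof.
move=> [mr rW rq] [mi iW iq].
apply: filterS2 (ae_sigR_remainder mr rW rq) (ae_sigR_remainder mi iW iq) => x hr hi m.
have S0 : (0 <= \sum_(m.+1 <= s <oo) (modf (qVP s f) x)%:E)%E.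
  by apply: nneseries_ge0 => s _ _; rewrite lee_fin modf_ge0.
apply: (@le_trans _ _ (`|reC ((f - partialVP m.+1 f) x)|%:E +
    `|imC ((f - partialVP m.+1 f) x)|%:E)%E).
  by rewrite -EFinD lee_fin; exact: modulus_ler.
rewrite (_ : (f - partialVP m.+1 f) x = f x - partialVP m.+1 f x)//.
rewrite partialVP_sigmaVP reCB imCB reC_sigmaVP imC_sigmaVP.
rewrite -[2%:E]/((1 + 1)%:E) EFinD ge0_muleDl ?lee_fin// !mul1e.
apply: leeD.
  apply: (le_trans (hr m)); apply: lee_nneseries => s _; first by rewrite lee_fin.
  by rewrite lee_fin -reC_qVP; exact: ler_reC_modulus.
apply: (le_trans (hi m)); apply: lee_nneseries => s _; first by rewrite lee_fin.
by rewrite lee_fin -imC_qVP; exact: ler_imC_modulus.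
Qed.

Lemma box_measure_fin a b : (mun (boxRn a b) < +oo)%E.
Proof.
have Fi j : (@lebesgue_measure R).-integrable setT
    (EFin \o (\1_(`]a j, b j] : set R) : R -> R)) by exact: integrable_indic_itvoc.
have := integrable_tensor d Fi => /integrableP[_].
apply: le_lt_trans; rewrite -[X in mun X]setIT -integral_indic//; last exact: measurable_boxRn.
apply: ge0_le_integral => //=.
- by apply/measurable_EFinP; apply: measurable_indic; exact: measurable_boxRn.
- apply/measurable_EFinP; apply: measurableT_comp => //.
  by apply: (@measurable_tensor _ _ (fun j => \1_(`]a j, b j] : set R))) => j; exact: measurable_indic_itvoc.
- by move=> x _; rewrite lee_fin indic_boxRn ler_norm.
Qed.

Section reconstructible_Lp.
Variables (f : rn -> R[i]) (w : nat -> R) (h : rn -> R).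
Hypothesis w0 : forall s, 0 <= w s.
Hypothesis wsum : (\sum_(s <oo) (w s)%:E < +oo)%E.
Hypothesis mh : measurable_fun setT h.
Hypothesis hf : forall x, `|h x| <= modf f x.
Hypothesis mf : measurable_fun setT (modf f).
Hypothesis hq : forall s x, `|qR h s x| <= modf (qVP s f) x.

Let mhW : measurable_fun setT (fun u => h u * weightRn u).
Proof. by apply: measurable_funM => //; exact: measurable_weightRn. Qed.

Lemma integrable_mul_weight_L1 : (normLp 1 f < +oo)%E ->
  mun.-integrable setT (EFin \o (fun u => h u * weightRn u)).
Proof.
rewrite normLp1 => fi.
have fint : mun.-integrable setT (EFin \o modf f).
  apply/integrableP; split; first exact/measurable_EFinP.
  by under eq_integral do rewrite /= ger0_norm ?modf_ge0//.
apply: le_Rintegrable fint => // x; rewrite normrM (gtr0_norm (weightRn_gt0 x)).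
by apply: (le_trans _ (hf x)); rewrite ler_piMr// weightRn_le1.
Qed.

Lemma reconstructible_L1 : (normLp 1 f < +oo)%E ->
  (forall s, (normLp 1 (qVP s f) <= (w s)%:E)%E) ->
  (forall s, measurable_fun setT (modf (qVP s f))) -> reconstructible h.
Proof.
move=> /integrable_mul_weight_L1 hW qw mq.
split => // a b; apply: le_lt_trans wsum; apply: lee_nneseries => s _.
  by move=> _; apply: integral_ge0.
apply: le_trans (qw s); rewrite normLp1.
have mqs : measurable_fun setT (fun x => `|qR h s x|%:E).
  by apply/measurable_EFinP; apply: measurableT_comp => //; exact: measurable_qR.
apply: (@le_trans _ _ (\int[mun]_x `|qR h s x|%:E)%E).
  by apply: ge0_subset_integral => //; exact: measurable_boxRn.
apply: ge0_le_integral => //.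
- by apply/measurable_EFinP; exact: mq.
- by move=> x _; rewrite lee_fin.
Qed.

(** A box has finite measure, so the essential bound [w s] yields a box integral of at most that
    measure times [w s], which is summable. *)
Lemma reconstructible_Ly : (normLp +oo f < +oo)%E ->
  (forall s, (normLp +oo (qVP s f) <= (w s)%:E)%E) -> reconstructible h.
Proof.
move=> fi qw.
have [K K0 fK] : exists2 K : R, 0 <= K & {ae mun, forall x, modf f x <= K}.
  move: fi; case E : (normLp +oo f) => [K||] // _.
    exists (Num.max K 0); first by rewrite le_max lexx orbT.
    have : (normLp +oo f <= K%:E)%E by rewrite E.
    by move=> /normLpyP; apply: filterS => x; rewrite lee_fin => xK; rewrite le_max xK.
  (* In the formal case [-oo] the almost everywhere bound is contradictory at each point, so any
     constant would do. *)
  exists 0 => //.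
  have : (normLp +oo f <= -oo)%E by rewrite E.
  by move=> /normLpyP; apply: filterS => x; rewrite leNgt ltNyr.
have hW : mun.-integrable setT (EFin \o (fun u => h u * weightRn u)).
  apply/integrableP; split; first exact/measurable_EFinP.
  apply: (@le_lt_trans _ _ (\int[mun]_x (K * weightRn x)%:E)%E); last first.
    rewrite EFin_Rintegral ?ltry//; apply: RintegrableZl; exact: integrable_weightRn.
  apply: ae_ge0_le_integral => //.
  - by apply: measurableT_comp => //; exact/measurable_EFinP.
  - by move=> x _; rewrite lee_fin mulr_ge0// ltW// weightRn_gt0.
  - apply/measurable_EFinP; apply: measurable_funM => //; exact: measurable_weightRn.
  - apply: filterS fK => x xK _ /=; rewrite lee_fin normrM (gtr0_norm (weightRn_gt0 x)).
    by rewrite ler_wpM2r ?(ltW (weightRn_gt0 x))// (le_trans (hf x)).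
split => // a b.
apply: (@le_lt_trans _ _ (\sum_(s <oo) mun (boxRn a b) * (w s)%:E)%E).
  apply: lee_nneseries => s _; first by move=> _; apply: integral_ge0.
  rewrite muleC -integral_cst; last exact: measurable_boxRn.
  apply: ae_ge0_le_integral => //.
  - exact: measurable_boxRn.
  - apply: measurable_funTS; apply/measurable_EFinP; apply: measurableT_comp => //.
    exact: measurable_qR.
  - by move=> x _; rewrite lee_fin.
  - have /normLpyP := qw s; apply: filterS => x xw _.
    by apply: le_trans xw; rewrite lee_fin.
have fb : mun (boxRn a b) \is a fin_num by rewrite ge0_fin_numE ?box_measure_fin.
rewrite -(fineK fb) nneseriesZl//; last by move=> s _; rewrite lee_fin.
by rewrite lte_mul_pinfty// lee_fin fine_ge0.
Qed.

End reconstructible_Lp.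

Lemma integral_nneseries_shift m (g : nat -> rn -> R) :
  (forall s, measurable_fun setT (g s)) -> (forall s x, 0 <= g s x) ->
  (\int[mun]_x (\sum_(m <= s <oo) (g s x)%:E) =
   \sum_(m <= s <oo) \int[mun]_x (g s x)%:E)%E /\
  measurable_fun setT (fun x => \sum_(m <= s <oo) (g s x)%:E)%E.
Proof.
move=> mg g0.
have gE x : (\sum_(m <= s <oo) (g s x)%:E = \sum_(s <oo) (g (s + m)%N x)%:E)%E.
  by rewrite (nneseries_addn (f := fun s => (g s x)%:E))// => s; rewrite lee_fin.
split.
  under eq_integral do rewrite gE.
  rewrite integral_nneseries//; last 2 first.
  - by move=> s; exact/measurable_EFinP.
  - by move=> s x _; rewrite lee_fin.
  rewrite (nneseries_addn (f := fun s => \int[mun]_x (g s x)%:E)%E)// => s.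
  by apply: integral_ge0 => x _; rewrite lee_fin.
rewrite (funext gE).
have := @ge0_emeasurable_sum _ _ R setT (fun s x => (g (s + m)%N x)%:E) predT.
by apply => [k x _ _|k _]; [rewrite lee_fin|exact/measurable_EFinP].
Qed.

End components.

Section upper_bound.
Context {R : realType} (d : nat).
Notation mun := (lebesgue_Rn R d).
Notation rn := (Rn R d).
Variables (alpha : R) (l : nat) (Omega : R -> R).
Hypotheses (alpha0 : 0 < alpha) (hO : Phi alpha l Omega).
Implicit Types (f : rn -> R[i]) (p theta : \bar R).

Lemma normLp_ge0 p f : (0 <= normLp p f)%E.
Proof. exact: Lnorm_ge0. Qed.

(** One term of the sum, or of the supremum, is at most the whole. This embedding of the class into
    the one for theta = oo removes theta from the upper bound. *)
Lemma normB_le1 p theta f s : (1 <= theta)%E -> (normB Omega p theta f <= 1)%E ->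
  (normLp p (qVP s f) <= (Omega (2 ^- s))%:E)%E.
Proof.
have Os := Omega_gt0 hO s; case: theta => [r||//] r1 /=.
- rewrite lee_fin in r1; have r0 : 0 < r by exact: lt_le_trans r1.
  pose u k := (((Omega (2 ^- k)) `^ (- r))%:E * normLp p (qVP k f) `^ r)%E.
  pose S := (\sum_(k <oo) u k)%E; change ((S `^ r^-1 <= 1)%E -> (normLp p (qVP s f) <= (Omega (2 ^- s))%:E)%E) => S1.
  have u0 k : (0 <= u k)%E by rewrite mule_ge0 ?poweR_ge0// lee_fin powR_ge0.
  have S0 : (0 <= S)%E by apply: nneseries_ge0.
  have {}S1 : (S <= 1)%E.
    rewrite -[S](@poweRe1 _ S)// -[X in (_ `^ X)%E](mulVf (lt0r_neq0 r0)) poweRrM.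
    rewrite -(@poweR1r R r); apply: gt0_ler_poweR => //; first exact: ltW.
      by rewrite in_itv/= poweR_ge0 leey.
    by rewrite in_itv/= lee01 leey.
  have us : (u s <= 1)%E.
    apply: le_trans S1; apply: le_trans (nneseries_lim_ge s.+1 (fun k _ _ => u0 k)).
    by rewrite big_nat_recr//= leeDr// sume_ge0.
  move: us (normLp_ge0 p (qVP s f)); rewrite /u; case: (normLp _ _) => [v||//].
    rewrite poweR_EFin -EFinM !lee_fin => H v0.
    rewrite leNgt; apply/negP => Ov; move: H; apply/negP; rewrite -ltNge.
    rewrite powRN mulrC ltr_pdivlMr ?powR_gt0// mul1r.
    by apply: gt0_ltr_powR => //; rewrite nnegrE// ltW.
  by rewrite poweRyr ?gt_eqF// gt0_muley// lte_fin powR_gt0.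
- move=> H; have : ((Omega (2 ^- s))^-1%:E * normLp p (qVP s f) <= 1)%E.
    by apply: le_trans H; apply: ereal_sup_ubound; exists s.
  by rewrite lee_pdivrMl// mule1.
Qed.

Lemma approxE_class_le p theta : p = 1%E \/ p = +oo%E -> (1 <= theta)%E ->
  exists2 C : R, 0 < C & forall n : nat, (0 < n)%N ->
    (approxE_class p n (@Bclass R d Omega p theta) <= (C * Omega (2 ^- n))%:E)%E.
Proof.
move=> hp t1; have [C C0 hC] := nneseries_Omega_le alpha0 hO.
exists (2 * C); first by rewrite mulr_gt0.
(* With n = m + 1, V_{n-1}(f) is sigma_{2^m}(f), and the tail starts at s = n. *)
case=> // m _; apply: ge_ereal_sup => _ [f [[mr mi fp] fB] <-].
have O0 s : 0 <= Omega (2 ^- s) by exact: ltW (Omega_gt0 hO s).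
have qO s := normB_le1 s t1 fB.
have Osum : (\sum_(s <oo) (Omega (2 ^- s))%:E < +oo)%E.
  exact: le_lt_trans (hC 0) (ltry _).
have mf := measurable_modf mr mi.
have rf x : `|reC (f x)| <= modf f x by exact: ler_reC_modulus.
have jf x : `|imC (f x)| <= modf f x by exact: ler_imC_modulus.
have rq s x : `|qR (fun u => reC (f u)) s x| <= modf (qVP s f) x.
  by rewrite -reC_qVP; exact: ler_reC_modulus.
have jq s x : `|qR (fun u => imC (f u)) s x| <= modf (qVP s f) x.
  by rewrite -imC_qVP; exact: ler_imC_modulus.
have q0 s x : 0 <= modf (qVP s f) x by exact: modf_ge0.
rewrite /approxE; case: hp fp qO => -> fp qO.
- have Wr := integrable_mul_weight_L1 mr rf mf fp.
  have Wi := integrable_mul_weight_L1 mi jf mf fp.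
  have mq s : measurable_fun setT (modf (qVP s f)).
    apply: measurable_modf.
      by rewrite (funext (reC_qVP s f)); exact: measurable_qR.
    by rewrite (funext (imC_qVP s f)); exact: measurable_qR.
  have Hr := reconstructible_L1 Osum mr rf mf rq fp qO mq.
  have Hi := reconstructible_L1 Osum mi jf mf jq fp qO mq.
  have AE := ae_modf_remainder Hr Hi.
  have [IE mS] := integral_nneseries_shift m.+1 mq q0.
  have S0 x : (0 <= \sum_(m.+1 <= s <oo) (modf (qVP s f) x)%:E)%E.
    by apply: nneseries_ge0 => s _ _; rewrite lee_fin.
  rewrite normLp1.
  apply: (@le_trans _ _ (\int[mun]_x (2%:E * \sum_(m.+1 <= s <oo) (modf (qVP s f) x)%:E))%E).
    apply: ae_ge0_le_integral => //.
    - by move=> x _; rewrite lee_fin modf_ge0.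
    - apply/measurable_EFinP; apply: measurable_modf.
        rewrite (_ : (fun x => _) = (fun x => reC (f x) - sigR m (fun u => reC (f u)) x)).
          by apply: measurable_funB => //; exact: measurable_sigR.
        by apply/funext => x; rewrite -reC_sigmaVP -partialVP_sigmaVP -reCB.
      rewrite (_ : (fun x => _) = (fun x => imC (f x) - sigR m (fun u => imC (f u)) x)).
        by apply: measurable_funB => //; exact: measurable_sigR.
      by apply/funext => x; rewrite -imC_sigmaVP -partialVP_sigmaVP -imCB.
    - by move=> x _; rewrite mule_ge0.
    - exact: measurable_funeM.
    - by apply: filterS AE => x H _; exact: H.
  rewrite ge0_integralZl// IE -mulrA EFinM lee_pmul2l//.
  apply: le_trans (hC m.+1); apply: lee_nneseries => s _.
    by move=> _; apply: integral_ge0 => x _; rewrite lee_fin.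
  by rewrite -normLp1; exact: qO.
- have Hr := reconstructible_Ly O0 Osum mr rf rq fp qO.
  have Hi := reconstructible_Ly O0 Osum mi jf jq fp qO.
  have AE := ae_modf_remainder Hr Hi.
  (* Countably many null sets, one for each s, are merged so that the tail can be bounded
     pointwise. *)
  have QE : \forall x \ae mun, forall s, ((modf (qVP s f) x)%:E <= (Omega (2 ^- s))%:E)%E.
    by apply: ae_foralln => s; exact/normLpyP.
  apply/normLpyP; apply: filterS2 AE QE => x H Q.
  apply: (le_trans (H m)); rewrite -mulrA EFinM lee_pmul2l//.
  apply: le_trans (hC m.+1); apply: lee_nneseries => s _ //.
  by rewrite lee_fin.
Qed.

End upper_bound.

(** * Band-limited functions *)

Section band_limited.
Context {R : realType}.
Let mu := @lebesgue_measure R.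
Implicit Types (x y u lam xi a : R) (s : nat).
Variable a : R.
Hypothesis a0 : 0 < a.

(** The right half of the triangle whose cosine transform is the Fejer kernel: for y nonzero,
    [fejer a y] is the integral of (a - xi) cos(xi y) over [0, a]. *)
Definition ramp xi : R := (a - xi) * \1_(`[0, a] : set R) xi.

Lemma indic_itvcc xi : \1_(`[0, a] : set R) xi = (0 <= xi <= a)%R%:R :> R.
Proof. by rewrite indicE mem_setE in_itv. Qed.

Lemma norm_ramp xi : `|ramp xi| <= a * \1_(`[0, a] : set R) xi.
Proof.
rewrite /ramp indic_itvcc; case: andP => [[h1 h2]|_]; last by rewrite !mulr0 normr0.
by rewrite !mulr1 ger0_norm; lra.
Qed.

Lemma measurable_ramp : measurable_fun setT ramp.
Proof.
by apply: measurable_funM; [exact: measurable_funB|exact: measurable_indic].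
Qed.

Lemma integrable_ramp : mu.-integrable setT (EFin \o ramp).
Proof.
have i1 : mu.-integrable setT (EFin \o (\1_(`[0, a] : set R) : R -> R)) by exact: integrable_indic_itv.
apply: (@le_Rintegrable _ _ R (@lebesgue_measure R) ramp (fun xi => a * \1_(`[0, a] : set R) xi)).
- exact: measurable_ramp.
- exact: norm_ramp.
- exact: RintegrableZl.
Qed.

Lemma measurable_cosM y : measurable_fun setT (fun xi : R => cos (y * xi)).
Proof. by apply: measurableT_comp; [exact: measurable_cos|exact: measurable_funM]. Qed.

Lemma measurable_cosMr y : measurable_fun setT (fun xi : R => cos (xi * y)).
Proof. by apply: measurableT_comp; [exact: measurable_cos|exact: measurable_funM]. Qed.

Lemma integrable_ramp_cos y : mu.-integrable setT (EFin \o (fun xi => ramp xi * cos (xi * y))).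
Proof.
apply: (RintegrableMr (C := 1) integrable_ramp (measurable_cosMr y)).
by move=> xi; exact: cos_max.
Qed.

(* Equals [fejer a] off 0; the junk value [fejer a 0 = 0] is not the limit. *)
Definition fejerI y : R := \int[mu]_xi (ramp xi * cos (xi * y)).

Lemma fejerI_bound : exists2 C : R, 0 <= C & forall y, `|fejerI y| <= C.
Proof.
have rn := integrable_norm integrable_ramp.
exists (\int[mu]_xi `|ramp xi|); first by apply: Rintegral_ge0.
move=> y; apply: ler_norm_Rintegral => //.
  exact: Rintegrable_measurable (integrable_ramp_cos y).
by move=> xi; rewrite normrM ler_piMr// cos_max.
Qed.

Lemma fejerIE y : y != 0 -> fejerI y = fejer a y.
Proof.
move=> y0.
(* An antiderivative of (a - xi) cos(xi y), from one integration by parts; dividing by y is why y =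
   0 is excluded. *)
pose H xi : R := (a - xi) * (sin (xi * y) / y) - cos (xi * y) / y ^+ 2.
have dH xi : is_derive xi (1 : R) H ((a - xi) * cos (xi * y)).
  by apply: is_derive_eq; rewrite /GRing.scale/=; field.
have E : (\int[mu]_(xi in `[0%R, a]) ((a - xi) * cos (xi * y))%:E = (H a)%:E - (H 0)%:E)%E.
  have cH : continuous H by move=> xi; apply: differentiable_continuous; exact/derivable1_diffP.
  apply: continuous_FTC2 => //.
  - apply: continuous_subspaceT => xi; apply: cvgM.
      by apply: cvgB; [exact: cvg_cst|exact: cvg_id].
    apply: (cvg_comp (fun xi => xi * y) cos); last exact: continuous_cos.
    by apply: cvgM; [exact: cvg_id|exact: cvg_cst].
  - split; first by move=> xi _; exact: ex_derive.
      by apply: cvg_at_right_filter; exact: cH.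
    by apply: cvg_at_left_filter; exact: cH.
  - by move=> xi _; rewrite derive1E derive_val.
transitivity (H a - H 0); last first.
  rewrite /H /fejer subrr mul0r sub0r mul0r sin0 cos0; field; exact: y0.
rewrite /fejerI /Rintegral -[RHS]/(fine ((H a)%:E - (H 0)%:E)%E) -E; congr fine.
rewrite [RHS]integral_mkcond; apply: eq_integral => xi _.
rewrite patchE mem_setE in_itv/= /ramp indic_itvcc.
by case: ifP; rewrite ?mulr1// mulr0 mul0r.
Qed.

Lemma measurable_fejerI : measurable_fun setT fejerI.
Proof.
rewrite (_ : fejerI = (fun y => fejer a y + fejerI 0 * \1_[set 0] y)).
  apply: measurable_funD; first exact: measurable_fejer.
  by apply: measurable_funM => //; exact: measurable_indic.
apply/funext => y; have [->|y0] := eqVneq y 0.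
  by rewrite /fejer expr0n invr0 mulr0 add0r indicE mem_set// mulr1.
by rewrite fejerIE// indicE memNset ?mulr0 ?addr0//; exact/eqP.
Qed.

Lemma ae_eq_fejerI (F : R -> R -> \bar R) :
  ae_eq (@lebesgue_measure R) setT (fun y => F y (fejerI y)) (fun y => F y (fejer a y)).
Proof.
exists [set 0]; split => //; first exact: lebesgue_measure_set1.
move=> y /= H; apply/eqP; apply/negP => /negP y0; apply: H => _; congr (F y _).
exact: fejerIE.
Qed.

Lemma integrable_fejerI : mu.-integrable setT (EFin \o fejerI).
Proof.
have [mf fi] := integrableP _ _ _ (integrable_fejer a).
apply/integrableP; split; first by apply/measurable_EFinP; exact: measurable_fejerI.
rewrite (_ : integral _ _ _ = \int[mu]_y `|(EFin \o fejer a) y|)%E//.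
apply: ae_eq_integral => //.
- by apply: measurableT_comp => //; apply/measurable_EFinP; exact: measurable_fejerI.
- exact: measurableT_comp.
- exact: (ae_eq_fejerI (fun _ z => `|z%:E|%E)).
Qed.

Lemma Rintegral_fejerI (g : R -> R) : measurable_fun setT g ->
  \int[mu]_y (fejerI y * g y) = \int[mu]_y (fejer a y * g y).
Proof.
move=> mg; rewrite /Rintegral; congr fine; apply: ae_eq_integral => //.
- by apply/measurable_EFinP; apply: measurable_funM => //; exact: measurable_fejerI.
- by apply/measurable_EFinP; apply: measurable_funM => //; exact: measurable_fejer.
- exact: (ae_eq_fejerI (fun y z => (z * g y)%:E)).
Qed.

Variable lam : R.

(** Built on [fejerI], not on [fejer], so that it is a superposition of cosines at every point, 0
    included. The sums sigma_{2^s} then reproduce it exactly as a function, not just almost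
    everywhere. *)
Definition wave y : R := fejerI y * cos (lam * y).

Lemma measurable_wave : measurable_fun setT wave.
Proof. by apply: measurable_funM; [exact: measurable_fejerI|exact: measurable_cosM]. Qed.

Lemma wave_bound : exists2 C : R, 0 <= C & forall y, `|wave y| <= C.
Proof.
have [C C0 hC] := fejerI_bound; exists C => // y.
by rewrite normrM (le_trans _ (hC y))// ler_piMr// cos_max.
Qed.

Lemma integrable_wave : mu.-integrable setT (EFin \o wave).
Proof.
apply: (RintegrableMr (C := 1) integrable_fejerI (measurable_cosM lam)).
by move=> y; exact: cos_max.
Qed.

(* Testing against [cos (lam * y)] gives half the total mass of the Fejer kernel. *)
Lemma Rintegral_wave_norm_ge : a <= 2 * lam -> pi * a / 2 <= \int[mu]_y `|wave y|.
Proof.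
move=> al; have n1 := gtr0_norm a0.
have l0 : 0 <= 2 * lam by exact: le_trans (ltW a0) al.
have n2 : `|a + 2 * lam| = a + 2 * lam by rewrite ger0_norm// addr_ge0// ltW.
have n3 : `|a - 2 * lam| = 2 * lam - a by rewrite ler0_norm ?opprB// subr_le0.
have n4 : `|2 * lam| = 2 * lam by exact: ger0_norm.
(* cos^2 is half of 1 + cos(2 lam y). The modulated half integrates to 0 because 2 lam >= a lies
   outside the interior of the spectrum of [fejer a]. *)
have E y : fejer a y * (cos (lam * y) * cos (lam * y)) =
    2^-1 * fejer a y + 2^-1 * (2^-1 * (fejer (a + 2 * lam) y + fejer (a - 2 * lam) y) - fejer (2 * lam) y).
  have C2 : cos (2 * lam * y) = 2 * (cos (lam * y) * cos (lam * y)) - 1.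
    rewrite (_ : 2 * lam * y = lam * y + lam * y); last by ring.
    rewrite cosD; have := cos2Dsin2 (lam * y); rewrite !expr2; lra.
  by rewrite -fejer_mul_cos C2; field.
have F b := @integrable_fejer R b.
have I : \int[mu]_y (wave y * cos (lam * y)) = pi * a / 2.
  under eq_Rintegral do rewrite /wave -mulrA.
  rewrite (Rintegral_fejerI (g := fun y => cos (lam * y) * cos (lam * y))); last first.
    by apply: measurable_funM; exact: measurable_cosM.
  under eq_Rintegral do rewrite E.
  have FD := RintegrableD (F (a + 2 * lam)) (F (a - 2 * lam)).
  have FB := RintegrableB (RintegrableZl 2^-1 FD) (F (2 * lam)).
  rewrite RintegralD//; [|exact: RintegrableZl..].
  rewrite !RintegralZl// RintegralB//; last exact: RintegrableZl.
  rewrite RintegralZl// RintegralD// !Rintegral_fejer.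
  by rewrite n1 n2 n3 n4; field.
rewrite -I; apply: (le_trans (ler_norm _)); apply: ler_norm_Rintegral.
- by apply: measurable_funM; [exact: measurable_wave|exact: measurable_cosM].
- by move=> y; rewrite normrM ler_piMr// cos_max.
- exact: integrable_norm integrable_wave.
Qed.

Lemma kerVP_mul_cos_ramp_integrable s x : (mu \x mu)%E.-integrable setT
  (fun z : measurableTypeR R * measurableTypeR R =>
    (kerVP s (x - z.1) * cos (lam * z.1) * (ramp z.2 * cos (z.2 * z.1)))%:E).
Proof.
set G := (X in integrable _ _ X).
have mG : measurable_fun setT G.
  apply/measurable_EFinP; apply: measurable_funM; apply: measurable_funM.
  - by apply: (measurableT_comp (measurable_kerVP_reflect s x)); exact: measurable_fst.
  - by apply: (measurableT_comp (measurable_cosM lam)); exact: measurable_fst.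
  - by apply: (measurableT_comp measurable_ramp); exact: measurable_snd.
  - apply: measurableT_comp; first exact: measurable_cos.
    by apply: measurable_funM; [exact: measurable_snd|exact: measurable_fst].
have kn := integrable_norm (integrable_kerVP_reflect s x).
have rn := integrable_norm integrable_ramp.
pose A := \int[mu]_xi `|ramp xi|.
apply/(integrable12ltyP _ _ mG).
apply: (@le_lt_trans _ _ (\int[mu]_u (A * `|kerVP s (x - u)|)%:E)%E); last first.
  by rewrite EFin_Rintegral ?ltry//; exact: RintegrableZl.
apply: ge0_le_integral => //.
- by move=> u _; apply: integral_ge0 => xi _; exact: abse_ge0.
- apply: (measurable_fun_fubini_tonelli_F (m2 := mu) (abse \o G)).
    exact: measurableT_comp.
  by move=> z; exact: abse_ge0.
- apply/measurable_EFinP; apply: measurable_funM => //.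
  by apply: measurableT_comp => //; exact: measurable_kerVP_reflect.
move=> u _.
apply: (@le_trans _ _ (\int[mu]_xi (`|kerVP s (x - u)| * `|ramp xi|)%:E)%E); last first.
  rewrite EFin_Rintegral; last exact: RintegrableZl.
  by rewrite RintegralZl// mulrC.
apply: ge0_le_integral => //.
- by apply: measurableT_comp => //; exact: (measurableT_comp mG (pair1_measurable u)).
- apply/measurable_EFinP; apply: measurable_funM => //.
  by apply: measurableT_comp => //; exact: measurable_ramp.
- move=> xi _; rewrite lee_fin !normrM; apply: ler_pM; rewrite ?mulr_ge0//.
    by rewrite ler_piMr// cos_max.
  by rewrite ler_piMr// cos_max.
Qed.

(* [wave] superposes the frequencies [lam + xi] and [lam - xi], [0 <= xi <= a]. *)
Lemma conv_kerVP_wave s x (k : R) :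
  (forall xi, 0 <= xi -> xi <= a -> multVP s (lam + xi) = k /\ multVP s (lam - xi) = k) ->
  \int[mu]_u (kerVP s (x - u) * wave u) = pi * k * wave x.
Proof.
move=> hk.
have KI := integrable_kerVP_reflect s x.
have KC c : mu.-integrable setT (EFin \o (fun u => kerVP s (x - u) * cos (c * u))).
  apply: (RintegrableMr (C := 1) KI (measurable_cosM c)).
  by move=> y; exact: cos_max.
have inner1 u : (\int[mu]_xi (kerVP s (x - u) * cos (lam * u) * (ramp xi * cos (xi * u)))%:E)%E
    = (kerVP s (x - u) * wave u)%:E.
  rewrite EFin_Rintegral; last by apply: RintegrableZl; exact: integrable_ramp_cos.
  rewrite RintegralZl//; last exact: integrable_ramp_cos.
  by rewrite /wave -mulrA (mulrC (cos _)).
have inner2 xi : (\int[mu]_u (kerVP s (x - u) * cos (lam * u) * (ramp xi * cos (xi * u)))%:E)%E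
    = (pi * k * cos (lam * x) * (ramp xi * cos (xi * x)))%:E.
  (* Product to sum: cos(lam u) cos(xi u) involves the frequencies lam + xi and lam - xi only. Since
     [ramp] vanishes off [0, a], the hypothesis on the multiplier is called for just those [xi]. *)
  rewrite (_ : (fun u => _) = (EFin \o (fun u => ramp xi / 2 * (kerVP s (x - u) * cos ((lam + xi) * u)
     + kerVP s (x - u) * cos ((lam - xi) * u))))); last first.
    apply/funext => u /=; congr EFin; rewrite (mulrDl lam) (mulrBl u lam) cosD cosB.
    by move: (kerVP s _) (cos _) (cos _) (sin _) (sin _) => ? ? ? ? ?; field.
  rewrite EFin_Rintegral; last by apply: RintegrableZl; exact: RintegrableD.
  rewrite RintegralZl//; last exact: RintegrableD.
  rewrite RintegralD// !conv_kerVP_cos; congr EFin.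
  rewrite /ramp indic_itvcc; case: andP => [[h1 h2]|_]; last by rewrite !(mulr0, mul0r).
  have [-> ->] := hk _ h1 h2; rewrite (mulrDl lam) (mulrBl x lam) cosD cosB.
  by move: (cos _) (cos _) (sin _) (sin _) => ? ? ? ?; field.
have /= FF := Fubini (kerVP_mul_cos_ramp_integrable s x).
transitivity (\int[mu]_xi (pi * k * cos (lam * x) * (ramp xi * cos (xi * x)))).
  congr fine; apply: etrans (etrans FF _); apply: eq_integral => t _; last exact: inner2.
  by rewrite inner1.
rewrite (RintegralZl _ measurableT (integrable_ramp_cos x)).
by rewrite /wave -mulrA (mulrC (cos _)).
Qed.

End band_limited.

(** * Convolution with the kernel in L_1 *)

Section young.
Context {R : realType}.
Let mu := @lebesgue_measure R.
Variables (s : nat) (g : R -> R) (C : R).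
Hypotheses (gi : mu.-integrable setT (EFin \o g)) (gC : forall y, `|g y| <= C).

Definition conv_kerVP (x : R) : R := \int[mu]_u (kerVP s (x - u) * g u).

Lemma integrable_conv_kerVP_at (x : R) :
  mu.-integrable setT (EFin \o (fun u => kerVP s (x - u) * g u)).
Proof.
exact: (RintegrableMr (integrable_kerVP_reflect s x) (Rintegrable_measurable gi) gC).
Qed.

Let G (z : measurableTypeR R * measurableTypeR R) : \bar R :=
  (kerVP s (z.1 - z.2) * g z.2)%:E.

Let mG : measurable_fun setT G.
Proof.
apply/measurable_EFinP; apply: measurable_funM.
  apply: measurableT_comp; first exact: measurable_kerVP.
  by apply: measurable_funB; [exact: measurable_fst|exact: measurable_snd].
by apply: measurableT_comp; [exact: Rintegrable_measurable gi|exact: measurable_snd].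
Qed.

Let kn : mu.-integrable setT (EFin \o (fun y => `|kerVP s y|)).
Proof. exact: integrable_norm (integrable_kerVP s). Qed.

Let innerG u : (\int[mu]_x `|G (x, u)| = (\int[mu]_y `|kerVP s y| * `|g u|)%:E)%E.
Proof.
transitivity (\int[mu]_x (`|g u| * `|kerVP s (u - x)|)%:E)%E.
  apply: eq_integral => x _; rewrite /G /= normrM mulrC; congr (_ * `|_|)%:E.
  by rewrite -kerVPN opprB.
have ri := integrable_norm (integrable_kerVP_reflect s u).
rewrite EFin_Rintegral; last exact: RintegrableZl.
by rewrite RintegralZl// mulrC (Rintegral_reflect u kn).
Qed.

Let intG : (\int[mu]_u \int[mu]_x `|G (x, u)| = (\int[mu]_y `|kerVP s y| * \int[mu]_u `|g u|)%:E)%E.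
Proof.
have gn := integrable_norm gi.
under eq_integral do rewrite innerG.
by rewrite EFin_Rintegral; [rewrite RintegralZl|exact: RintegrableZl].
Qed.

Lemma integrable_conv_kerVP : mu.-integrable setT (EFin \o conv_kerVP).
Proof.
have GI : (mu \x mu)%E.-integrable setT G.
  by apply/(integrable21ltyP _ _ mG); rewrite intG ltry.
have := integrable_fubini_F GI; apply: eq_integrable => // x _.
by rewrite /fubini_F /G/= EFin_Rintegral//; exact: integrable_conv_kerVP_at.
Qed.

Lemma Rintegral_norm_conv_kerVP :
  \int[mu]_x `|conv_kerVP x| <= 3 * pi * \int[mu]_u `|g u|.
Proof.
have gn0 : 0 <= \int[mu]_u `|g u| by apply: Rintegral_ge0.
apply: (@le_trans _ _ (\int[mu]_y `|kerVP s y| * \int[mu]_u `|g u|)); last first.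
  by rewrite ler_wpM2r// Rintegral_norm_kerVP.
rewrite -lee_fin -intG -EFin_Rintegral; last exact: integrable_norm integrable_conv_kerVP.
have /= <- := @fubini_tonelli _ _ _ _ R mu mu (abse \o G) (measurableT_comp _ mG) (fun z => abse_ge0 _) => //.
apply: ge0_le_integral => //.
- apply/measurable_EFinP; apply: measurableT_comp => //.
  exact: Rintegrable_measurable integrable_conv_kerVP.
- apply: (measurable_fun_fubini_tonelli_F (m2 := mu) (abse \o G)).
    exact: measurableT_comp.
  by move=> z; exact: abse_ge0.
- move=> x _; have I := integrable_conv_kerVP_at x.
  rewrite (_ : integral _ _ _ = (\int[mu]_u `|kerVP s (x - u) * g u|)%:E).
    by rewrite lee_fin; exact: le_normr_Rintegral.
  by rewrite -EFin_Rintegral//; exact: integrable_norm I.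
Qed.

End young.

Section tensor_sums.
Context {R : realType} (d : nat).
Let mu := @lebesgue_measure R.
Notation mun := (lebesgue_Rn R d).
Notation rn := (Rn R d).

(** [VP s] is a tensor product too, so the integral factorises, one 1/pi per coordinate. Bounded
    rather than integrable factors are allowed, to include the constants and sinusoids used for p =
    oo. *)
Lemma sigR_tensor s (K : R) (F : nat -> R -> R) (x : rn) :
  (forall j, measurable_fun setT (F j)) ->
  (forall j, exists C : R, forall y, `|F j y| <= C) ->
  sigR s (fun u => K * \prod_(j < d) F j (coordRn u j)) x =
  K * \prod_(j < d) (pi^-1 * conv_kerVP s (F j) (coordRn x j)).
Proof.
move=> mF bF.
pose k (j : nat) (y : R) := kerVP s (nth 0 x j - y) * F j y.
have ki j : mu.-integrable setT (EFin \o k j).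
  have [C hC] := bF j.
  exact: (RintegrableMr (integrable_kerVP_reflect s (nth 0 x j)) (mF j) hC).
rewrite /sigR (_ : Rintegral _ _ _ = \int[mun]_u (K * \prod_(j < d) k j (coordRn u j))).
  rewrite RintegralZl//; last exact: (integrable_tensor d ki).
  rewrite (Rintegral_tensor d ki) big_split/= prodr_const card_ord exprVn mulrCA.
  congr (_ * (_ * _)); apply: eq_bigr => j _.
  by rewrite /k /conv_kerVP -coordRn_nth.
apply: eq_Rintegral => u _; rewrite VP_subRn mulrCA -big_split/=; congr (_ * _).
by apply: eq_bigr => j _; rewrite /k -coordRn_nth.
Qed.

Lemma sigmaVP_pair s (h g : rn -> R) :
  sigmaVP s (fun x => Complex (h x) (g x)) = (fun x => Complex (sigR s h x) (sigR s g x)).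
Proof.
apply/funext => x; apply/eqP; rewrite eq_complex reC_sigmaVP imC_sigmaVP/=.
by rewrite !eqxx.
Qed.

Lemma modf_pair (h g : rn -> R) x :
  modf (fun x => Complex (h x) (g x)) x = Num.sqrt (h x ^+ 2 + g x ^+ 2).
Proof. exact: modulusE. Qed.

Lemma sigR_0 s : sigR s (fun=> 0 : R) = (fun=> 0) :> (rn -> R).
Proof.
apply/funext => x; rewrite /sigR /Rintegral integral0_eq ?mulr0// => u _.
by rewrite mulr0.
Qed.

End tensor_sums.

(** * The lower bound *)

Section spectral_block.
Context {R : realType} (d : nat).
Notation mun := (lebesgue_Rn R d).
Notation rn := (Rn R d).
Variables (alpha : R) (l : nat) (Omega : R -> R).
Hypotheses (hO : Phi alpha l Omega).
Variables (p : \bar R) (n : nat) (f : rn -> R[i]).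
Hypothesis p1 : (1 <= p)%E.
Hypothesis f_low : forall s, (s < n)%N -> sigmaVP s f = 0.
Hypothesis f_high : forall s, (n < s)%N -> sigmaVP s f = f.

Lemma normLp_0 : normLp p (0 : rn -> R[i]) = 0%E.
Proof.
rewrite /normLp (_ : (fun x : rn => _) = cst 0%E).
  by rewrite Lnorm0// gt_eqF// (lt_le_trans _ p1).
by apply/funext => x; rewrite normr0.
Qed.

Lemma qVP_block0 s : s != n -> s != n.+1 -> qVP s f = 0.
Proof.
case: s => [|s] sn sn1; first by rewrite /qVP f_low// lt0n eq_sym.
rewrite /qVP; have [ns|] := ltnP n s; first by rewrite !f_high ?subrr// ltnW.
rewrite leq_eqVlt => /predU1P[sE|sn']; first by rewrite sE eqxx in sn1.
by rewrite !f_low ?subrr// ltn_neqAle sn.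
Qed.

Lemma qVP_blockn : qVP n f = sigmaVP n f.
Proof.
by case: n f_low => // m low; rewrite /qVP (low m)// subr0.
Qed.

Lemma qVP_blockSn : qVP n.+1 f = f - sigmaVP n f.
Proof. by rewrite /qVP f_high. Qed.

Lemma approxE_block : (0 < n)%N -> approxE p n f = normLp p f.
Proof.
by case: n f_low => // m low _; rewrite /approxE partialVP_sigmaVP low// subr0.
Qed.

Hypothesis qn : (normLp p (sigmaVP n f) <= (Omega (2 ^- n) / 2)%:E)%E.
Hypothesis qSn : (normLp p (f - sigmaVP n f)%R <= (Omega (2 ^- n.+1) / 2)%:E)%E.

Let q_le s : (normLp p (qVP s f) <= (Omega (2 ^- s) / 2 * ((s == n) + (s == n.+1))%:R)%:E)%E.
Proof.
have [->|sn] := eqVneq s n.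
  by rewrite qVP_blockn (_ : (n == n.+1) = false) ?addn0 ?mulr1//; lia.
have [->|sn1] := eqVneq s n.+1; first by rewrite qVP_blockSn mulr1.
by rewrite qVP_block0// normLp_0 mulr0.
Qed.

(** At most two blocks survive. The halves in the hypotheses make each of their terms at most
    2^-theta <= 1/2, for every finite theta >= 1; for theta = oo the supremum is at most 1/2. *)
Lemma normB_block theta : (1 <= theta)%E -> (normB Omega p theta f <= 1)%E.
Proof.
have O0 s := Omega_gt0 hO s; case: theta => [r||//] r1 /=; last first.
  apply: ge_ereal_sup => _ [s _ <-]; rewrite lee_pdivrMl// mule1.
  apply: (le_trans (q_le s)); rewrite lee_fin -mulrA ler_piMr ?(ltW (O0 s))//.
  by rewrite ler_pdivrMl// mulr1 ler_nat; lia.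
rewrite lee_fin in r1; have r0 : 0 < r by exact: lt_le_trans r1.
pose u k := (((Omega (2 ^- k)) `^ (- r))%:E * normLp p (qVP k f) `^ r)%E.
pose b k : R := (if k == n then 2^-1 else 0) + (if k == n.+1 then 2^-1 else 0).
have u0 k : (0 <= u k)%E by rewrite mule_ge0 ?poweR_ge0// lee_fin powR_ge0.
have half v w : 0 < w -> 0 <= v -> v <= w / 2 -> w `^ (- r) * v `^ r <= 2^-1.
  move=> w0 v0 vw; apply: (@le_trans _ _ (w `^ (- r) * (w / 2) `^ r)).
    rewrite ler_wpM2l ?powR_ge0//; apply: ge0_ler_powR => //; first exact: ltW.
    by rewrite nnegrE divr_ge0// ltW.
  rewrite powRM ?invr_ge0 ?(ltW w0)// mulrA -powRD ?addNr ?powRr0 ?mul1r; last first.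
    by rewrite eqxx/= gt_eqF.
  rewrite -[leRHS]powRr1 ?invr_ge0//; apply: ger_powR => //.
  by rewrite invr_gt0 ltr0n invf_le1// ler1n.
have ub k : (u k <= (b k)%:E)%E.
  have := q_le k; have := normLp_ge0 p (qVP k f); rewrite /u.
  case: (normLp _ _) => [v||//].
    rewrite poweR_EFin -EFinM !lee_fin => v0 vO.
    have [kn|kn] := eqVneq k n.
      rewrite /b kn eqxx (_ : (n == n.+1) = false) ?addr0; last by lia.
      apply: half => //; apply: le_trans vO _; rewrite kn eqxx (_ : (n == n.+1) = false) ?mulr1//; lia.
    have [kn1|kn1] := eqVneq k n.+1.
      rewrite /b kn1 eqxx (_ : (n.+1 == n) = false) ?add0r; last by lia.
      apply: half => //; apply: le_trans vO _; rewrite kn1 eqxx (_ : (n.+1 == n) = false) ?mulr1//; lia.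
    move: vO; rewrite (negbTE kn) (negbTE kn1) mulr0 => vO.
    have -> : v = 0 by apply/eqP; rewrite eq_le vO.
    by rewrite powR0 ?gt_eqF// mulr0 /b (negbTE kn) (negbTE kn1) addr0.
  by rewrite leye_eq.
rewrite (_ : 1%E = (1 `^ r^-1)%E); last by rewrite poweR_EFin powR1.
apply: gt0_ler_poweR.
- by rewrite invr_ge0 ltW.
- by rewrite in_itv/= leey andbT; apply: nneseries_ge0 => k _ _; exact: u0.
- by rewrite in_itv/= lee01 leey.
apply: lime_le; first by apply: is_cvg_nneseries => k _ _; exact: u0.
apply: nearW => N; apply: (@le_trans _ _ (\sum_(0 <= k < N) (b k)%:E)%E).
  by apply: lee_sum => k _; exact: ub.
rewrite sumEFin lee_fin big_split/= -!big_mkcond/= !big_nat1_eq.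
by case: ifP; case: ifP; lra.
Qed.

End spectral_block.

Section lower_bound.
Context {R : realType} (d : nat).
Let mu := @lebesgue_measure R.
Notation mun := (lebesgue_Rn R d).
Notation rn := (Rn R d).
Variables (alpha : R) (l : nat) (Omega : R -> R).
Hypotheses (hd : (0 < d)%N) (hO : Phi alpha l Omega).

Lemma conv_kerVP_1 s (x : R) : conv_kerVP s (cst 1) x = pi.
Proof.
have := conv_kerVP_cos s x 0; rewrite multVP1 ?normr0 ?exprn_ge0// mul0r cos0 !mulr1 => <-.
by apply: eq_Rintegral => u _; rewrite mul0r cos0.
Qed.

(** A function of one coordinate is a tensor product with constant factors elsewhere, and constants
    are reproduced because the kernel has mass pi. [m] is the eigenvalue of [g]. *)
Lemma sigR_coord s (K m : R) (g : R -> R) (i : 'I_d) : measurable_fun setT g ->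
  (forall y, `|g y| <= 1) -> (forall y, conv_kerVP s g y = pi * m * g y) ->
  sigR s (fun u : rn => K * g (coordRn u i)) = (fun x => m * (K * g (coordRn x i))).
Proof.
move=> mg g1 gE.
pose F (j : nat) : R -> R := if j == i :> nat then g else cst 1.
have FE (G : 'I_d -> R) c : (forall j, j != i -> G j = 1) -> G i = c -> \prod_(j < d) G j = c.
  by move=> G1 <-; rewrite (bigD1 i)//= big1 ?mulr1.
rewrite (_ : (fun u : rn => K * _) = (fun u : rn => K * \prod_(j < d) F j (coordRn u j))).
  apply/funext => x; rewrite sigR_tensor.
  - rewrite (FE _ (m * g (coordRn x i))); [by rewrite mulrCA|move=> j ji|].
      by rewrite /F (negbTE ji : (j == i :> nat) = false) conv_kerVP_1 mulVf// gt_eqF// pi_gt0.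
    by rewrite /F eqxx gE -mulrA mulKf// gt_eqF// pi_gt0.
  - by move=> j; rewrite /F; case: ifP.
  - by move=> j; exists 1 => y; rewrite /F; case: ifP => // _; rewrite normr1.
apply/funext => u; congr (_ * _); apply/esym/FE; last by rewrite /F eqxx.
by move=> j ji; rewrite /F (negbTE ji : (j == i :> nat) = false).
Qed.

Lemma ae_le_normLpy (f : rn -> R[i]) (c : R) : (forall x, c <= modf f x) ->
  (c%:E <= normLp +oo f)%E.
Proof.
move=> cf; have /(normLpyP f) : (normLp +oo f <= normLp +oo f)%E by [].
move=> [A [mA A0 hA]]; rewrite leNgt; apply/negP => Nc.
have : (mun setT <= mun A)%E.
  apply: le_measure; rewrite ?inE// => x _; apply: hA => /= H.
  have := lt_le_trans Nc (le_trans (_ : c%:E <= (modf f x)%:E)%E H).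
  by rewrite ltxx lee_fin => /(_ (cf x)).
by rewrite A0 leNgt lebesgue_Rn_setT_gt0.
Qed.

(** The complex exponential has constant modulus, so its norm, which is also the approximation
    error, can be read off directly. *)
Lemma lower_infty theta n : (1 <= theta)%E -> (0 < n)%N ->
  exists2 f : rn -> R[i], Bclass Omega +oo theta f &
    ((Omega (2 ^- n) / 2)%:E <= approxE +oo n f)%E.
Proof.
move=> t1 n0; pose i := Ordinal hd; set w := Omega (2 ^- n) / 2.
have w0 : 0 < w by rewrite divr_gt0// (Omega_gt0 hO).
pose c y : R := cos (2 ^+ n * y); pose sn y : R := sin (2 ^+ n * y).
pose f (x : rn) := Complex (w * c (coordRn x i)) (w * sn (coordRn x i)).
have mc : measurable_fun setT c by exact: measurable_cosM.
have ms : measurable_fun setT sn.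
  by apply: measurableT_comp; [exact: measurable_sin|exact: measurable_funM].
have polar (r u v : R) : 0 < r -> u ^+ 2 + v ^+ 2 = 1 ->
    Num.sqrt ((r * u) ^+ 2 + (r * v) ^+ 2) = r.
  by move=> r0 uv; rewrite !exprMn -mulrDr uv mulr1 sqrtr_sqr gtr0_norm.
have fw x : modf f x = w.
  by rewrite modf_pair; apply: polar => //; exact: cos2Dsin2.
have sE s x : sigmaVP s f x = Complex (multVP s (2 ^+ n) * (w * c (coordRn x i)))
    (multVP s (2 ^+ n) * (w * sn (coordRn x i))).
  rewrite sigmaVP_pair (@sigR_coord s w (multVP s (2 ^+ n)) c)//; last 2 first.
  - by move=> y; exact: cos_max.
  - by move=> y; exact: conv_kerVP_cos.
  rewrite (@sigR_coord s w (multVP s (2 ^+ n)) sn)//.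
  - by move=> y; exact: sin_max.
  - by move=> y; exact: conv_kerVP_sin.
(* [multVP n (2 ^+ n)] is already 1, so reproduction begins at s = n: q_{n+1}(f) vanishes and q_n(f)
   = f is the only block. *)
have high s : (n <= s)%N -> sigmaVP s f = f.
  move=> ns; apply/funext => x; rewrite sE multVP1 ?mul1r//.
  by rewrite ger0_norm ?exprn_ge0// ler_weXn2l// ler1n.
have low s : (s < n)%N -> sigmaVP s f = 0.
  move=> sl; apply/funext => x; rewrite sE multVP0 ?mul0r//.
  by rewrite ger0_norm ?exprn_ge0// ler_weXn2l// ler1n.
have fn : (normLp +oo f <= w%:E)%E.
  by apply/normLpyP; apply: aeW => x; rewrite fw.
have p1 : (1 <= +oo :> \bar R)%E by rewrite leey.
have high' s : (n < s)%N -> sigmaVP s f = f by move=> /ltnW; exact: high.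
exists f; last first.
  by rewrite (approxE_block +oo low n0); apply: ae_le_normLpy => x; rewrite fw.
split.
  split; last exact: le_lt_trans fn (ltry _).
  - apply: measurable_funM => //; apply: (measurableT_comp mc); exact: measurable_coordRn.
  - apply: measurable_funM => //; apply: (measurableT_comp ms); exact: measurable_coordRn.
apply: (normB_block hO p1 low high') => //; first by rewrite high.
by rewrite high// subrr normLp_0// lee_fin divr_ge0// ltW// (Omega_gt0 hO).
Qed.

Lemma normLp1_real (h : rn -> R) :
  normLp 1 (fun x => Complex (h x) 0) = (\int[mun]_x `|h x|%:E)%E.
Proof.
rewrite normLp1; apply: eq_integral => x _.
by rewrite modf_pair expr0n addr0 sqrtr_sqr.
Qed.

Lemma lower_one theta : (1 <= theta)%E -> exists2 k : R, 0 < k & forall n, (0 < n)%N ->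
  exists2 f : rn -> R[i], Bclass Omega 1 theta f & ((k * Omega (2 ^- n))%:E <= approxE 1 n f)%E.
Proof.
move=> t1; have [C1 C10 hC1] := Phi_dilation hO.
have D0 : 0 < 1 + C1 * 2 ^+ l by rewrite addr_gt0// mulr_gt0// exprn_gt0.
have T0 : 0 < 1 + 3 ^+ d :> R by rewrite addr_gt0// exprn_gt0.
(* The norm of q_{n+1}(f) = f - sigma_{2^n}(f) is at most (1 + 3^d) k Omega(2^-n), with 3^d from
   Young in each coordinate. It must not exceed Omega(2^-(n+1)) / 2, and C1 2^l is the loss between
   the two values of Omega. *)
pose k : R := (2 * (1 + 3 ^+ d) * (1 + C1 * 2 ^+ l))^-1.
have k0 : 0 < k by rewrite invr_gt0 !mulr_gt0.
exists k => // -[//|m] _; set n := m.+1.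
have On := Omega_gt0 hO n; have OSn := Omega_gt0 hO n.+1.
have Ole : Omega (2 ^- n) <= C1 * 2 ^+ l * Omega (2 ^- n.+1).
  have := hC1 2 (2 ^- n.+1); rewrite invr_ge0 exprn_ge0// => /(_ isT).
  by have -> : 2%:R * 2 ^- n.+1 = 2 ^- n :> R by rewrite exprS invfM mulrA mulfV// mul1r.
pose a : R := 2 ^+ m; pose lam : R := 3 * 2 ^+ m.
have a0 : 0 < a by rewrite exprn_gt0.
pose phi := wave a lam; pose N := \int[mu]_y `|phi y|.
have phii := integrable_wave a0 lam : mu.-integrable setT (EFin \o phi).
have [B B0 phiB] := wave_bound a lam.
have N0 : 0 < N.
  apply: lt_le_trans (@Rintegral_wave_norm_ge _ _ a0 lam _); first by rewrite divr_gt0// mulr_gt0// pi_gt0.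
  by rewrite /lam -/a; lra.
(* The tensor power has L_1 norm [N ^+ d], so [f] gets norm exactly [k * Omega (2 ^- n)]. *)
pose K := k * Omega (2 ^- n) / N ^+ d.
have K0 : 0 < K by rewrite divr_gt0 ?exprn_gt0// mulr_gt0.
pose h (x : rn) := K * \prod_(j < d) phi (coordRn x j).
pose f (x : rn) := Complex (h x) 0.
pose psi s y := pi^-1 * conv_kerVP s phi y.
have mphi : measurable_fun setT phi by exact: measurable_wave.
have sE s : sigR s h = (fun x => K * \prod_(j < d) psi s (coordRn x j)).
  apply/funext => x; apply: (@sigR_tensor _ _ s K (fun=> phi)) => //.
  by move=> _; exists B.
have FE s : sigmaVP s f = (fun x => Complex (sigR s h x) 0).
  by rewrite sigmaVP_pair sigR_0.
have psi_low s y : (s < n)%N -> psi s y = 0.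
  move=> sn; rewrite /psi /conv_kerVP (@conv_kerVP_wave _ a lam s y 0) ?mulr0 ?mul0r ?mulr0//.
  move=> xi x0 xa.
  have sa : 2 ^+ s.+1 <= 2 * a by rewrite /a -exprS ler_weXn2l// ler1n.
  by split; apply: multVP0; rewrite ger0_norm /lam -/a; lra.
have psi_high s y : (n < s)%N -> psi s y = phi y.
  move=> ns; rewrite /psi /conv_kerVP (@conv_kerVP_wave _ a lam s y 1).
    by rewrite mulr1 mulKf// gt_eqF// pi_gt0.
  move=> xi x0 xa.
  have sa : 2 * (2 * a) <= 2 ^+ s by rewrite /a -!exprS ler_weXn2l// ler1n.
  by split; apply: multVP1; rewrite ger0_norm /lam -/a; lra.
have low s : (s < n)%N -> sigmaVP s f = 0.
  move=> sn; rewrite FE; apply/funext => x; rewrite sE.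
  (* One vanishing factor annihilates the product, and d > 0 provides one. *)
  by rewrite (bigD1 (Ordinal hd))//= psi_low// mul0r mulr0.
have high s : (n < s)%N -> sigmaVP s f = f.
  move=> ns; rewrite FE /f; apply/funext => x; rewrite sE; congr (Complex (_ * _) _).
  by apply: eq_bigr => j _; exact: psi_high.
have psii s : mu.-integrable setT (EFin \o psi s).
  by apply: RintegrableZl; exact: (integrable_conv_kerVP s phii phiB).
have psiN s : \int[mu]_y `|psi s y| <= 3 * N.
  rewrite (_ : Rintegral _ _ _ = \int[mu]_y (pi^-1 * `|conv_kerVP s phi y|)).
    rewrite RintegralZl//; last exact: integrable_norm (integrable_conv_kerVP s phii phiB).
    rewrite ler_pdivrMl ?pi_gt0// mulrA (mulrC pi).
    exact: (Rintegral_norm_conv_kerVP s phii phiB).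
  by apply: eq_Rintegral => y _; rewrite normrM gtr0_norm// invr_gt0 pi_gt0.
have hI (g : R -> R) : mu.-integrable setT (EFin \o g) ->
    mun.-integrable setT (EFin \o (fun x : rn => K * \prod_(j < d) g (coordRn x j))) /\
    (\int[mun]_x `|K * \prod_(j < d) g (coordRn x j)|%:E = (K * (\int[mu]_y `|g y|) ^+ d)%:E)%E.
  move=> gi; have ti := integrable_tensor d (F := fun=> g) (fun=> gi).
  split; first exact: RintegrableZl.
  have tn := integrable_norm ti.
  rewrite (_ : (fun x : rn => _) = EFin \o (fun x : rn => K * `|\prod_(j < d) g (coordRn x j)|)).
    rewrite EFin_Rintegral; last exact: RintegrableZl.
    rewrite RintegralZl// (Rintegral_tensor_norm d (F := fun=> g) (fun=> gi)).
    by rewrite prodr_const card_ord.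
  by apply/funext => x /=; rewrite normrM gtr0_norm.
have KN : K * N ^+ d = k * Omega (2 ^- n) by rewrite /K divfK// gt_eqF// exprn_gt0.
have fN : normLp 1 f = (k * Omega (2 ^- n))%:E by rewrite normLp1_real (hI _ phii).2 KN.
have sN : (\int[mun]_x `|sigR n h x|%:E <= (3 ^+ d * (k * Omega (2 ^- n)))%:E)%E.
  rewrite sE (hI _ (psii n)).2 lee_fin -KN mulrCA -exprMn ler_wpM2l ?(ltW K0)//.
  by rewrite lerXn2r// nnegrE ?Rintegral_ge0// mulr_ge0// ltW.
have [hi _] := hI _ phii; have [si _] := hI _ (psii n).
have mh := Rintegrable_measurable hi; have msi := Rintegrable_measurable si.
have kle : (1 + 3 ^+ d) * (k * Omega (2 ^- n)) <= Omega (2 ^- n.+1) / 2.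
  have -> : (1 + 3 ^+ d) * (k * Omega (2 ^- n)) = (2 * (1 + C1 * 2 ^+ l))^-1 * Omega (2 ^- n).
    by rewrite /k; field; rewrite !gt_eqF.
  rewrite ler_pdivrMl ?mulr_gt0//.
  rewrite (_ : _ * (_ / 2) = Omega (2 ^- n.+1) + C1 * 2 ^+ l * Omega (2 ^- n.+1)); last by field.
  by apply: (le_trans Ole); rewrite lerDr ltW.
have kle' : 3 ^+ d * (k * Omega (2 ^- n)) <= Omega (2 ^- n) / 2.
  apply: (@le_trans _ _ ((1 + 3 ^+ d) * (k * Omega (2 ^- n)))).
    by rewrite ler_wpM2r ?lerDr// ltW// mulr_gt0.
  apply: (le_trans kle); rewrite ler_wpM2r ?invr_ge0//.
  apply: (Phi_nondecreasing hO); first by rewrite invr_ge0 exprn_ge0.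
  by rewrite lef_pV2 ?posrE ?exprn_gt0// ler_weXn2l// ler1n.
have p1 : (1 <= 1 :> \bar R)%E by [].
exists f; last by rewrite (approxE_block 1%E low)// fN.
split; first by split => //; rewrite fN ltry.
apply: (normB_block hO p1 low high) => //.
  by rewrite FE normLp1_real (le_trans sN).
rewrite (_ : f - sigmaVP n f = (fun x => Complex (h x - sigR n h x) 0)); last first.
  by rewrite FE; apply/funext => x; apply/eqP; rewrite eq_complex/= subr0 !eqxx.
rewrite normLp1_real; apply: (@le_trans _ _ (\int[mun]_x (`|h x|%:E + `|sigR n h x|%:E))%E).
  apply: ge0_le_integral => //.
  - apply/measurable_EFinP; apply: measurableT_comp => //; apply: measurable_funB => //.
    by rewrite sE.
  - apply: emeasurable_funD; apply/measurable_EFinP; apply: measurableT_comp => //.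
    by rewrite sE.
  - by move=> x _; rewrite -EFinD lee_fin ler_normB.
rewrite ge0_integralD//; first last.
- by apply/measurable_EFinP; apply: measurableT_comp => //; rewrite sE.
- by apply/measurable_EFinP; apply: measurableT_comp.
rewrite -normLp1_real fN; apply: (le_trans (leeD2l _ sN)); rewrite -EFinD lee_fin.
by apply: le_trans kle; rewrite mulrDl mul1r.
Qed.

End lower_bound.

Theorem mainTheorem3 (R : realType) (d l : nat) (alpha : R) (Omega : R -> R)
    (theta p q : \bar R)
    (hd : (0 < d)%N) (hl : (0 < l)%N) (halpha : 0 < alpha)
    (hOmega : Phi alpha l Omega) (htheta : (1 <= theta)%E)
    (hpq : (p = 1%E /\ q = 1%E) \/ (p = +oo%E /\ q = +oo%E)) :
  exists c C : R, [/\ 0 < c, 0 < C &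
    forall n : nat, (0 < n)%N ->
      ((c * Omega (2 ^- n))%:E
         <= approxE_class q n (@Bclass R d Omega p theta))%E /\
      (approxE_class q n (@Bclass R d Omega p theta)
         <= (C * Omega (2 ^- n))%:E)%E].
Proof.
have hp : p = 1%E \/ p = +oo%E by case: hpq => -[-> _]; [left|right].
have -> : q = p by case: hpq => -[-> ->].
have [C C0 hC] := approxE_class_le d halpha hOmega hp htheta.
have [c c0 hc] : exists2 c : R, 0 < c & forall n, (0 < n)%N ->
    exists2 f : Rn R d -> R[i], Bclass Omega p theta f &
      ((c * Omega (2 ^- n))%:E <= approxE p n f)%E.
  case: hp => ->; first exact: (lower_one hd hOmega htheta).
  exists 2^-1 => // n n0; have [f fB fE] := lower_infty hd hOmega htheta n0.
  by exists f => //; rewrite mulrC.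
exists c, C; split => // n n0; split; last exact: hC.
have [f fB fE] := hc n n0; apply: (le_trans fE).
by apply: ereal_sup_ubound; exists f.
Qed.
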